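(* (1) In case $6\mathrm I$: for every rational number $r$ in the transition cusp $[\tau_{6\mathrm I}^\infty]=[\frac13]$ of $\Gamma_1(6)$, the limit $Q^\ell_r$ is a root of unity. (2) In case $6\mathrm{II}$: for every rational number $r=\frac ac$ in the transition cusp $[\tau^\infty_{6\mathrm{II}}]=[\frac12]$ of $\Gamma_1(6)$, written with $\gcd(a,c)=1$ and $c\equiv2\pmod 6$, one has $$Q_r^\ell=\omega\cdot e^{-c\,\mathrm L'(-1,\chi_{3,2})}$$ for some root of unity $\omega$. In particular, $Q_r^\ell$ is not a root of unity.
   Context: A Type II extremal transition $Y\searrow X$ consists of smooth projective complex threefolds, a crepant contraction $\phi:Y\to\bar Y$ of an extremal ray (relative Picard number 1) contracting a divisor $E$ to a point, followed by a smoothing of $\bar Y$ to $X$. When its degree $E^3$ is $6$ there are two cases: $6\mathrm I$ if $\chi_{\rm top}(Y)-\chi_{\rm top}(X)=6$ and $6\mathrm{II}$ if it is $4$. $\ell$ is the class in the contracted ray with $(E,\ell)=-1$. With $P=P^\ell$, $\theta=P\frac d{dP}$, $(\kappa,\lambda,\mu)=(7,2,8)$ in case $6\mathrm I$ and $(10,3,-9)$ in case $6\mathrm{II}$, $u=1+\kappa P-\mu P^2$, let $f\in1+P\,\mathbb C[[P]]$ solve $u\,\theta^2f+(\kappa P-2\mu P^2)\theta f+(\lambda P-\mu P^2)f=0$ and let $g\in P\,\mathbb C[[P]]$ satisfy $1+\theta g=f$; the quantum variable is $Q^\ell=P^\ell e^{g(P^\ell)}$. Define $q=e^{2\pi\mathtt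 i\tau}$ by $\frac{d\log Q^\ell}{d\log q}=\mathrm E_6:=uf^3$, $q=-Q^\ell+O((Q^\ell)^2)$. In both cases, as a function of $\tau\in\mathbb H$, $$\mathrm E_6(\tau)=1-\sum_{m\ge1}\chi_{3,2}(m)m^2\frac{q^m}{1-q^m}-8\sum_{m\ge1}\chi_{3,2}(m)m^2\frac{q^{2m}}{1-q^{2m}},$$ a weight $3$ modular form on $\Gamma_1(6)$, where $\chi_{3,2}=\left(\frac{-3}\cdot\right)$ is the nontrivial Dirichlet character mod $3$ and $\mathrm L(s,\chi_{3,2})$ is its Dirichlet $\mathrm L$-function. $P^\ell$ is a Hauptmodul identifying $\mathbb P^1$ with $\Gamma_1(6)\backslash\mathbb H^*$, with $P^\ell=0$ at $[\mathtt i\infty]$ and $P^\ell=\infty$ at the transition cusp, which is $[\frac13]$ in case $6\mathrm I$ and $[\frac12]$ in case $6\mathrm{II}$. A path from $P^\ell=0$ to $P^\ell=\infty$ lifts to a path from $\mathtt i\infty$ to a rational $r$ in the transition cusp, and the limit of $Q^\ell$ along it depends only on $r$ and equals $$Q_r^\ell=-e^{2\pi\mathtt ir}\exp\Bigl(\int_{\mathtt i\infty}^r(\mathrm E_6(\tau)-1)\,d(2\pi\mathtt i\tau)\Bigr).$$ (The denominator $c$ may be negative, chosen so that $c\equiv2\pmod6$.) *)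

(* Defs.v *)
From Stdlib Require Export QArith Qreals ZArith Reals.
From Coquelicot Require Export Coquelicot.

Open Scope R_scope.

(** Stdlib reals and Coquelicot's complex numbers [C].  A derivative of a
    function [C -> C] is always the complex one ([C_AbsRing]). *)

Definition Cexp (z : C) : C := (exp (Re z) * cos (Im z), exp (Re z) * sin (Im z)).

(** Sum of a complex series; meaningful only when the series converges. *)
Definition CSeries (a : nat -> C) : C :=
  (Series (fun n => Re (a n)), Series (fun n => Im (a n))).

Definition CPSeries (a : nat -> C) (z : C) : C :=
  CSeries (fun n => (a n * z ^ n)%C).

Definition root_of_unity (z : C) : Prop :=
  exists n : nat, (0 < n)%nat /\ (z ^ n)%C = 1.

(** The Kronecker symbol [(-3/n)], the nontrivial character mod 3. *)
Definition chi32 (n : nat) : R :=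
  match (n mod 3)%nat with
  | 1%nat => 1
  | 2%nat => - 1
  | _ => 0
  end.

(** [L] is the Dirichlet L-function of [chi]: an entire function given by the
    Dirichlet series on [Re s > 1] (so that [L] is unique).  The series is
    indexed from [0], its [n]-th term being [chi (n+1) (n+1)^(-s)]. *)
Definition is_entire_Dirichlet_L (chi : nat -> R) (L : C -> C) : Prop :=
  (forall s : C, ex_derive L s) /\
  (forall s : C, 1 < Re s ->
     is_series (fun n : nat => (chi (S n) * Cexp (- s * ln (INR (S n))))%C) (L s)).

(** [nome tau] is [q = exp(2 pi i tau)]. *)
Definition nome (tau : C) : C := Cexp (2 * PI * Ci * tau)%C.

(** The index [n] below stands for [m = n+1]. *)
Definition E6 (tau : C) : C :=
  let q := nome tau in
  (1 - CSeries (fun n => chi32 (S n) * (INR (S n)) ^ 2 *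
                         (q ^ S n / (1 - q ^ S n)))
     - 8 * CSeries (fun n => chi32 (S n) * (INR (S n)) ^ 2 *
                             (q ^ (2 * S n) / (1 - q ^ (2 * S n)))))%C.

Definition Gamma1_6 (a b c d : Z) : Prop :=
  (a * d - b * c = 1 /\ a mod 6 = 1 /\ d mod 6 = 1 /\ c mod 6 = 0)%Z.

(** [r] lies in the [Gamma1(6)]-orbit of the real number [r0]. *)
Definition same_cusp (r0 r : R) : Prop :=
  exists a b c d : Z, Gamma1_6 a b c d /\
    IZR c * r0 + IZR d <> 0 /\
    r = (IZR a * r0 + IZR b) / (IZR c * r0 + IZR d).

Definition same_orbit (tau tau' : C) : Prop :=
  exists a b c d : Z, Gamma1_6 a b c d /\
    tau' = ((IZR a * tau + IZR b) / (IZR c * tau + IZR d))%C.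

Inductive case6 := case6I | case6II.

Definition kappa (k : case6) : R := match k with case6I => 7 | case6II => 10 end.
Definition lambda (k : case6) : R := match k with case6I => 2 | case6II => 3 end.
Definition mu (k : case6) : R := match k with case6I => 8 | case6II => - 9 end.

Definition transition_cusp (k : case6) : R :=
  match k with case6I => 1 / 3 | case6II => 1 / 2 end.

Definition u (k : case6) (p : C) : C := (1 + kappa k * p - mu k * p ^ 2)%C.

(** Formal power series in [P] are coefficient sequences; [theta = P d/dP]
    multiplies the [n]-th coefficient by [n], and [PS_incr_1] multiplies a
    series by [P]. *)
Definition theta (a : nat -> C) (n : nat) : C := (INR n * a n)%C.

Definition is_period (k : case6) (f : nat -> C) : Prop :=
  f 0%nat = 1 /\
  let t1 := theta f in
  let t2 := theta (theta f) in
  let sh := PS_incr_1 (V := C_NormedModule) in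
  forall n : nat,
    (  (t2 n + kappa k * sh t2 n - mu k * sh (sh t2) n)
     + (kappa k * sh t1 n - 2 * mu k * sh (sh t1) n)
     + (lambda k * sh f n - mu k * sh (sh f) n))%C = 0.

Definition is_mirror_series (f g : nat -> C) : Prop :=
  g 0%nat = 0 /\
  forall n : nat, ((if Nat.eqb n 0 then 1 else 0) + theta g n)%C = f n.

(** [P] is a Hauptmodul of [Gamma1(6)], vanishing at the cusp at infinity and
    with its pole at the cusp of the real number [r0]. *)
Record is_Hauptmodul (r0 : R) (P : C -> C) : Prop := {
  Hauptmodul_holomorphic : forall tau : C, 0 < Im tau -> ex_derive P tau;
  Hauptmodul_orbits : forall tau tau' : C, 0 < Im tau -> 0 < Im tau' ->
    (P tau = P tau' <-> same_orbit tau tau');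
  Hauptmodul_zero : forall eps : R, 0 < eps ->
    exists M : R, forall tau : C, M < Im tau -> Cmod (P tau) < eps;
  Hauptmodul_pole : forall r : R, same_cusp r0 r ->
    filterlim (fun t : R => Cmod (P (r, t))) (at_right 0) (Rbar_locally p_infty)
}.

(** [P] and [Ql] are the variables [P^l] and [Q^l] of a transition of the case
    [k], as functions of [tau] in the upper half plane.  The power series [f]
    and [g] only converge near [P = 0], hence the equations that evaluate them
    are stated for [Im tau] large; [Ql] is continued to the whole upper half
    plane by [d log Ql / d log q = E6]. *)
Record is_quantum_variable (k : case6) (f g : nat -> C) (P Ql : C -> C) : Prop := {
  qv_period : is_period k f;
  qv_mirror_series : is_mirror_series f g;
  qv_Hauptmodul : is_Hauptmodul (transition_cusp k) P;
  qv_mirror_map : exists M : R, 0 < M /\ forall tau : C, M < Im tau ->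
    Ql tau = (P tau * Cexp (CPSeries g (P tau)))%C;
  qv_E6 : exists M : R, 0 < M /\ forall tau : C, M < Im tau ->
    E6 tau = (u k (P tau) * CPSeries f (P tau) ^ 3)%C;
  qv_derive : forall tau : C, 0 < Im tau ->
    is_derive Ql tau (2 * PI * Ci * E6 tau * Ql tau)%C;
  qv_leading : exists M K : R, 0 < M /\ forall tau : C, M < Im tau ->
    Cmod (nome tau + Ql tau) <= K * Cmod (Ql tau) ^ 2
}.

(** [Qr] is the limit of [Ql] along the vertical half-line from [i oo] down
    to [r]. *)
Definition is_transition_limit (Ql : C -> C) (r : R) (Qr : C) : Prop :=
  filterlim (fun t : R => Ql (r, t)) (at_right 0) (locally Qr).

(* Main.v *)
(** Along the vertical line [tau = r + i t] the equation [d log Ql = E6 d log q]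
    integrates to [Ql = - q * prod_m (1 - q^m)^(m beta(m))], where [beta] is the
    odd function of period 6 with values [1, 1, 0, -1, -1, 0] obtained by merging
    the two Lambert series of [E6].  For [r = a / N] in lowest terms, split the
    logarithm of the product according to [m mod N].  When [N mod 6] is 2, 3 or 4,
    [beta] has mean zero on each class, so three summations by parts make the sum
    over the class absolutely convergent, uniformly as [t -> 0] by scale
    invariance of [y log (1 - exp (i th - y))].  A class [rho <> 0] tends to
    [log (1 - exp (2 pi i rho r))] times a rational number: the real parts cancel
    between [rho] and [N - rho], and the imaginary parts are rational multiples of
    [pi].  The class of [0] tends to [+- N] times the regularised sum of
    [chi(m) m ln m], that is [-+ N L'(-1)], or is identically zero if [3] divides
    [N].  The same summation by parts, repeated as often as needed, continues
    [L(s)] to the whole plane. *)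

Require Import Defs.
From Stdlib Require Import QArith Qreals ZArith Reals Lra Lia.
From Coquelicot Require Import Coquelicot.
Open Scope R_scope.

(** * Summation by parts against periodic weights *)

(** The obstacle is that the logarithm of the product has no termwise majorant uniform in [t]: the
    bound used at fixed [t] blows up like [t^(-4)]. With [F y = y log (1 - exp (i th - y))] and
    [y = m x], the terms of a class are [F (m x) / x] on a grid of step [N x]. A difference of order
    [k] costs [(N x)^k F^(k) / x], and near [0] the derivatives of [F] are at worst like [ln y],
    [1 / y], [1 / y^2]. Order 2 leaves the majorant [1 / m], which is not summable; order 3 leaves
    [1 / m^2], with every power of [x] cancelled.

    The value of a regularised sum does not depend on its order, provided the differences involved
    tend to [0]. This allows the limit of the class of [0], found at order 3, to be compared with
    the derivative of the L-function, found at order 7, and the L-function itself with its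
    convergent series, of order 0.

    That [L'(-1)] is not zero comes from the constant sign of the third differences of [m ln m],
    which reduces the matter to [3 < 4]; the functional equation is not invoked. *)

Fixpoint psum (h : nat -> R) (n : nat) : R :=
  match n with O => 0 | S n => psum h n + h n end.

Lemma psum_S h n : psum h (S n) = psum h n + h n.
Proof. reflexivity. Qed.

Lemma sum_n_psum (h : nat -> R) n : sum_n h n = psum h (S n).
Proof.
  induction n as [|n IH].
  - rewrite sum_O; simpl; lra.
  - rewrite sum_Sn, IH; reflexivity.
Qed.

Lemma psum_ext h k n : (forall i, (i < n)%nat -> h i = k i) -> psum h n = psum k n.
Proof.
  induction n as [|n IH]; intros E; simpl; [reflexivity|].
  rewrite IH, E; auto.
Qed.

Lemma is_series_psum (a : nat -> R) (l : R) :
  is_series a l <-> is_lim_seq (psum a) l.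
Proof.
  rewrite (is_lim_seq_incr_1 (psum a)); unfold is_series.
  split; apply filterlim_ext; intros n; rewrite sum_n_psum; reflexivity.
Qed.

Definition mean6 (h : nat -> R) : R :=
  (psum h 0 + psum h 1 + psum h 2 + psum h 3 + psum h 4 + psum h 5) / 6.

(** The antidifference of [h] whose mean over a period is zero. *)
Definition antidiff (h : nat -> R) (n : nat) : R := psum h n - mean6 h.

(** Abel summation pairs the difference of [f] at [n] with the antidifference at [n + 1], so this
    shifted sequence is the weight of the next round. *)
Definition antidiff_shift (h : nat -> R) (n : nat) : R := antidiff h (S n).

Definition balanced (h : nat -> R) : Prop :=
  (forall n, h (n + 6)%nat = h n) /\ psum h 6 = 0.

Lemma psum_periodic h n : balanced h -> psum h (n + 6) = psum h n.
Proof.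
  intros [P Z]; induction n as [|n IH]; [exact Z|].
  change (psum h (n + 6) + h (n + 6)%nat = psum h n + h n); rewrite IH, P; reflexivity.
Qed.

(** A zero sum makes the partial sums periodic, and subtracting their mean makes the sum over a
    period vanish again. The class of weights is thus stable, and summation by parts can be
    iterated. *)
Lemma balanced_antidiff_shift h : balanced h -> balanced (antidiff_shift h).
Proof.
  intros B; split.
  - intros n; unfold antidiff_shift, antidiff.
    change (S (n + 6)) with (S n + 6)%nat; rewrite psum_periodic by assumption; reflexivity.
  - destruct B as [_ Z]; unfold antidiff_shift, antidiff, mean6; simpl in *; lra.
Qed.

Lemma balanced_bounded h : balanced h -> exists B, 0 <= B /\ forall n, Rabs (h n) <= B.
Proof.
  intros [P _].
  exists (Rabs (h 0%nat) + Rabs (h 1%nat) + Rabs (h 2%nat) + Rabs (h 3%nat)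
          + Rabs (h 4%nat) + Rabs (h 5%nat)).
  pose proof (Rabs_pos (h 0%nat)); pose proof (Rabs_pos (h 1%nat));
  pose proof (Rabs_pos (h 2%nat)); pose proof (Rabs_pos (h 3%nat));
  pose proof (Rabs_pos (h 4%nat)); pose proof (Rabs_pos (h 5%nat)).
  split; [lra|]; intros n; induction n as [n IH] using lt_wf_ind.
  destruct (le_lt_dec 6 n) as [L|L].
  - replace n with ((n - 6) + 6)%nat by lia; rewrite P; apply IH; lia.
  - do 6 (destruct n as [|n]; [lra|]); lia.
Qed.

(** * Sums regularised by iterated summation by parts *)

Definition fdiff (f : nat -> R) (n : nat) : R := f (S n) - f n.

Fixpoint fdiffn (K : nat) (f : nat -> R) : nat -> R :=
  match K with O => f | S K => fdiffn K (fdiff f) end.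

(** [is_RS K h phi l]: the sum of [h n * phi n], regularised by [K] summations
    by parts, is [l]. *)
Fixpoint is_RS (K : nat) (h phi : nat -> R) (l : R) : Prop :=
  match K with
  | O => is_series (fun n => h n * phi n) l
  | S K => is_RS K (antidiff_shift h) (fdiff phi) (- antidiff h 0 * phi 0%nat - l)
  end.

Lemma fdiff_ext f g : (forall n, f n = g n) -> forall n, fdiff f n = fdiff g n.
Proof. intros E n; unfold fdiff; rewrite !E; reflexivity. Qed.

Lemma fdiffn_ext K f g : (forall n, f n = g n) -> forall n, fdiffn K f n = fdiffn K g n.
Proof.
  revert f g; induction K as [|K IH]; intros f g E; simpl; [exact E|].
  apply IH, fdiff_ext, E.
Qed.

Lemma fdiffn_lin K a b f g n :
  fdiffn K (fun n => a * f n + b * g n) n = a * fdiffn K f n + b * fdiffn K g n.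
Proof.
  revert f g; induction K as [|K IH]; intros f g; simpl; [reflexivity|].
  rewrite <- IH; apply fdiffn_ext; intros m; unfold fdiff; ring.
Qed.

Lemma fdiffn_S K f n : fdiffn (S K) f n = fdiffn K f (S n) - fdiffn K f n.
Proof.
  revert f; induction K as [|K IH]; intros f; [reflexivity|].
  change (fdiffn (S K) (fdiff f) n = fdiffn K (fdiff f) (S n) - fdiffn K (fdiff f) n).
  apply IH.
Qed.

Lemma is_RS_ext K h f g l : (forall n, f n = g n) -> is_RS K h f l -> is_RS K h g l.
Proof.
  revert h f g l; induction K as [|K IH]; intros h f g l E; simpl.
  - apply is_series_ext; intros n; rewrite E; reflexivity.
  - rewrite <- (E 0%nat); apply IH, fdiff_ext, E.
Qed.

Lemma is_RS_lin K h f g l m a b :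
  is_RS K h f l -> is_RS K h g m ->
  is_RS K h (fun n => a * f n + b * g n) (a * l + b * m).
Proof.
  revert h f g l m; induction K as [|K IH]; intros h f g l m Hf Hg; simpl in *.
  - apply is_series_ext with (fun n => plus (scal a (h n * f n)) (scal b (h n * g n))).
    { intros n; unfold plus, scal; simpl; unfold mult; simpl; ring. }
    apply (is_series_plus (fun n => scal a (h n * f n)) (fun n => scal b (h n * g n)));
      apply (is_series_scal (V := R_NormedModule)); assumption.
  - pose proof (IH _ _ _ _ _ Hf Hg) as H.
    eapply is_RS_ext with (g := fdiff (fun n => a * f n + b * g n)) in H.
    2: { intros n; unfold fdiff; ring. }
    match type of H with is_RS _ _ _ ?x => replace (_ - _) with x by ring end.
    exact H.
Qed.

Lemma is_RS_unique K h f l m : is_RS K h f l -> is_RS K h f m -> l = m.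
Proof.
  revert h f l m; induction K as [|K IH]; intros h f l m Hl Hm; simpl in *.
  - rewrite <- (is_series_unique _ _ Hl); apply is_series_unique; assumption.
  - pose proof (IH _ _ _ _ Hl Hm); lra.
Qed.

Lemma summation_by_parts h f n :
  psum (fun i => h i * f i) n =
  antidiff h n * f n - antidiff h 0 * f 0%nat
  - psum (fun i => antidiff_shift h i * fdiff f i) n.
Proof.
  induction n as [|n IH]; simpl; [ring|].
  rewrite IH; unfold antidiff_shift, antidiff, fdiff; rewrite psum_S; ring.
Qed.

Lemma is_lim_seq_mul_bounded (a f : nat -> R) B :
  (forall n, Rabs (a n) <= B) -> is_lim_seq f 0 -> is_lim_seq (fun n => a n * f n) 0.
Proof.
  intros HB Hf; apply is_lim_seq_abs_0.
  apply is_lim_seq_le_le with (fun _ => 0) (fun n => B * Rabs (f n)).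
  - intros n; split; [apply Rabs_pos|rewrite Rabs_mult].
    apply Rmult_le_compat_r; [apply Rabs_pos|apply HB].
  - apply is_lim_seq_const.
  - replace (Finite 0) with (Rbar_mult B 0) by (simpl; f_equal; ring).
    apply (is_lim_seq_scal_l (fun n => Rabs (f n)) B 0).
    apply is_lim_seq_abs_0 in Hf; exact Hf.
Qed.

Lemma antidiff_bounded h : balanced h -> exists B, forall n, Rabs (antidiff h n) <= B.
Proof.
  intros Bh; destruct (balanced_bounded _ (balanced_antidiff_shift h Bh)) as [B [_ HB]].
  exists B; intros n.
  replace (antidiff h n) with (antidiff_shift h (n + 5)); [apply HB|].
  unfold antidiff_shift, antidiff; replace (S (n + 5)) with (n + 6)%nat by lia.
  rewrite psum_periodic by assumption; reflexivity.
Qed.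

Lemma is_series_by_parts h f l :
  balanced h -> is_lim_seq f 0 ->
  (is_series (fun n => h n * f n) l <->
   is_series (fun n => antidiff_shift h n * fdiff f n) (- antidiff h 0 * f 0%nat - l)).
Proof.
  intros Bh Hf; rewrite !is_series_psum.
  destruct (antidiff_bounded h Bh) as [B HB].
  pose proof (is_lim_seq_mul_bounded _ _ _ HB Hf) as H0.
  split; intros H.
  - apply is_lim_seq_ext with (fun n =>
      (antidiff h n * f n - antidiff h 0 * f 0%nat) - psum (fun i => h i * f i) n).
    { intros n; rewrite (summation_by_parts h f n); ring. }
    replace (- antidiff h 0 * f 0%nat - l) with (0 - antidiff h 0 * f 0%nat - l) by ring.
    apply is_lim_seq_minus'; [|exact H].
    apply is_lim_seq_minus'; [exact H0|apply is_lim_seq_const].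
  - apply is_lim_seq_ext with (fun n =>
      (antidiff h n * f n - antidiff h 0 * f 0%nat)
      - psum (fun i => antidiff_shift h i * fdiff f i) n).
    { intros n; rewrite (summation_by_parts h f n); ring. }
    replace l with ((0 - antidiff h 0 * f 0%nat) - (- antidiff h 0 * f 0%nat - l)) by ring.
    apply is_lim_seq_minus'; [|exact H].
    apply is_lim_seq_minus'; [exact H0|apply is_lim_seq_const].
Qed.

(** Only the difference of order [K] has to vanish at infinity, which kills the boundary term; [f]
    itself may grow, as [m ln m] does. *)
Lemma is_RS_succ K h f l :
  balanced h -> is_lim_seq (fdiffn K f) 0 -> (is_RS K h f l <-> is_RS (S K) h f l).
Proof.
  revert h f l; induction K as [|K IH]; intros h f l Bh Hf.
  - apply (is_series_by_parts h f l Bh Hf).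
  - apply (IH (antidiff_shift h) (fdiff f)); [apply balanced_antidiff_shift, Bh|exact Hf].
Qed.

Lemma is_lim_seq_fdiff f : is_lim_seq f 0 -> is_lim_seq (fdiff f) 0.
Proof.
  intros H; replace (Finite 0) with (Finite (0 - 0)) by (f_equal; ring).
  apply is_lim_seq_minus'; [apply is_lim_seq_incr_1 in H|]; exact H.
Qed.

Lemma is_lim_seq_fdiffn K f : is_lim_seq f 0 -> is_lim_seq (fdiffn K f) 0.
Proof.
  revert f; induction K as [|K IH]; intros f H; simpl; [exact H|].
  apply IH, is_lim_seq_fdiff, H.
Qed.

Lemma is_RS_add K J h f l :
  balanced h -> is_lim_seq (fdiffn K f) 0 -> (is_RS K h f l <-> is_RS (J + K) h f l).
Proof.
  intros Bh Hf; induction J as [|J IH]; [reflexivity|].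
  rewrite IH; apply is_RS_succ; [exact Bh|].
  clear - Hf; induction J as [|J IH]; [exact Hf|].
  apply is_lim_seq_ext with (fdiff (fdiffn (J + K) f)).
  - intros n; symmetry; apply fdiffn_S.
  - apply is_lim_seq_fdiff, IH.
Qed.

Lemma ex_series_mul_bounded (h f M : nat -> R) :
  balanced h -> (forall n, Rabs (f n) <= M n) -> ex_series M ->
  ex_series (fun n => h n * f n).
Proof.
  intros Bh Hf HM; destruct (balanced_bounded h Bh) as [B [B0 HB]].
  apply (ex_series_le (V := R_CompleteNormedModule)) with (fun n => B * M n).
  - intros n; change (norm (h n * f n)) with (Rabs (h n * f n)); rewrite Rabs_mult.
    apply Rmult_le_compat; auto using Rabs_pos.
  - apply (ex_series_scal_l (V := R_NormedModule) B M HM).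
Qed.

Lemma ex_RS K h f M :
  balanced h -> (forall n, Rabs (fdiffn K f n) <= M n) -> ex_series M ->
  exists l, is_RS K h f l.
Proof.
  revert h f; induction K as [|K IH]; intros h f Bh Hf HM; simpl in *.
  - eexists; apply Series_correct, ex_series_mul_bounded with M; assumption.
  - destruct (IH (antidiff_shift h) (fdiff f)) as [l Hl]; auto using balanced_antidiff_shift.
    exists (- antidiff h 0 * f 0%nat - l).
    replace (_ - _) with l by ring; exact Hl.
Qed.

(** * Dominated convergence for series and for regularised sums *)

Lemma Series_tail_small M eps :
  ex_series M -> 0 < eps -> exists n, Rabs (Series (fun k => M (S n + k)%nat)) < eps.
Proof.
  intros HM He; pose proof (Series_correct _ HM) as H.
  apply (is_lim_seq_spec (sum_n M) (Series M)) in H.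
  destruct (H (mkposreal _ He)) as [N HN]; exists N.
  specialize (HN N (le_n _)); simpl in HN.
  rewrite (Series_incr_n M (S N)) in HN by (lia || assumption).
  rewrite sum_n_Reals in HN; simpl pred in HN.
  replace (sum_f_R0 M N - _) with (- Series (fun k => M (S N + k)%nat)) in HN by ring.
  rewrite Rabs_Ropp in HN; exact HN.
Qed.

Lemma Series_abs_le (a M : nat -> R) :
  (forall n, Rabs (a n) <= M n) -> ex_series M -> Rabs (Series a) <= Series M.
Proof.
  intros Ha HM.
  assert (E : ex_series (fun n => Rabs (a n))).
  { apply (ex_series_le (V := R_CompleteNormedModule)) with M; [|exact HM].
    intros n; change (Rabs (Rabs (a n)) <= M n); rewrite Rabs_Rabsolu; apply Ha. }
  eapply Rle_trans; [apply Series_Rabs, E|].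
  apply Series_le; [|exact HM]; intros n; split; [apply Rabs_pos|apply Ha].
Qed.

Lemma ex_series_dominated (a M : nat -> R) :
  (forall n, Rabs (a n) <= M n) -> ex_series M -> ex_series a.
Proof. apply (ex_series_le (V := R_CompleteNormedModule)). Qed.

Lemma filterlim_psum {T} (F : (T -> Prop) -> Prop) {FF : Filter F} (a : T -> nat -> R) b n :
  (forall k, filterlim (fun x => a x k) F (locally (b k))) ->
  filterlim (fun x => psum (a x) n) F (locally (psum b n)).
Proof.
  intros H; induction n as [|n IH]; simpl; [apply filterlim_const|].
  eapply filterlim_comp_2; [apply IH|apply H|].
  apply (filterlim_plus (V := R_NormedModule)).
Qed.

Lemma filterlim_R_spec {T} (F : (T -> Prop) -> Prop) {FF : Filter F} (f : T -> R) (l : R) :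
  filterlim f F (locally l) <-> forall eps, 0 < eps -> F (fun x => Rabs (f x - l) < eps).
Proof.
  split.
  - intros H eps He; apply (H (fun y => Rabs (y - l) < eps)).
    exists (mkposreal _ He); intros y Hy; exact Hy.
  - intros H P [eps HP]; unfold filtermap.
    apply filter_imp with (2 := H eps (cond_pos eps)).
    intros x Hx; apply HP, Hx.
Qed.

(** Tannery's theorem: beyond some [N] both tails are below [eps / 3] by the common majorant, and
    the finite part converges termwise. *)
Lemma filterlim_Series_dominated {T} (F : (T -> Prop) -> Prop) {FF : Filter F}
  (a : T -> nat -> R) (b M : nat -> R) :
  F (fun x => forall n, Rabs (a x n) <= M n) -> (forall n, Rabs (b n) <= M n) ->
  ex_series M ->
  (forall n, filterlim (fun x => a x n) F (locally (b n))) ->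
  filterlim (fun x => Series (a x)) F (locally (Series b)).
Proof.
  intros Ha Hb HM Hl; apply filterlim_R_spec; [exact FF|]; intros eps He.
  destruct (Series_tail_small M (eps / 3) HM ltac:(lra)) as [N HN].
  assert (E : forall c, (forall n, Rabs (c n) <= M n) ->
    Rabs (Series c - psum c (S N)) <= Series (fun k => M (S N + k)%nat)).
  { intros c Hc; rewrite (Series_incr_n c (S N)) by
      (lia || apply ex_series_dominated with M; assumption).
    rewrite <- sum_n_Reals, <- sum_n_psum; simpl pred.
    replace (_ - _) with (Series (fun k => c (S N + k)%nat)) by ring.
    apply Series_abs_le; [intros n; apply Hc|].
    apply (proj1 (ex_series_incr_n M (S N))), HM. }
  pose proof (proj1 (filterlim_R_spec F _ _) (filterlim_psum F a b (S N) Hl) (eps / 3) ltac:(lra)) as H.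
  generalize (filter_and _ _ Ha H); apply filter_imp; intros x [H1 H2].
  pose proof (E _ H1) as E1; pose proof (E _ Hb) as E2.
  apply Rabs_def2 in H2; apply Rabs_def2 in HN.
  revert E1 E2; unfold Rabs at 1 2; intros.
  destruct (Rcase_abs (Series (a x) - psum (a x) (S N)));
  destruct (Rcase_abs (Series b - psum b (S N))); apply Rabs_def1; lra.
Qed.

(** Each round splits off a boundary term that converges by the termwise hypothesis. A majorant is
    therefore required only for the differences of order [K]. *)
Lemma filterlim_RS_dominated {T} (F : (T -> Prop) -> Prop) {FF : Filter F} K h
  (f : T -> nat -> R) (g M : nat -> R) (l : T -> R) l0 :
  balanced h ->
  F (fun x => forall n, Rabs (fdiffn K (f x) n) <= M n) ->
  (forall n, Rabs (fdiffn K g n) <= M n) -> ex_series M ->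
  (forall n, filterlim (fun x => f x n) F (locally (g n))) ->
  F (fun x => is_RS K h (f x) (l x)) -> is_RS K h g l0 ->
  filterlim l F (locally l0).
Proof.
  revert h f g l l0; induction K as [|K IH]; intros h f g l l0 Bh Hf Hg HM Hfg Hl Hl0; simpl in *.
  - destruct (balanced_bounded h Bh) as [B [B0 HB]].
    rewrite <- (is_series_unique _ _ Hl0).
    apply filterlim_ext_loc with (fun x => Series (fun n => h n * f x n)).
    { revert Hl; apply filter_imp; intros x Hx; apply is_series_unique, Hx. }
    apply filterlim_Series_dominated with (fun n => B * M n); auto.
    + revert Hf; apply filter_imp; intros x Hx n; rewrite Rabs_mult.
      apply Rmult_le_compat; auto using Rabs_pos.
    + intros n; rewrite Rabs_mult; apply Rmult_le_compat; auto using Rabs_pos.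
    + apply (ex_series_scal_l (V := R_NormedModule) B M HM).
    + intros n; eapply filterlim_comp; [apply Hfg|].
      apply (filterlim_scal_r (K := R_AbsRing) (V := R_NormedModule) (h n) (g n)).
  - assert (H : filterlim (fun x => - antidiff h 0 * f x 0%nat - l x) F
       (locally (- antidiff h 0 * g 0%nat - l0))).
    { apply (IH (antidiff_shift h) (fun x => fdiff (f x)) (fdiff g)); auto.
      - apply balanced_antidiff_shift, Bh.
      - intros n; unfold fdiff, Rminus; eapply filterlim_comp_2; [apply Hfg| |].
        + eapply filterlim_comp; [apply Hfg|apply (filterlim_opp (V := R_NormedModule))].
        + apply (filterlim_plus (V := R_NormedModule)). }
    assert (H2 : filterlim (fun x => - antidiff h 0 * f x 0%nat) F
       (locally (- antidiff h 0 * g 0%nat))).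
    { eapply filterlim_comp; [apply Hfg|].
      apply (filterlim_scal_r (K := R_AbsRing) (V := R_NormedModule) (- antidiff h 0) (g 0%nat)). }
    replace l0 with ((- antidiff h 0 * g 0%nat) + - (- antidiff h 0 * g 0%nat - l0)) by ring.
    apply filterlim_ext with (fun x =>
      (- antidiff h 0 * f x 0%nat) + - (- antidiff h 0 * f x 0%nat - l x)); [intros; ring|].
    eapply filterlim_comp_2; [apply H2| |apply (filterlim_plus (V := R_NormedModule))].
    eapply filterlim_comp; [apply H|apply (filterlim_opp (V := R_NormedModule))].
Qed.

(** By the mean value theorem each difference of step [b] is [b] times a derivative. The induction
    replaces the whole chain [F] by its difference, which again is a chain of successive
    derivatives. *)
Lemma fdiffn_derivative K (F : nat -> R -> R) (m M a b : R) (n : nat) :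
  0 <= b ->
  (forall k y, (k < K)%nat -> a + b * INR n <= y <= a + b * (INR n + INR K) ->
     is_derive (F k) y (F (S k) y)) ->
  (forall y, a + b * INR n <= y <= a + b * (INR n + INR K) -> m <= F K y <= M) ->
  m * b ^ K <= fdiffn K (fun i => F O (a + b * INR i)) n <= M * b ^ K.
Proof.
  intros Hb; revert F m M; induction K as [|K IH]; intros F m M HF HM.
  - simpl; rewrite !Rmult_1_r; apply HM; simpl; lra.
  - simpl fdiffn.
    rewrite (fdiffn_ext K _ (fun i => (fun k y => F k (y + b) - F k y) O (a + b * INR i))).
    2: { intros i; unfold fdiff; rewrite S_INR; f_equal; f_equal; ring. }
    rewrite S_INR in HF, HM.
    pose proof (pos_INR K) as PK.
    assert (P : 0 <= b * INR K) by (apply Rmult_le_pos; assumption).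
    replace (m * b ^ S K) with ((m * b) * b ^ K) by (simpl; ring).
    replace (M * b ^ S K) with ((M * b) * b ^ K) by (simpl; ring).
    apply (IH (fun k y => F k (y + b) - F k y)).
    + intros k y Hk Hy.
      apply (is_derive_minus (V := R_NormedModule) (fun y => F k (y + b)) (F k)).
      * replace (F (S k) (y + b)) with (scal 1 (F (S k) (y + b))) by
          (unfold scal; simpl; unfold mult; simpl; ring).
        apply (is_derive_comp (F k) (fun y => y + b)).
        -- apply HF; [lia|]; nra.
        -- auto_derive; [trivial|ring].
      * apply HF; [lia|]; nra.
    + intros y Hy.
      destruct (MVT_gen (F K) y (y + b) (F (S K))) as [c [Hc E]].
      * intros z; rewrite Rmin_left, Rmax_right by lra; intros; apply HF; [lia|nra].
      * intros z; rewrite Rmin_left, Rmax_right by lra; intros.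
        apply continuity_pt_filterlim.
        apply (ex_derive_continuous (V := R_NormedModule)).
        eexists; apply HF; [lia|nra].
      * rewrite Rmin_left, Rmax_right in Hc by lra.
        rewrite E; replace (y + b - y) with b by ring.
        assert (m <= F (S K) c <= M) by (apply HM; nra); nra.
Qed.

Lemma fdiffn_derivative_abs K (F : nat -> R -> R) (M a b : R) (n : nat) :
  0 <= b ->
  (forall k y, (k < K)%nat -> a + b * INR n <= y -> is_derive (F k) y (F (S k) y)) ->
  (forall y, a + b * INR n <= y -> Rabs (F K y) <= M) ->
  Rabs (fdiffn K (fun i => F O (a + b * INR i)) n) <= M * b ^ K.
Proof.
  intros Hb HF HM; apply Rabs_le.
  replace (- (M * b ^ K)) with ((- M) * b ^ K) by ring.
  apply fdiffn_derivative; [exact Hb| |].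
  - intros k y Hk Hy; apply HF; [exact Hk|lra].
  - intros y Hy; specialize (HM y ltac:(lra)); revert HM; unfold Rabs;
      destruct (Rcase_abs (F K y)); lra.
Qed.

Lemma ex_series_inv_sq : ex_series (fun n => / (INR (S n)) ^ 2).
Proof.
  (* Without its first term the series lies below the telescoping sum of [1 / ((n + 1) (n + 2))]. *)
  rewrite (ex_series_incr_1 (V := R_NormedModule)).
  assert (T : forall n, psum (fun k => / INR (S k) - / INR (S (S k))) n = 1 - / INR (S n)).
  { induction n as [|n IH]; [simpl; lra|]; rewrite psum_S, IH; ring. }
  apply ex_series_dominated with (fun n => / INR (S n) - / INR (S (S n))).
  - intros n; rewrite !S_INR; pose proof (pos_INR n).
    rewrite Rabs_pos_eq; [|apply Rlt_le, Rinv_0_lt_compat, pow_lt; lra].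
    replace (/ (INR n + 1) - / (INR n + 1 + 1)) with (/ ((INR n + 1) * (INR n + 1 + 1))) by (field; lra).
    apply Rinv_le_contravar; nra.
  - exists (1 - 0); apply is_series_psum.
    apply is_lim_seq_ext with (fun n => 1 - / INR (S n)); [intros; symmetry; apply T|].
    apply is_lim_seq_minus'; [apply is_lim_seq_const|].
    apply is_lim_seq_incr_1 with (u := fun n => / INR n).
    apply is_lim_seq_inv with (l := p_infty); [apply is_lim_seq_INR|discriminate].
Qed.

(** * The logarithm of [1 - z] on a ray *)

(** Real and imaginary parts ([true] and [false]) of [log (1 - z)] and of
    [z / (1 - z)] at [z = exp (i th - y)]. *)
Definition log1m (re : bool) (th y : R) : R :=
  if re then ln (1 - 2 * exp (- y) * cos th + exp (- y) ^ 2) / 2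
  else - atan (exp (- y) * sin th / (1 - exp (- y) * cos th)).

Definition geom (re : bool) (th y : R) : R :=
  (if re then exp (- y) * cos th - exp (- y) ^ 2 else exp (- y) * sin th)
  / (1 - 2 * exp (- y) * cos th + exp (- y) ^ 2).

(** With [w = z / (1 - z)] and [dz/dy = - z] one has [w' = - (w + w^2)], whose parts are taken here;
    those of [w'' = - (w' + 2 w w')] come next. *)
Definition geom1 (re : bool) (th y : R) : R :=
  - (geom re th y +
     if re then geom true th y ^ 2 - geom false th y ^ 2
     else 2 * geom true th y * geom false th y).

Definition geom2 (re : bool) (th y : R) : R :=
  - (geom1 re th y +
     if re then 2 * geom true th y * geom1 true th y - 2 * geom false th y * geom1 false th y
     else 2 * geom1 true th y * geom false th y + 2 * geom true th y * geom1 false th y).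

Lemma exp_neg_bounds y : 0 < y -> 0 < exp (- y) < 1.
Proof.
  intros H; split; [apply exp_pos|].
  rewrite <- exp_0; apply exp_increasing; lra.
Qed.

Lemma cos_sin_sq th : cos th ^ 2 + sin th ^ 2 = 1.
Proof. pose proof (sin2_cos2 th) as H; unfold Rsqr in H; lra. Qed.

(** Inside the unit disc [1 - z] has positive real part, so the [atan] in [log1m] is the principal
    argument; its modulus lies between [1 - e^(-y)] and [1 + e^(-y)]. *)
Lemma log1m_denominators th y : 0 < y ->
  (1 - exp (- y)) ^ 2 <= 1 - 2 * exp (- y) * cos th + exp (- y) ^ 2
    <= (1 + exp (- y)) ^ 2 /\
  1 - exp (- y) <= 1 - exp (- y) * cos th /\ 0 < 1 - exp (- y).
Proof.
  intros H; pose proof (exp_neg_bounds y H); pose proof (COS_bound th); nra.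
Qed.

Lemma is_derive_log1m re th y : 0 < y ->
  is_derive (log1m re th) y (geom re th y).
Proof.
  intros H; destruct (log1m_denominators th y H) as [D1 [D2 D3]].
  pose proof (cos_sin_sq th) as CS.
  destruct re; unfold log1m, geom.
  - auto_derive; [nra|].
    replace (exp (- y) * (exp (- y) * 1)) with (exp (- y) ^ 2) by ring.
    field; nra.
  - auto_derive; [lra|]. 
    field_simplify_eq; [|split; nra].
    replace (sin th ^ 3) with (sin th * (1 - cos th ^ 2)) by (rewrite <- CS; ring).
    replace (sin th ^ 2) with (1 - cos th ^ 2) by (rewrite <- CS; ring).
    ring.
Qed.

Lemma is_derive_geom re th y : 0 < y -> is_derive (geom re th) y (geom1 re th y).
Proof.
  intros H; destruct (log1m_denominators th y H) as [D1 [D2 D3]].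
  pose proof (cos_sin_sq th) as CS.
  assert (DD : 1 - 2 * exp (- y) * cos th + exp (- y) ^ 2 <> 0) by nra.
  destruct re; unfold geom1, geom; (auto_derive; [nra|]); (field_simplify_eq; [|exact DD]);
    try replace (sin th ^ 2) with (1 - cos th ^ 2) by (rewrite <- CS; ring); ring.
Qed.

Lemma is_derive_geom1 re th y : 0 < y -> is_derive (geom1 re th) y (geom2 re th y).
Proof.
  intros H.
  pose proof (is_derive_geom true th y H) as H1.
  pose proof (is_derive_geom false th y H) as H2.
  assert (U1 : Derive (fun x : R => geom true th x) y = geom1 true th y) by (apply is_derive_unique; exact H1).
  assert (U2 : Derive (fun x : R => geom false th x) y = geom1 false th y) by (apply is_derive_unique; exact H2).
  destruct re; unfold geom1 at 1, geom2;
    (auto_derive; [repeat split; eexists; eassumption|]);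
    rewrite ?U1, ?U2; ring.
Qed.

(** [geomW y = 1 / (e^y - 1)] dominates [|z / (1 - z)|] and [|log (1 - z)|]
    on the circle [|z| = e^(-y)]. *)
Definition geomW (y : R) : R := exp (- y) / (1 - exp (- y)).

Lemma geomW_pos y : 0 < y -> 0 < geomW y.
Proof.
  intros H; pose proof (exp_neg_bounds y H); apply Rdiv_lt_0_compat; lra.
Qed.

Lemma geom_norm th y : 0 < y ->
  geom true th y ^ 2 + geom false th y ^ 2 <= geomW y ^ 2.
Proof.
  intros H; destruct (log1m_denominators th y H) as [D1 [D2 D3]].
  pose proof (exp_neg_bounds y H) as E.
  pose proof (cos_sin_sq th) as CS.
  unfold geom, geomW; set (e := exp (- y)) in *.
  assert (DD : 0 < 1 - 2 * e * cos th + e ^ 2) by nra.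
  replace (_ + _) with (e ^ 2 * / (1 - 2 * e * cos th + e ^ 2)).
  2: { field_simplify_eq; [|lra].
       replace (sin th ^ 2) with (1 - cos th ^ 2) by (rewrite <- CS; ring); ring. }
  replace ((e / (1 - e)) ^ 2) with (e ^ 2 * / ((1 - e) ^ 2)) by (field; lra).
  apply Rmult_le_compat_l; [nra|]; apply Rinv_le_contravar; nra.
Qed.

Lemma Rabs_le_of_sq a b : 0 <= b -> a ^ 2 <= b ^ 2 -> Rabs a <= b.
Proof. intros Hb H; apply Rabs_le; nra. Qed.

Lemma geom_abs re th y : 0 < y -> Rabs (geom re th y) <= geomW y.
Proof.
  intros H; pose proof (geom_norm th y H); pose proof (geomW_pos y H).
  apply Rabs_le_of_sq; [lra|]; destruct re; nra.
Qed.

(** The real part lies between [ln (1 - e)] and [ln (1 + e)], and [ln u <= u - 1] at [1 / (1 - e)]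
    and at [1 + e] controls both ends. The imaginary part uses [|atan v| <= |v|]. *)
Lemma log1m_abs re th y : 0 < y -> Rabs (log1m re th y) <= geomW y.
Proof.
  intros H; destruct (log1m_denominators th y H) as [[D1 D1'] [D2 D3]].
  pose proof (exp_neg_bounds y H) as E; unfold log1m, geomW; set (e := exp (- y)) in *.
  assert (L : forall u, 0 < u -> ln u <= u - 1).
  { intros u Hu; pose proof (exp_ineq1_le (ln u)) as X; rewrite exp_ln in X; lra. }
  destruct re.
  - apply Rabs_le; split.
    + assert (H0 : ln ((1 - e) ^ 2) <= ln (1 - 2 * e * cos th + e ^ 2))
        by (apply ln_le; [apply pow_lt; lra|lra]).
      rewrite (ln_pow (1 - e) 2) in H0 by lra; simpl INR in H0.
      pose proof (L (/ (1 - e)) ltac:(apply Rinv_0_lt_compat; lra)) as X.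
      rewrite ln_Rinv in X by lra.
      replace (/ (1 - e) - 1) with (e / (1 - e)) in X by (field; lra); lra.
    + assert (H0 : ln (1 - 2 * e * cos th + e ^ 2) <= ln ((1 + e) ^ 2))
        by (apply ln_le; [eapply Rlt_le_trans, D1; apply pow_lt; lra|lra]).
      rewrite (ln_pow (1 + e) 2) in H0 by lra; simpl INR in H0.
      pose proof (L (1 + e) ltac:(lra)) as X.
      assert (e * (1 - e) <= e) by nra.
      assert (e <= e / (1 - e)) by (apply Rmult_le_reg_r with (1 - e); [lra|];
        unfold Rdiv; rewrite Rmult_assoc, Rinv_l by lra; lra).
      lra.
  - rewrite Rabs_Ropp.
    assert (A : forall v, Rabs (atan v) <= Rabs v).
    { intros v; destruct (MVT_gen atan 0 v (fun x => / (1 + x ^ 2))) as [c [_ Ec]].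
      - intros x _; apply is_derive_Reals.
        apply derivable_pt_lim_atan.
      - intros x _; apply derivable_continuous_pt, derivable_pt_atan.
      - rewrite atan_0, !Rminus_0_r in Ec; rewrite Ec, Rabs_mult.
        assert (0 < / (1 + c ^ 2)) by (apply Rinv_0_lt_compat; nra).
        assert (/ (1 + c ^ 2) <= 1) by (rewrite <- Rinv_1; apply Rinv_le_contravar; nra).
        rewrite (Rabs_pos_eq (/ _)) by lra.
        pose proof (Rabs_pos v); nra. }
    eapply Rle_trans; [apply A|].
    unfold Rdiv; rewrite !Rabs_mult, Rabs_inv.
    rewrite (Rabs_pos_eq e), (Rabs_pos_eq (1 - e * cos th)) by lra.
    apply Rmult_le_compat; [| |pose proof (SIN_bound th)|apply Rinv_le_contravar; lra].
    + apply Rmult_le_pos; [lra|apply Rabs_pos].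
    + apply Rlt_le, Rinv_0_lt_compat; lra.
    + rewrite <- (Rmult_1_r e) at 2; apply Rmult_le_compat_l; [lra|]; apply Rabs_le; lra.
Qed.

(** With [g = e^(-y/3)] the claim reads [g y <= 3 (1 - g^3)]. After multiplication by [1 + y] it
    follows from [g (1 + y) <= 3] and [y <= (1 - g^3) (1 + y)], both consequences of
    [1 + v <= e^v]. *)
Lemma geomW_exp y : 0 < y -> y * geomW y <= 3 * exp (- (2 * y / 3)).
Proof.
  intros H; pose proof (exp_neg_bounds y H) as E.
  unfold geomW.
  pose proof (exp_ineq1_le (y / 3)) as I.
  pose proof (exp_pos (y / 3)) as P.
  set (g := exp (- (y / 3))).
  assert (Eg : exp (y / 3) * g = 1) by (unfold g; rewrite <- exp_plus, <- exp_0; f_equal; ring).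
  assert (E1 : exp (- y) = g ^ 3).
  { unfold g; simpl; rewrite Rmult_1_r, <- !exp_plus; f_equal; field. }
  assert (E2 : exp (- (2 * y / 3)) = g ^ 2).
  { unfold g; simpl; rewrite Rmult_1_r, <- !exp_plus; f_equal; field. }
  assert (Y : exp (- y) * (1 + y) <= 1).
  { pose proof (exp_ineq1_le y).
    assert (X : exp (- y) * exp y = 1) by (rewrite <- exp_plus, <- exp_0; f_equal; ring). nra. }
  rewrite E1 in *; rewrite E2.
  assert (g > 0) by apply exp_pos.
  assert (g * (1 + y) <= 3) by nra.
  apply Rmult_le_reg_r with (1 - g ^ 3); [lra|].
  replace (y * (g ^ 3 / (1 - g ^ 3)) * (1 - g ^ 3)) with (g ^ 2 * (g * y)) by (field; lra).
  replace (3 * g ^ 2 * (1 - g ^ 3)) with (g ^ 2 * (3 * (1 - g ^ 3))) by ring.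
  apply Rmult_le_compat_l; [nra|].
  apply Rmult_le_reg_r with (1 + y); [lra|].
  assert (y <= (1 - g ^ 3) * (1 + y)) by nra.
  nra.
Qed.

Lemma exp_neg_mul y : 0 < y -> y * exp (- y) <= 1.
Proof.
  intros H; pose proof (exp_ineq1_le y); pose proof (exp_pos (- y)).
  assert (X : exp (- y) * exp y = 1) by (rewrite <- exp_plus, <- exp_0; f_equal; ring).
  nra.
Qed.

(** Of the four powers, two pay for the factor [m^2] of the Lambert series and two leave the
    summable [1 / m^2]. The constant rounds up [3 (9/2)^3 = 273.375], where [9/2] bounds
    [y e^(-2y/9)]. *)
Lemma geomW_pow4 y : 0 < y -> y ^ 4 * geomW y <= 274.
Proof.
  intros H; pose proof (geomW_exp y H) as G.
  pose proof (exp_neg_mul (2 * y / 9) ltac:(lra)) as X.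
  set (g := exp (- (2 * y / 9))) in *.
  assert (E : exp (- (2 * y / 3)) = g ^ 3).
  { unfold g; simpl; rewrite Rmult_1_r, <- !exp_plus; f_equal; field. }
  rewrite E in G; assert (0 < g) by apply exp_pos.
  assert (Z : y * g <= 9 / 2) by lra.
  assert (0 < y * g) by (apply Rmult_lt_0_compat; assumption).
  replace (y ^ 4 * geomW y) with (y ^ 3 * (y * geomW y)) by ring.
  apply Rle_trans with (y ^ 3 * (3 * g ^ 3)); [apply Rmult_le_compat_l; [apply pow_le; lra|exact G]|].
  replace (y ^ 3 * (3 * g ^ 3)) with (3 * (y * g) ^ 3) by ring.
  apply Rle_trans with (3 * (9 / 2) ^ 3); [|lra].
  apply Rmult_le_compat_l; [lra|]; apply pow_incr; lra.
Qed.

Definition ylog (re : bool) (th : R) (k : nat) (y : R) : R :=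
  match k with
  | O => y * log1m re th y
  | 1%nat => log1m re th y + y * geom re th y
  | 2%nat => 2 * geom re th y + y * geom1 re th y
  | _ => 3 * geom1 re th y + y * geom2 re th y
  end.

Lemma is_derive_ylog re th k y : (k < 3)%nat -> 0 < y ->
  is_derive (ylog re th k) y (ylog re th (S k) y).
Proof.
  intros Hk H.
  pose proof (is_derive_log1m re th y H) as H0; assert (U0 : Derive (fun x : R => log1m re th x) y = geom re th y) by (apply is_derive_unique; exact H0).
  pose proof (is_derive_geom re th y H) as H1; assert (U1 : Derive (fun x : R => geom re th x) y = geom1 re th y) by (apply is_derive_unique; exact H1).
  pose proof (is_derive_geom1 re th y H) as H2; assert (U2 : Derive (fun x : R => geom1 re th x) y = geom2 re th y) by (apply is_derive_unique; exact H2).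
  do 3 (destruct k as [|k]; [unfold ylog; (auto_derive;
    [repeat split; eexists; eassumption|]); rewrite ?U0, ?U1, ?U2; ring|]); lia.
Qed.

(** The worst case is [th = 0], where the function behaves like [y ln y] near [0] and its third
    derivative like [- 1 / y^2]. For large [y] the exponential decay of [geomW] takes over. The
    bound is uniform in [th]. *)
Lemma ylog_third_bound re th y : 0 < y -> Rabs (ylog re th 3 y) <= 486 / y ^ 2.
Proof.
  intros H.
  pose proof (geom_abs true th y H) as A; pose proof (geom_abs false th y H) as B.
  pose proof (geomW_pos y H) as P; pose proof (geomW_exp y H) as G.
  unfold ylog.
  set (a := geom true th y) in *; set (b := geom false th y) in *; set (W := geomW y) in *.
  assert (D : forall r, Rabs (geom1 r th y) <= W + 2 * W ^ 2).
  { pose proof (geom_norm th y H) as N; fold a b W in N.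
    intros r; unfold geom1; fold a b; apply Rabs_le; destruct r; fold a b.
    - apply Rabs_le_between in A; nra.
    - apply Rabs_le_between in B; nra. }
  assert (DD : Rabs (geom2 re th y) <= (1 + 4 * W) * (W + 2 * W ^ 2)).
  { unfold geom2; fold a b.
    pose proof (D true) as D1; pose proof (D false) as D2; pose proof (D re) as D3.
    set (V := W + 2 * W ^ 2) in *.
    assert (T : forall p q r s, Rabs p <= W -> Rabs q <= V -> Rabs r <= W -> Rabs s <= V ->
       Rabs (2 * p * q) + Rabs (2 * r * s) <= 4 * W * V).
    { intros p q r s Hp Hq Hr Hs.
      rewrite !Rabs_mult, (Rabs_pos_eq 2) by lra.
      assert (Rabs p * Rabs q <= W * V) by (apply Rmult_le_compat; auto using Rabs_pos).
      assert (Rabs r * Rabs s <= W * V) by (apply Rmult_le_compat; auto using Rabs_pos).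
      lra. }
    rewrite Rabs_Ropp; eapply Rle_trans; [apply Rabs_triang|].
    replace ((1 + 4 * W) * V) with (V + 4 * W * V) by ring.
    apply Rplus_le_compat; [exact D3|].
    destruct re; unfold Rminus; (eapply Rle_trans; [apply Rabs_triang|]); rewrite ?Rabs_Ropp.
    - apply T; assumption.
    - replace (2 * geom1 true th y * b) with (2 * b * geom1 true th y) by ring.
      apply T; assumption. }
  pose proof (exp_neg_mul (y / 3) ltac:(lra)) as X.
  set (g := exp (- (y / 3))) in *.
  assert (E2 : exp (- (2 * y / 3)) = g ^ 2).
  { unfold g; simpl; rewrite Rmult_1_r, <- !exp_plus; f_equal; field. }
  rewrite E2 in G.
  assert (0 < g) by apply exp_pos.
  assert (g <= 1) by (unfold g; pose proof (exp_neg_bounds (y / 3) ltac:(lra)); lra).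
  apply Rle_trans with (3 * (W + 2 * W ^ 2) + y * ((1 + 4 * W) * (W + 2 * W ^ 2))).
  { eapply Rle_trans; [apply Rabs_triang|]; rewrite !Rabs_mult, (Rabs_pos_eq 3), (Rabs_pos_eq y) by lra.
    apply Rplus_le_compat; apply Rmult_le_compat_l; auto; lra. }
  apply Rmult_le_reg_r with (y ^ 2); [apply pow_lt; lra|].
  replace (486 / y ^ 2 * y ^ 2) with 486 by (field; lra).
  replace (_ * y ^ 2) with ((y * W) * ((y + 2 * (y * W)) * (3 + y + 4 * (y * W)))) by ring.
  assert (Q : 0 <= y * W) by (apply Rmult_le_pos; lra).
  apply Rle_trans with ((3 * g ^ 2) * ((y + 2 * (3 * g ^ 2)) * (3 + y + 4 * (3 * g ^ 2)))).
  { apply Rmult_le_compat; [lra| |lra|]; [apply Rmult_le_pos; lra|].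
    apply Rmult_le_compat; lra. }
  (* Each bracket absorbs one factor [g] of [g^2]; then [y g <= 3] and [g <= 1] give
     [3 (3 + 6) (3 + 3 + 12) = 486]. *)
  replace (3 * g ^ 2 * _) with
    (3 * ((y * g + 6 * g ^ 3) * (3 * g + y * g + 12 * g ^ 3))) by ring.
  assert (g ^ 3 <= 1) by (rewrite <- (pow1 3); apply pow_incr; lra).
  assert (0 < g ^ 3) by (apply pow_lt; lra).
  assert (0 < y * g <= 3) by (split; [apply Rmult_lt_0_compat; assumption|lra]).
  apply Rle_trans with (3 * (9 * 18)); [|lra].
  apply Rmult_le_compat_l; [lra|]; apply Rmult_le_compat; lra.
Qed.

(** * Finite differences of [y^(-s)] *)

Lemma C_eq (z w : C) : Re z = Re w -> Im z = Im w -> z = w.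
Proof. destruct z, w; simpl; intros; subst; reflexivity. Qed.

Lemma exp_le x y : x <= y -> exp x <= exp y.
Proof. intros [H|H]; [left; apply exp_increasing, H|right; rewrite H; reflexivity]. Qed.

Lemma Cmod_le_sum (z : C) : Cmod z <= Rabs (Re z) + Rabs (Im z).
Proof.
  unfold Cmod; rewrite <- (sqrt_pow2 (Rabs (Re z) + Rabs (Im z)));
    [|pose proof (Rabs_pos (Re z)); pose proof (Rabs_pos (Im z)); lra].
  apply sqrt_le_1_alt.
  rewrite <- (pow2_abs (fst z)), <- (pow2_abs (snd z)).
  pose proof (Rabs_pos (Re z)); pose proof (Rabs_pos (Im z)); unfold Re, Im in *; nra.
Qed.

Lemma im_le_Cmod (z : C) : Rabs (Im z) <= Cmod z.
Proof. eapply Rle_trans; [apply Rmax_r|apply Rmax_Cmod]. Qed.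

Lemma Cexp_plus z w : Cexp (z + w) = (Cexp z * Cexp w)%C.
Proof.
  unfold Cexp; apply C_eq; simpl; unfold Re, Im; simpl; rewrite exp_plus, ?cos_plus, ?sin_plus; ring.
Qed.

Lemma Cexp_0 : Cexp 0 = 1.
Proof. unfold Cexp; simpl; rewrite exp_0, cos_0, sin_0; apply C_eq; simpl; ring. Qed.

Lemma Cexp_mod z : Cmod (Cexp z) = exp (Re z).
Proof.
  unfold Cexp, Cmod; simpl fst; simpl snd.
  replace (_ + _) with (exp (Re z) ^ 2 * ((sin (Im z))² + (cos (Im z))²)) by (unfold Rsqr; ring).
  rewrite sin2_cos2, Rmult_1_r; apply sqrt_pow2, Rlt_le, exp_pos.
Qed.

Lemma Cexp_RtoC (x : R) : Cexp x = exp x.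
Proof. unfold Cexp; simpl; rewrite cos_0, sin_0; apply C_eq; simpl; ring. Qed.

(** Differentiation along a real path, by coordinates, so that real calculus and the mean value
    theorem apply. *)
Definition Cder (f : R -> C) (x : R) (l : C) : Prop :=
  is_derive (fun t => Re (f t)) x (Re l) /\ is_derive (fun t => Im (f t)) x (Im l).

Lemma Cder_const (c : C) x : Cder (fun _ => c) x 0.
Proof. split; apply (is_derive_const (V := R_NormedModule)). Qed.

Lemma Cder_plus f g x l m : Cder f x l -> Cder g x m ->
  Cder (fun t => f t + g t)%C x (l + m)%C.
Proof.
  intros [F1 F2] [G1 G2]; split;
    apply (is_derive_plus (V := R_NormedModule)); assumption.
Qed.

Lemma is_derive_Rmult (f g : R -> R) x l m : is_derive f x l -> is_derive g x m ->
  is_derive (fun t => f t * g t) x (l * g x + f x * m).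
Proof. intros F G; apply (is_derive_mult f g x l m F G), Rmult_comm. Qed.

Lemma Cder_mult f g x l m : Cder f x l -> Cder g x m ->
  Cder (fun t => f t * g t)%C x (l * g x + f x * m)%C.
Proof.
  intros [F1 F2] [G1 G2]; split; simpl.
  - replace (_ + _) with ((Re l * Re (g x) + Re (f x) * Re m)
      - (Im l * Im (g x) + Im (f x) * Im m)) by (unfold Re, Im; ring).
    apply (is_derive_minus (V := R_NormedModule) (fun t => Re (f t) * Re (g t))
             (fun t => Im (f t) * Im (g t))); apply is_derive_Rmult; assumption.
  - replace (_ + _) with ((Re l * Im (g x) + Re (f x) * Im m)
      + (Im l * Re (g x) + Im (f x) * Re m)) by (unfold Re, Im; ring).
    apply (is_derive_plus (V := R_NormedModule) (fun t => Re (f t) * Im (g t))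
             (fun t => Im (f t) * Re (g t))); apply is_derive_Rmult; assumption.
Qed.

Lemma Cder_exp f x l : Cder f x l -> Cder (fun t => Cexp (f t)) x (l * Cexp (f x))%C.
Proof.
  assert (X : forall (u v : R -> R) a b, is_derive u x a -> is_derive v x b ->
    is_derive (fun t => exp (u t) * cos (v t)) x
      (a * (exp (u x) * cos (v x)) - b * (exp (u x) * sin (v x))) /\
    is_derive (fun t => exp (u t) * sin (v t)) x
      (a * (exp (u x) * sin (v x)) + b * (exp (u x) * cos (v x)))).
  { intros u v a b U V.
    pose proof (is_derive_unique _ _ _ U) as U1; pose proof (is_derive_unique _ _ _ V) as U2.
    split; (auto_derive; [repeat split; eexists; eassumption|]);
      change (Derive (fun x => u x) x) with (Derive u x);
      change (Derive (fun x => v x) x) with (Derive v x); rewrite U1, U2; ring. }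
  intros [F1 F2]; exact (X (fun t => Re (f t)) (fun t => Im (f t)) _ _ F1 F2).
Qed.

Lemma Cder_RtoC (f : R -> R) x l : is_derive f x l -> Cder (fun t => RtoC (f t)) x (RtoC l).
Proof. intros F; split; simpl; [exact F|apply (is_derive_const (V := R_NormedModule))]. Qed.

Lemma Cder_eq f x l m : Cder f x l -> l = m -> Cder f x m.
Proof. intros H E; rewrite <- E; exact H. Qed.

(** The mean value theorem gives each coordinate its own intermediate point, hence the factor 2. *)
Lemma Cder_bound (g g' : R -> C) D :
  (forall t, 0 <= t <= 1 -> Cder g t (g' t) /\ Cmod (g' t) <= D) ->
  Cmod (g 1 - g 0)%C <= 2 * D.
Proof.
  intros H.
  assert (B : forall u u' : R -> R, (forall t, 0 <= t <= 1 -> is_derive u t (u' t) /\ Rabs (u' t) <= D) ->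
    Rabs (u 1 - u 0) <= D).
  { intros v v' Hu; destruct (MVT_gen v 0 1 v') as [c [Hc E]].
    - rewrite Rmin_left, Rmax_right by lra; intros x Hx; apply Hu; lra.
    - rewrite Rmin_left, Rmax_right by lra; intros x Hx.
      apply continuity_pt_filterlim, (ex_derive_continuous (V := R_NormedModule)).
      eexists; apply Hu; lra.
    - rewrite Rmin_left, Rmax_right in Hc by lra.
      rewrite E, Rminus_0_r, Rmult_1_r; apply Hu, Hc. }
  eapply Rle_trans; [apply Cmod_le_sum|].
  replace (2 * D) with (D + D) by ring; apply Rplus_le_compat.
  - apply (B (fun t => Re (g t)) (fun t => Re (g' t))).
    intros t Ht; destruct (H t Ht) as [[H1 _] H2]; split; [exact H1|].
    eapply Rle_trans; [apply re_le_Cmod|exact H2].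
  - apply (B (fun t => Im (g t)) (fun t => Im (g' t))).
    intros t Ht; destruct (H t Ht) as [[_ H1] H2]; split; [exact H1|].
    eapply Rle_trans; [apply im_le_Cmod|exact H2].
Qed.

Lemma Cexp_mod_le z : Cmod (Cexp z) <= exp (Cmod z).
Proof.
  rewrite Cexp_mod; apply exp_le.
  eapply Rle_trans; [apply Rle_abs|apply re_le_Cmod].
Qed.

Lemma Cder_Cexp_line z t : Cder (fun t : R => Cexp (t * z)) t (z * Cexp (t * z))%C.
Proof.
  apply (Cder_exp (fun t : R => (t * z)%C)).
  eapply Cder_eq; [apply (Cder_mult (fun t : R => RtoC t) (fun _ => z)); [|apply Cder_const]|].
  - apply (Cder_RtoC (fun t => t) t 1), (is_derive_id (K := R_AbsRing)).
  - cbv beta; ring.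
Qed.

Lemma Cmod_line t z : 0 <= t <= 1 -> Cmod (t * z)%C <= Cmod z.
Proof.
  intros H; rewrite Cmod_mult, Cmod_R, Rabs_pos_eq by lra.
  pose proof (Cmod_ge_0 z); nra.
Qed.

Lemma Cexp_minus_1_bound z : Cmod (Cexp z - 1)%C <= 2 * (Cmod z * exp (Cmod z)).
Proof.
  replace (Cexp z - 1)%C with (Cexp (1%R * z) - Cexp (0%R * z))%C.
  2: { rewrite Cmult_1_l, Cmult_0_l, Cexp_0; reflexivity. }
  apply (Cder_bound (fun t : R => Cexp (t * z)) (fun t : R => z * Cexp (t * z))%C).
  intros t Ht; split; [apply Cder_Cexp_line|].
  rewrite Cmod_mult; apply Rmult_le_compat_l; [apply Cmod_ge_0|].
  eapply Rle_trans; [apply Cexp_mod_le|]; apply exp_le, Cmod_line, Ht.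
Qed.

(** On the segment from [0] to [z] the derivative of [e^(tz) - t z] is [z (e^(tz) - 1)], to which
    the preceding estimate applies. *)
Lemma Cexp_minus_1_z_bound z :
  Cmod (Cexp z - 1 - z)%C <= 4 * (Cmod z ^ 2 * exp (Cmod z)).
Proof.
  replace (Cexp z - 1 - z)%C with
    ((Cexp (1%R * z) + - 1%R * z * 1%R) - (Cexp (0%R * z) + - 1%R * z * 0%R))%C.
  2: { rewrite Cmult_1_l, Cmult_0_l, Cexp_0; ring. }
  replace (4 * _) with (2 * (Cmod z * (2 * (Cmod z * exp (Cmod z))))) by ring.
  apply (Cder_bound (fun t : R => Cexp (t * z) + - 1%R * z * t)%C
           (fun t : R => z * (Cexp (t * z) - 1))%C).
  intros t Ht; split.
  - eapply Cder_eq.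
    + apply Cder_plus; [apply Cder_Cexp_line|].
      apply (Cder_mult (fun _ => (- 1%R * z)%C) (fun t : R => RtoC t)); [apply Cder_const|].
      apply (Cder_RtoC (fun t => t) t 1), (is_derive_id (K := R_AbsRing)).
    + cbv beta; ring.
  - rewrite Cmod_mult; apply Rmult_le_compat_l; [apply Cmod_ge_0|].
    eapply Rle_trans; [apply Cexp_minus_1_bound|].
    pose proof (Cmod_line t z Ht); pose proof (Cmod_ge_0 (t * z)%C).
    apply Rmult_le_compat_l; [lra|]; apply Rmult_le_compat; auto.
    + apply Rlt_le, exp_pos.
    + apply exp_le; assumption.
Qed.

(** The functions
    [y^(-s) (a0 + a1 ln y + a (G - 1 + h ln y) + b h (G - 1) + c h^2 G)] with
    [G = y^(-h)] are stable under derivation, up to replacing [s] by [s + 1].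
    The remainder of the first-order expansion of [y^(-s)] in [s] is one of
    them, and its successive derivatives stay [O(h^2)]. *)
Definition coeffs : Type := (C * C * C * C * C)%type.

Definition power_log (s h : C) (v : coeffs) (y : R) : C :=
  let '(a0, a1, a, b, c) := v in
  let G := Cexp (- h * ln y) in
  (Cexp (- s * ln y) *
   (a0 + a1 * ln y + a * (G - 1 + h * ln y) + b * (h * (G - 1)) + c * (h * h * G)))%C.

(** Up to the factor [1 / y], the derivative sends [ln y] to [1], [G - 1 + h ln y] to [- h (G - 1)],
    [h (G - 1)] to [- h^2 G] and [h^2 G] to [- h] times itself; the factor [y^(-s)] contributes the
    multiples of [- s]. *)
Definition coeffs_step (s h : C) (v : coeffs) : coeffs :=
  let '(a0, a1, a, b, c) := v in
  (- s * a0 + a1, - s * a1, - s * a, - s * b - a, - s * c - b - h * c)%C.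

Fixpoint coeffs_iter (s h : C) (v : coeffs) (k : nat) : coeffs :=
  match k with
  | O => v
  | S k => coeffs_step (s + INR k) h (coeffs_iter s h v k)
  end.

Lemma Cder_ln y : 0 < y -> Cder (fun y => RtoC (ln y)) y (/ y).
Proof.
  intros H; rewrite <- RtoC_inv by lra.
  apply (Cder_RtoC ln), is_derive_ln, H.
Qed.

Lemma Cexp_ln y : 0 < y -> Cexp (- ln y) = (/ y)%C.
Proof.
  intros H; rewrite <- RtoC_opp, Cexp_RtoC, exp_Ropp, exp_ln, RtoC_inv by lra; reflexivity.
Qed.

Lemma Cder_power_log s h v y : 0 < y ->
  Cder (power_log s h v) y (power_log (s + 1) h (coeffs_step s h v) y).
Proof.
  intros H; destruct v as [[[[a0 a1] a] b] c]; unfold power_log, coeffs_step.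
  pose proof (Cder_ln y H) as L.
  assert (X : forall w, Cder (fun y => Cexp (- w * ln y)) y (- w * / y * Cexp (- w * ln y))%C).
  { intros w; apply (Cder_exp (fun y => (- w * ln y)%C)).
    eapply Cder_eq; [apply Cder_mult; [apply Cder_const|exact L]|]; cbv beta; unfold Cdiv; ring. }
  pose proof (X h) as XG.
  assert (S : forall (z : C) (f : R -> C) l, Cder f y l -> Cder (fun y => z * f y)%C y (z * l)%C).
  { intros z f l F; eapply Cder_eq; [apply Cder_mult; [apply Cder_const|exact F]|].
    cbv beta; ring. }
  assert (XG1 : Cder (fun y => Cexp (- h * ln y) - 1)%C y (- h * / y * Cexp (- h * ln y))%C).
  { eapply Cder_eq; [apply (Cder_plus (fun y => Cexp (- h * ln y)) (fun _ => - (1))%C);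
      [exact XG|apply Cder_const]|]; ring. }
  eapply Cder_eq.
  - apply Cder_mult; [apply X|].
    apply Cder_plus; [apply Cder_plus; [apply Cder_plus; [apply Cder_plus|]|]|].
    + apply Cder_const.
    + apply S, L.
    + apply S, Cder_plus; [exact XG1|apply S, L].
    + apply S, S, XG1.
    + apply S, S, XG.
  - replace (- (s + 1) * ln y)%C with (- s * ln y + - ln y)%C by ring.
    rewrite Cexp_plus, Cexp_ln by exact H; cbv beta; unfold Cdiv; ring.
Qed.

(** The first norm covers the terms free of [h], the second those of size [O(h^2)]. A step never
    mixes the two groups, so the remainder keeps its factor [h^2] under derivation. *)
Definition norm_main (v : coeffs) : R := let '(a0, a1, a, b, c) := v in Cmod a0 + Cmod a1.
Definition norm_rem (v : coeffs) : R :=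
  let '(a0, a1, a, b, c) := v in Cmod a + Cmod b + Cmod c.

Lemma norm_main_pos v : 0 <= norm_main v.
Proof.
  destruct v as [[[[a0 a1] a] b] c]; simpl.
  pose proof (Cmod_ge_0 a0); pose proof (Cmod_ge_0 a1); lra.
Qed.

Lemma norm_rem_pos v : 0 <= norm_rem v.
Proof.
  destruct v as [[[[a0 a1] a] b] c]; simpl.
  pose proof (Cmod_ge_0 a); pose proof (Cmod_ge_0 b); pose proof (Cmod_ge_0 c); lra.
Qed.

Lemma coeffs_step_norms s h v : Cmod h <= 1 ->
  norm_main (coeffs_step s h v) <= (Cmod s + 2) * norm_main v /\
  norm_rem (coeffs_step s h v) <= (Cmod s + 2) * norm_rem v.
Proof.
  intros Hh; destruct v as [[[[a0 a1] a] b] c]; simpl.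
  assert (T : forall z w, Cmod (z - w)%C <= Cmod z + Cmod w).
  { intros z w; rewrite <- (Cmod_opp w); apply Cmod_triangle. }
  pose proof (Cmod_triangle (- s * a0) a1) as T1.
  pose proof (T (- s * b)%C a) as T2.
  pose proof (T (- s * c - b)%C (h * c)%C) as T3; pose proof (T (- s * c)%C b) as T4.
  rewrite ?Cmod_mult, ?Cmod_opp in *.
  pose proof (Cmod_ge_0 s); pose proof (Cmod_ge_0 a0); pose proof (Cmod_ge_0 a1).
  pose proof (Cmod_ge_0 a); pose proof (Cmod_ge_0 b); pose proof (Cmod_ge_0 c).
  pose proof (Cmod_ge_0 h).
  assert (Cmod h * Cmod c <= Cmod c) by nra.
  split; nra.
Qed.

Lemma coeffs_iter_norms s h v K k : Cmod h <= 1 -> (k <= K)%nat ->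
  norm_main (coeffs_iter s h v k) <= (Cmod s + INR K + 2) ^ k * norm_main v /\
  norm_rem (coeffs_iter s h v k) <= (Cmod s + INR K + 2) ^ k * norm_rem v.
Proof.
  intros Hh; induction k as [|k IH]; intros Hk; [simpl; lra|].
  destruct (IH ltac:(lia)) as [I1 I2]; simpl coeffs_iter.
  destruct (coeffs_step_norms (s + INR k) h (coeffs_iter s h v k) Hh) as [S1 S2].
  assert (B : Cmod (s + INR k) + 2 <= Cmod s + INR K + 2).
  { pose proof (Cmod_triangle s (INR k)) as T.
    rewrite Cmod_R, Rabs_pos_eq in T by apply pos_INR.
    pose proof (le_INR k K ltac:(lia)); lra. }
  pose proof (Cmod_ge_0 (s + INR k)).
  simpl pow; rewrite !Rmult_assoc; split.
  - eapply Rle_trans; [exact S1|]; apply Rmult_le_compat; [lra|apply norm_main_pos|lra|exact I1].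
  - eapply Rle_trans; [exact S2|]; apply Rmult_le_compat; [lra|apply norm_rem_pos|lra|exact I2].
Qed.

Lemma ln_nonneg y : 1 <= y -> 0 <= ln y.
Proof. intros H; rewrite <- ln_1; apply ln_le; lra. Qed.

Lemma one_plus_ln y : 0 < y -> 1 + ln y <= y.
Proof. intros H; pose proof (exp_ineq1_le (ln y)) as E; rewrite exp_ln in E by exact H; exact E. Qed.

(** Since [|h| <= 1], [e^(|h| ln y) <= y]; together with [1 + ln y <= y] this bounds every remainder
    term by [4 |h|^2 y^3]. *)
Lemma power_log_bound s h v y : 1 <= y -> Cmod h <= 1 ->
  Cmod (power_log s h v y) <=
  exp (- Re s * ln y) * (norm_main v * y + norm_rem v * (4 * Cmod h ^ 2 * y ^ 3)).
Proof.
  intros Hy Hh; destruct v as [[[[a0 a1] a] b] c]; unfold power_log; simpl norm_main; simpl norm_rem.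
  pose proof (ln_nonneg y Hy) as L0; pose proof (one_plus_ln y ltac:(lra)) as L1.
  set (l := ln y) in *.
  rewrite Cmod_mult, Cexp_mod.
  replace (Re (- s * l)%C) with (- Re s * l) by (simpl; unfold Re; ring).
  apply Rmult_le_compat_l; [apply Rlt_le, exp_pos|].
  set (z := (- h * l)%C).
  assert (Z : Cmod z = Cmod h * l) by (unfold z; rewrite Cmod_mult, Cmod_opp, Cmod_R, Rabs_pos_eq; auto).
  pose proof (Cmod_ge_0 h) as H0.
  assert (EZ : exp (Cmod z) <= y).
  { rewrite <- (exp_ln y) by lra; apply exp_le; rewrite Z; fold l; nra. }
  pose proof (exp_pos (Cmod z)) as EP.
  pose proof (Cexp_mod_le z) as B0; pose proof (Cexp_minus_1_bound z) as B1;
    pose proof (Cexp_minus_1_z_bound z) as B2.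
  replace (Cexp z - 1 + h * l)%C with (Cexp z - 1 - z)%C by (unfold z; ring).
  rewrite Z in B1, B2.
  assert (Y2 : (1 + l) ^ 2 <= y ^ 2) by (apply pow_incr; lra).
  assert (C2 : Cmod (Cexp z - 1 - z) <= 4 * Cmod h ^ 2 * y ^ 3).
  { eapply Rle_trans; [exact B2|].
    replace (4 * ((Cmod h * l) ^ 2 * exp (Cmod h * l))) with
      (4 * Cmod h ^ 2 * (l ^ 2 * exp (Cmod h * l))) by ring.
    apply Rmult_le_compat_l; [nra|].
    replace (y ^ 3) with (y ^ 2 * y) by ring; rewrite <- Z.
    apply Rmult_le_compat; try nra. }
  assert (C1 : Cmod (h * (Cexp z - 1))%C <= 4 * Cmod h ^ 2 * y ^ 3).
  { rewrite Cmod_mult; rewrite <- Z in B1.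
    assert (Cmod z * exp (Cmod z) <= Cmod h * (y ^ 2 * y)).
    { rewrite Z at 1; rewrite Rmult_assoc; apply Rmult_le_compat_l; [lra|].
      apply Rmult_le_compat; nra. }
    assert (0 <= Cmod h * (y ^ 2 * y)) by (apply Rmult_le_pos; nra). nra. }
  assert (C0 : Cmod (h * h * Cexp z)%C <= 4 * Cmod h ^ 2 * y ^ 3).
  { rewrite !Cmod_mult.
    assert (Cmod (Cexp z) <= y ^ 3) by nra.
    pose proof (Cmod_ge_0 (Cexp z)).
    assert (0 <= Cmod h * Cmod h) by nra. nra. }
  set (m := 4 * Cmod h ^ 2 * y ^ 3) in *.
  replace ((Cmod a0 + Cmod a1) * y + (Cmod a + Cmod b + Cmod c) * m) with
    ((Cmod a0 + Cmod a1) * y + Cmod a * m + Cmod b * m + Cmod c * m) by ring.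
  pose proof (Cmod_ge_0 a0); pose proof (Cmod_ge_0 a1).
  repeat (eapply Rle_trans; [apply Cmod_triangle|apply Rplus_le_compat]);
    rewrite ?(Cmod_mult a), ?(Cmod_mult b), ?(Cmod_mult c);
    try (apply Rmult_le_compat_l; [apply Cmod_ge_0|assumption]).
  eapply Rle_trans; [apply Cmod_triangle|]; rewrite Cmod_mult, Cmod_R, Rabs_pos_eq by exact L0.
  nra.
Qed.

Definition Cpart (re : bool) (z : C) : R := if re then Re z else Im z.

Lemma Cpart_le re z : Rabs (Cpart re z) <= Cmod z.
Proof. destruct re; [apply re_le_Cmod|apply im_le_Cmod]. Qed.

(** The threshold 5 arises because [K] derivatives bring the power down to [y^(-5)] at most and the
    bracket costs [y^3], which leaves the summable [y^(-2)]. *)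
Lemma fdiffn_power_log re K s h v n : Cmod h <= 1 -> 5 <= Re s + INR K ->
  Rabs (fdiffn K (fun i => Cpart re (power_log s h v (1 + 1 * INR i))) n) <=
  (norm_main v + 4 * Cmod h ^ 2 * norm_rem v) * ((Cmod s + INR K + 2) ^ K * / INR (S n) ^ 2).
Proof.
  intros Hh HK.
  set (M := (norm_main v + 4 * Cmod h ^ 2 * norm_rem v) * (Cmod s + INR K + 2) ^ K).
  assert (Pn := pos_INR n).
  rewrite <- Rmult_assoc; fold M.
  replace (M * / INR (S n) ^ 2) with (M * / INR (S n) ^ 2 * 1 ^ K) by (rewrite pow1; ring).
  rewrite (fdiffn_ext K _ (fun i =>
    (fun k y => Cpart re (power_log (s + INR k) h (coeffs_iter s h v k) y)) O (1 + 1 * INR i))).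
  2: { intros i; simpl INR; rewrite Cplus_0_r; reflexivity. }
  apply (fdiffn_derivative_abs K
    (fun k y => Cpart re (power_log (s + INR k) h (coeffs_iter s h v k) y))
     (M * / INR (S n) ^ 2) 1 1 n); [lra| |].
  - intros k y _ Hy.
    assert (D := Cder_power_log (s + INR k) h (coeffs_iter s h v k) y ltac:(lra)).
    rewrite S_INR, RtoC_plus, Cplus_assoc.
    destruct re; apply D.
  - intros y Hy.
    eapply Rle_trans; [apply Cpart_le|].
    assert (Y : 1 <= y) by lra.
    eapply Rle_trans; [apply power_log_bound; assumption|].
    destruct (coeffs_iter_norms s h v K K Hh (le_n K)) as [N1 N2].
    replace (Re (s + INR K)%C) with (Re s + INR K) by reflexivity.
    assert (E : exp (- (Re s + INR K) * ln y) <= / y ^ 5).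
    { rewrite <- (exp_ln (/ y ^ 5)) by (apply Rinv_0_lt_compat, pow_lt; lra).
      apply exp_le; rewrite ln_Rinv, ln_pow by (try apply pow_lt; lra).
      pose proof (ln_nonneg y Y); simpl INR; nra. }
    assert (S2 : / y ^ 2 <= / INR (S n) ^ 2).
    { rewrite S_INR; apply Rinv_le_contravar; [apply pow_lt; lra|apply pow_incr; lra]. }
    pose proof (norm_main_pos v); pose proof (norm_rem_pos v).
    set (P := (Cmod s + INR K + 2) ^ K) in *.
    assert (P0 : 0 <= P) by (apply pow_le; pose proof (Cmod_ge_0 s); pose proof (pos_INR K); lra).
    pose proof (Cmod_ge_0 h).
    assert (M0 : 0 <= M) by (unfold M; apply Rmult_le_pos; [|exact P0]; nra).
    apply Rle_trans with (/ y ^ 5 * (M * y ^ 3)).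
    + apply Rmult_le_compat; [apply Rlt_le, exp_pos| |exact E|].
      * pose proof (norm_main_pos (coeffs_iter s h v K)).
        pose proof (norm_rem_pos (coeffs_iter s h v K)).
        assert (0 <= y ^ 3) by (apply pow_le; lra).
        assert (0 <= 4 * Cmod h ^ 2 * y ^ 3) by (apply Rmult_le_pos; nra). nra.
      * unfold M.
        assert (Y3 : y <= y ^ 3) by nra.
        assert (0 <= y ^ 3) by (apply pow_le; lra).
        assert (0 <= 4 * Cmod h ^ 2 * y ^ 3) by (apply Rmult_le_pos; nra).
        replace (_ * P * y ^ 3) with (P * norm_main v * y ^ 3 + P * norm_rem v * (4 * Cmod h ^ 2 * y ^ 3)) by ring.
        apply Rplus_le_compat; [|apply Rmult_le_compat_r; assumption].
        apply Rmult_le_compat; try assumption; [apply norm_main_pos|lra].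
    + replace (/ y ^ 5 * (M * y ^ 3)) with (M * / y ^ 2) by (field; lra).
      apply Rmult_le_compat_l; assumption.
Qed.

(** * The Dirichlet L-function of [chi32] *)

Fixpoint RS (K : nat) (h f : nat -> R) : R :=
  match K with
  | O => Series (fun n => h n * f n)
  | S K => - antidiff h 0 * f 0%nat - RS K (antidiff_shift h) (fdiff f)
  end.

Lemma is_RS_RS K h f l : is_RS K h f l -> RS K h f = l.
Proof.
  revert h f l; induction K as [|K IH]; intros h f l H; simpl in *.
  - apply is_series_unique, H.
  - rewrite (IH _ _ _ H); ring.
Qed.

(** The constant is fixed before [f], so a family of amplitude [m = |h|^2] has regularised sums
    [O(|h|^2)]. The envelope [B] controls the boundary terms and [M] the final series. *)
Lemma is_RS_bound K h (B M : nat -> R) :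
  balanced h -> ex_series M ->
  exists c, 0 <= c /\ forall f l m, 0 <= m -> (forall i, Rabs (f i) <= m * B i) ->
    (forall i, Rabs (fdiffn K f i) <= m * M i) -> is_RS K h f l -> Rabs l <= c * m.
Proof.
  intros Bh HM; revert h B Bh; induction K as [|K IH]; intros h B Bh.
  - destruct (balanced_bounded h Bh) as [b [b0 Hb]].
    exists (b * Rabs (Series M)); split; [apply Rmult_le_pos; [exact b0|apply Rabs_pos]|].
    intros f l m Hm _ Hf Hl; simpl in *.
    rewrite <- (is_series_unique _ _ Hl).
    apply Rle_trans with (Series (fun n => b * m * M n)).
    + apply Series_abs_le; [|apply (ex_series_scal_l (V := R_NormedModule) (b * m) M HM)].
      intros n; rewrite Rabs_mult, Rmult_assoc.
      apply Rmult_le_compat; auto using Rabs_pos.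
    + rewrite Series_scal_l; pose proof (Rle_abs (Series M)).
      replace (b * Rabs (Series M) * m) with (b * m * Rabs (Series M)) by ring.
      apply Rmult_le_compat_l; [apply Rmult_le_pos|]; assumption.
  - destruct (IH (antidiff_shift h) (fun i => B (S i) + B i)) as [c [c0 Hc]];
      [apply balanced_antidiff_shift, Bh|].
    exists (Rabs (antidiff h 0) * Rabs (B 0%nat) + c); split.
    { apply Rplus_le_le_0_compat; [apply Rmult_le_pos; apply Rabs_pos|exact c0]. }
    intros f l m Hm Hf HD Hl; simpl in *.
    assert (X : Rabs (- antidiff h 0 * f 0%nat - l) <= c * m).
    { apply Hc with (fdiff f); auto; intros i; unfold fdiff.
      eapply Rle_trans; [apply Rabs_triang|]; rewrite Rabs_Ropp, Rmult_plus_distr_l.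
      apply Rplus_le_compat; apply Hf. }
    assert (Y : Rabs (- antidiff h 0 * f 0%nat) <= Rabs (antidiff h 0) * Rabs (B 0%nat) * m).
    { rewrite Rabs_mult, Rabs_Ropp, Rmult_assoc; apply Rmult_le_compat_l; [apply Rabs_pos|].
      eapply Rle_trans; [apply Hf|]; rewrite Rmult_comm.
      apply Rmult_le_compat_r; [exact Hm|apply Rle_abs]. }
    replace l with (- antidiff h 0 * f 0%nat - (- antidiff h 0 * f 0%nat - l)) by ring.
    eapply Rle_trans; [apply Rabs_triang|]; rewrite Rabs_Ropp; lra.
Qed.

Lemma chi32_periodic n : chi32 (n + 3) = chi32 n.
Proof. unfold chi32; replace (n + 3)%nat with (n + 1 * 3)%nat by lia; rewrite Nat.Div0.mod_add; reflexivity. Qed.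

Definition chiS (n : nat) : R := chi32 (S n).

Lemma balanced_chiS : balanced chiS.
Proof.
  split; [|unfold chiS, chi32; simpl; ring].
  intros n; unfold chiS; replace (S (n + 6)) with (S n + 3 + 3)%nat by lia.
  rewrite !chi32_periodic; reflexivity.
Qed.

Definition dirichlet (s : C) (n : nat) : C := Cexp (- s * ln (INR (S n))).
Definition dirichlet' (s : C) (n : nat) : C := (- ln (INR (S n)) * dirichlet s n)%C.
Definition dirichlet_rem (s h : C) (n : nat) : C :=
  (dirichlet (s + h) n - dirichlet s n - h * dirichlet' s n)%C.

Lemma INR_S_affine i : INR (S i) = 1 + 1 * INR i.
Proof. rewrite S_INR; ring. Qed.

Lemma dirichlet_power_log s n :
  dirichlet s n = power_log s 0 (RtoC 1, RtoC 0, RtoC 0, RtoC 0, RtoC 0) (1 + 1 * INR n).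
Proof. unfold dirichlet, power_log; rewrite INR_S_affine; ring. Qed.

Lemma dirichlet'_power_log s n :
  dirichlet' s n = power_log s 0 (RtoC 0, (- RtoC 1)%C, RtoC 0, RtoC 0, RtoC 0) (1 + 1 * INR n).
Proof. unfold dirichlet', dirichlet, power_log; rewrite INR_S_affine; ring. Qed.

(** Taking out [y^(-s)] leaves [y^(-h) - 1 + h ln y], the third member of the stable family. *)
Lemma dirichlet_rem_power_log s h n :
  dirichlet_rem s h n = power_log s h (RtoC 0, RtoC 0, RtoC 1, RtoC 0, RtoC 0) (1 + 1 * INR n).
Proof.
  unfold dirichlet_rem, dirichlet', dirichlet, power_log; rewrite INR_S_affine.
  replace (- (s + h) * ln (1 + 1 * INR n))%C with
    (- s * ln (1 + 1 * INR n) + - h * ln (1 + 1 * INR n))%C by ring.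
  rewrite Cexp_plus; ring.
Qed.

Definition pow_const (s : C) (K : nat) : R := (Cmod s + INR K + 2) ^ K.

Lemma fdiffn_dirichlet re K s n : 5 <= Re s + INR K ->
  Rabs (fdiffn K (fun i => Cpart re (dirichlet s i)) n) <= pow_const s K * / INR (S n) ^ 2.
Proof.
  intros HK.
  rewrite (fdiffn_ext K _ _ (fun i => f_equal (Cpart re) (dirichlet_power_log s i))).
  eapply Rle_trans; [apply fdiffn_power_log; [rewrite Cmod_0; lra|exact HK]|].
  simpl norm_main; simpl norm_rem; rewrite Cmod_0, Cmod_1; fold (pow_const s K).
  right; ring.
Qed.

Lemma fdiffn_dirichlet' re K s n : 5 <= Re s + INR K ->
  Rabs (fdiffn K (fun i => Cpart re (dirichlet' s i)) n) <= pow_const s K * / INR (S n) ^ 2.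
Proof.
  intros HK.
  rewrite (fdiffn_ext K _ _ (fun i => f_equal (Cpart re) (dirichlet'_power_log s i))).
  eapply Rle_trans; [apply fdiffn_power_log; [rewrite Cmod_0; lra|exact HK]|].
  simpl norm_main; simpl norm_rem; rewrite Cmod_opp, Cmod_0, Cmod_1; fold (pow_const s K).
  right; ring.
Qed.

Lemma fdiffn_dirichlet_rem re K s h n : Cmod h <= 1 -> 5 <= Re s + INR K ->
  Rabs (fdiffn K (fun i => Cpart re (dirichlet_rem s h i)) n) <=
  Cmod h ^ 2 * (4 * pow_const s K * / INR (S n) ^ 2).
Proof.
  intros Hh HK.
  rewrite (fdiffn_ext K _ _ (fun i => f_equal (Cpart re) (dirichlet_rem_power_log s h i))).
  eapply Rle_trans; [apply fdiffn_power_log; [exact Hh|exact HK]|].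
  simpl norm_main; simpl norm_rem; rewrite Cmod_0, Cmod_1; fold (pow_const s K).
  right; ring.
Qed.

Lemma ex_series_pow_const c : ex_series (fun n => c * / INR (S n) ^ 2).
Proof. apply (ex_series_scal_l (V := R_NormedModule) c _ ex_series_inv_sq). Qed.

Lemma is_lim_seq_dominated_inv_sq f c :
  (forall n, Rabs (f n) <= c * / INR (S n) ^ 2) -> is_lim_seq f 0.
Proof.
  intros H; apply is_lim_seq_abs_0.
  apply is_lim_seq_le_le with (fun _ => 0) (fun n => c * / INR (S n) ^ 2).
  - intros n; split; [apply Rabs_pos|apply H].
  - apply is_lim_seq_const.
  - apply ex_series_lim_0, ex_series_pow_const.
Qed.

Definition is_CRS (K : nat) (h : nat -> R) (f : nat -> C) (l : C) : Prop :=
  forall re, is_RS K h (fun n => Cpart re (f n)) (Cpart re l).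

Lemma Cpart_inj z w : (forall re, Cpart re z = Cpart re w) -> z = w.
Proof. intros H; apply C_eq; [apply (H true)|apply (H false)]. Qed.

Definition CRS K h (f : nat -> C) : C :=
  (RS K h (fun n => Cpart true (f n)), RS K h (fun n => Cpart false (f n))).

Lemma ex_CRS K h f M : balanced h ->
  (forall re n, Rabs (fdiffn K (fun i => Cpart re (f i)) n) <= M n) -> ex_series M ->
  is_CRS K h f (CRS K h f).
Proof.
  intros Bh Hf HM re; destruct (ex_RS K h _ M Bh (Hf re) HM) as [l Hl].
  replace (Cpart re (CRS K h f)) with (RS K h (fun n => Cpart re (f n))) by (destruct re; reflexivity).
  rewrite (is_RS_RS _ _ _ _ Hl); exact Hl.
Qed.

Definition dirichlet_order (s : C) : nat := Z.to_nat (up (5 - Re s)).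

Lemma dirichlet_order_spec s : 5 <= Re s + INR (dirichlet_order s).
Proof.
  unfold dirichlet_order; destruct (archimed (5 - Re s)) as [H _]; rewrite INR_IZR_INZ.
  assert (IZR (up (5 - Re s)) <= IZR (Z.of_nat (Z.to_nat (up (5 - Re s))))) by (apply IZR_le; lia).
  lra.
Qed.

Definition L3 (s : C) : C := CRS (dirichlet_order s) chiS (dirichlet s).

Lemma is_RS_change_order h f K K' l : balanced h ->
  is_lim_seq (fdiffn K f) 0 -> is_lim_seq (fdiffn K' f) 0 ->
  is_RS K h f l -> is_RS K' h f l.
Proof.
  intros Bh H H' Hl; destruct (le_lt_dec K K') as [D|D].
  - replace K' with ((K' - K) + K)%nat by lia; apply is_RS_add; assumption.
  - replace K with ((K - K') + K')%nat in Hl by lia.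
    apply is_RS_add in Hl; assumption.
Qed.

(** The order used in [L3] jumps with [s]. Any large enough order gives the same value, so one [K]
    can serve all points near a given one. *)
Lemma is_CRS_L3 K s : 5 <= Re s + INR K -> is_CRS K chiS (dirichlet s) (L3 s).
Proof.
  intros HK re.
  apply is_RS_change_order with (K := dirichlet_order s); [apply balanced_chiS| | |].
  - apply is_lim_seq_dominated_inv_sq with (pow_const s (dirichlet_order s)).
    intros n; apply fdiffn_dirichlet, dirichlet_order_spec.
  - apply is_lim_seq_dominated_inv_sq with (pow_const s K).
    intros n; apply fdiffn_dirichlet, HK.
  - apply (ex_CRS (dirichlet_order s) chiS (dirichlet s) (fun n => pow_const s (dirichlet_order s) * / INR (S n) ^ 2)).
    + apply balanced_chiS.
    + intros r n; apply fdiffn_dirichlet, dirichlet_order_spec.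
    + apply ex_series_pow_const.
Qed.

Lemma C_is_derive_quadratic (f : C -> C) (s l : C) c :
  0 <= c ->
  (forall h, Cmod h <= 1 -> Cmod (f (s + h) - f s - h * l)%C <= c * Cmod h ^ 2) ->
  is_derive f s l.
Proof.
  intros Hc H; split; [apply is_linear_scal_l|].
  intros x Hx; apply (is_filter_lim_locally_unique (V := AbsRing_NormedModule C_AbsRing)) in Hx; subst x.
  intros eps.
  assert (D : 0 < Rmin 1 (eps / (c + 1))).
  { apply Rmin_pos; [lra|]; apply Rdiv_lt_0_compat; [apply cond_pos|lra]. }
  exists (mkposreal _ D); intros y Hy; simpl in Hy.
  unfold ball in Hy; simpl in Hy; unfold AbsRing_ball in Hy.
  set (h := (y - s)%C).
  assert (B : Cmod h < Rmin 1 (eps / (c + 1))) by exact Hy.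
  assert (E : (s + h)%C = y) by (unfold h; change (s + (y - s) = y)%C; ring).
  assert (B1 : Cmod h < 1) by (eapply Rlt_le_trans; [exact B|apply Rmin_l]).
  assert (B2 : Cmod h < eps / (c + 1)) by (eapply Rlt_le_trans; [exact B|apply Rmin_r]).
  specialize (H h ltac:(lra)).
  rewrite E in H.
  change (Cmod (f y - f s - h * l)%C <= eps * Cmod h).
  eapply Rle_trans; [exact H|].
  pose proof (Cmod_ge_0 h).
  replace (c * Cmod h ^ 2) with (c * Cmod h * Cmod h) by ring.
  apply Rmult_le_compat_r; [assumption|].
  apply Rmult_lt_compat_r with (r := c + 1) in B2; [|lra].
  replace (eps / (c + 1) * (c + 1)) with (pos eps) in B2 by (field; lra).
  nra.
Qed.

Lemma is_CRS_lin K h f g l m (a b : C) : is_CRS K h f l -> is_CRS K h g m ->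
  is_CRS K h (fun n => a * f n + b * g n)%C (a * l + b * m)%C.
Proof.
  intros Hf Hg re.
  pose proof (is_RS_lin K h _ _ _ _ (Re a) (if re then - Im a else Im a)
     (Hf true) (Hf false)) as F1.
  pose proof (is_RS_lin K h _ _ _ _ (Re b) (if re then - Im b else Im b)
     (Hg true) (Hg false)) as G1.
  pose proof (is_RS_lin K h _ _ _ _ (Im a) (Re a) (Hf true) (Hf false)) as F2.
  pose proof (is_RS_lin K h _ _ _ _ (Im b) (Re b) (Hg true) (Hg false)) as G2.
  destruct re.
  - pose proof (is_RS_lin K h _ _ _ _ 1 1 F1 G1) as H.
    eapply is_RS_ext in H.
    + match type of H with is_RS _ _ _ ?x => replace (Cpart true _) with x; [exact H|] end.
      simpl; unfold Re, Im; ring.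
    + intros n; simpl; unfold Re, Im; ring.
  - pose proof (is_RS_lin K h _ _ _ _ 1 1 F2 G2) as H.
    eapply is_RS_ext in H.
    + match type of H with is_RS _ _ _ ?x => replace (Cpart false _) with x; [exact H|] end.
      simpl; unfold Re, Im; ring.
    + intros n; simpl; unfold Re, Im; ring.
Qed.

Lemma is_CRS_ext K h f g l : (forall n, f n = g n) -> is_CRS K h f l -> is_CRS K h g l.
Proof.
  intros E H re; eapply is_RS_ext; [|apply H]; intros n; simpl; rewrite E; reflexivity.
Qed.

Lemma Cmod_parts_le z b : (forall re, Rabs (Cpart re z) <= b) -> Cmod z <= 2 * b.
Proof.
  intros H; eapply Rle_trans; [apply Cmod_le_sum|].
  pose proof (H true); pose proof (H false); simpl in *; lra.
Qed.

(** The error of the linear approximation is the regularised sum of [dirichlet_rem], hence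
    [O(|h|^2)]. The margin from 5 to 6 lets the same order [K] serve every [s + h] with
    [|h| <= 1]. *)
Lemma is_derive_L3 K s : 6 <= Re s + INR K ->
  is_derive L3 s (CRS K chiS (dirichlet' s)).
Proof.
  intros HK.
  set (D := CRS K chiS (dirichlet' s)).
  assert (HD : is_CRS K chiS (dirichlet' s) D).
  { apply ex_CRS with (fun n => pow_const s K * / INR (S n) ^ 2).
    - apply balanced_chiS.
    - intros re n; apply fdiffn_dirichlet'; lra.
    - apply ex_series_pow_const. }
  destruct (is_RS_bound K chiS
    (fun i => exp (- Re s * ln (INR (S i))) * (4 * INR (S i) ^ 3))
    (fun n => 4 * pow_const s K * / INR (S n) ^ 2) balanced_chiS
    (ex_series_pow_const _)) as [c [c0 Hc]].
  apply C_is_derive_quadratic with (2 * c); [lra|].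
  intros h Hh.
  rewrite Rmult_assoc; apply Cmod_parts_le; intros re.
  apply Hc with (fun n => Cpart re (dirichlet_rem s h n)).
  - apply pow2_ge_0.
  - intros i; eapply Rle_trans; [apply Cpart_le|].
    rewrite dirichlet_rem_power_log.
    eapply Rle_trans; [apply power_log_bound; [pose proof (pos_INR i); lra|exact Hh]|].
    rewrite <- INR_S_affine; simpl norm_main; simpl norm_rem; rewrite Cmod_0, Cmod_1; right; ring.
  - intros n; apply fdiffn_dirichlet_rem; [exact Hh|lra].
  - assert (Hsh : 5 <= Re (s + h)%C + INR K).
    { replace (Re (s + h)%C) with (Re s + Re h) by reflexivity.
      pose proof (re_le_Cmod h) as Q; apply Rabs_le_between in Q; lra. }
    pose proof (is_CRS_lin _ _ _ _ _ _ 1 (- (1))%C (is_CRS_L3 K (s + h) Hsh)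
      (is_CRS_L3 K s ltac:(lra))) as H1.
    pose proof (is_CRS_lin _ _ _ _ _ _ 1 (- h)%C H1 HD) as H2.
    replace (L3 (s + h) - L3 s - h * D)%C with
      (1%R * (1%R * L3 (s + h) + - (1) * L3 s) + - h * D)%C by ring.
    revert re; change (is_CRS K chiS (dirichlet_rem s h)
      (1%R * (1%R * L3 (s + h) + - (1) * L3 s) + - h * D)%C).
    eapply is_CRS_ext; [|exact H2].
    intros n; unfold dirichlet_rem; simpl; ring.
Qed.

Lemma is_series_C_parts (f : nat -> C) (l : C) :
  is_series (fun n => Re (f n)) (Re l) -> is_series (fun n => Im (f n)) (Im l) ->
  is_series f l.
Proof.
  intros H1 H2; unfold is_series in *.
  assert (E : forall n, sum_n f n = (sum_n (fun n => Re (f n)) n, sum_n (fun n => Im (f n)) n)).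
  { induction n as [|n IH]; [rewrite !sum_O; destruct (f 0%nat); reflexivity|].
    rewrite !sum_Sn, IH; reflexivity. }
  intros P [eps HP].
  assert (B1 := H1 _ (locally_ball (Re l) eps)).
  assert (B2 := H2 _ (locally_ball (Im l) eps)).
  unfold filtermap in *; generalize (filter_and _ _ B1 B2); apply filter_imp.
  intros n [X Y]; apply HP; rewrite E; split; assumption.
Qed.

Lemma L3_entire_Dirichlet : is_entire_Dirichlet_L chi32 L3.
Proof.
  split.
  - intros s; exists (CRS (S (dirichlet_order s)) chiS (dirichlet' s)); apply is_derive_L3.
    rewrite S_INR; pose proof (dirichlet_order_spec s); lra.
  - intros s Hs.
    assert (Z : forall re, is_lim_seq (fun n => Cpart re (dirichlet s n)) 0).
    { intros re; apply is_lim_seq_abs_0.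
      apply is_lim_seq_le_le with (fun _ => 0) (fun n => / INR (S n)).
      - intros n; split; [apply Rabs_pos|].
        eapply Rle_trans; [apply Cpart_le|]; unfold dirichlet; rewrite Cexp_mod.
        replace (Re (- s * ln (INR (S n)))%C) with (- Re s * ln (INR (S n))) by
          (simpl; unfold Re; ring).
        assert (1 <= INR (S n)) by (rewrite S_INR; pose proof (pos_INR n); lra).
        pose proof (ln_nonneg _ H).
        rewrite <- (exp_ln (/ INR (S n))) by (apply Rinv_0_lt_compat; lra).
        apply exp_le; rewrite ln_Rinv by lra; nra.
      - apply is_lim_seq_const.
      - apply is_lim_seq_incr_1 with (u := fun n => / INR n).
        apply is_lim_seq_inv with (l := p_infty); [apply is_lim_seq_INR|discriminate]. }
    (* The terms tend to [0], so the order can be lowered to 0, where the regularised sum is the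
       convergent series. *)
    assert (H : is_CRS 0 chiS (dirichlet s) (L3 s)).
    { intros re; apply is_RS_change_order with (dirichlet_order s); [apply balanced_chiS| |apply Z|].
      - apply is_lim_seq_fdiffn, Z.
      - apply is_CRS_L3, dirichlet_order_spec. }
    apply is_series_C_parts.
    + eapply is_series_ext; [|apply (H true)]; intros n; simpl; unfold Re, Im, chiS; simpl; ring.
    + eapply is_series_ext; [|apply (H false)]; intros n; simpl; unfold Re, Im, chiS; simpl; ring.
Qed.

(** * The derivative of the L-function at -1 and its sign *)

Definition yln (k : nat) (y : R) : R :=
  match k with
  | O => y * ln y
  | 1%nat => ln y + 1
  | 2%nat => / y
  | _ => - / y ^ 2
  end.

Lemma is_derive_yln k y : (k < 3)%nat -> 0 < y -> is_derive (yln k) y (yln (S k) y).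
Proof.
  intros Hk H; do 3 (destruct k as [|k]; [unfold yln; auto_derive; [lra|field; lra]|]); lia.
Qed.

Definition mlnm (n : nat) : R := INR (S n) * ln (INR (S n)).

(** The third derivative of [y ln y] is [- 1 / y^2]. Its size gives convergence, its sign the
    negativity of [RS_mlnm]. *)
Lemma fdiffn_mlnm n : - / INR (S n) ^ 2 <= fdiffn 3 mlnm n <= 0.
Proof.
  rewrite (fdiffn_ext 3 _ (fun i => yln 0 (1 + 1 * INR i)))
    by (intros i; unfold mlnm; rewrite INR_S_affine; reflexivity).
  pose proof (pos_INR n).
  enough (- / INR (S n) ^ 2 * 1 ^ 3 <= fdiffn 3 (fun i => yln 0 (1 + 1 * INR i)) n <= 0 * 1 ^ 3) by lra.
  apply (fdiffn_derivative 3 yln); [lra| |].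
  - intros k y Hk Hy; apply is_derive_yln; [exact Hk|lra].
  - intros y Hy; change (yln 3 y) with (- / y ^ 2); rewrite S_INR.
    assert (0 < / y ^ 2) by (apply Rinv_0_lt_compat, pow_lt; lra).
    assert (/ y ^ 2 <= / (INR n + 1) ^ 2) by (apply Rinv_le_contravar; [apply pow_lt; lra|apply pow_incr; lra]).
    lra.
Qed.

Lemma fdiffn_mlnm_abs n : Rabs (fdiffn 3 mlnm n) <= 1 * / INR (S n) ^ 2.
Proof. pose proof (fdiffn_mlnm n); apply Rabs_le; lra. Qed.

Definition RS_mlnm : R := RS 3 chiS mlnm.

Lemma is_RS_mlnm : is_RS 3 chiS mlnm RS_mlnm.
Proof.
  destruct (ex_RS 3 chiS mlnm _ balanced_chiS fdiffn_mlnm_abs (ex_series_pow_const 1)) as [l Hl].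
  unfold RS_mlnm; rewrite (is_RS_RS _ _ _ _ Hl); exact Hl.
Qed.

Lemma dirichlet'_m1 n : dirichlet' (- (1)) n = RtoC (- mlnm n).
Proof.
  assert (0 < INR (S n)) by apply lt_0_INR, Nat.lt_0_succ.
  unfold dirichlet', dirichlet, mlnm.
  replace (- - (1) * ln (INR (S n)))%C with (RtoC (ln (INR (S n)))) by ring.
  rewrite Cexp_RtoC, exp_ln, <- RtoC_opp, <- RtoC_mult by assumption; f_equal; ring.
Qed.

Lemma C_derive_L3_m1 : C_derive L3 (- (1)) = RtoC (- RS_mlnm).
Proof.
  apply is_C_derive_unique.
  (* At [s = -1] the condition [6 <= Re s + K] holds from order 7 on; the order 3 of [RS_mlnm] is
     raised to it below. *)
  replace (RtoC (- RS_mlnm)) with (CRS 7 chiS (dirichlet' (- (1)))).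
  { apply is_derive_L3; simpl; lra. }
  assert (H6 : 5 <= Re (- (1))%C + INR 7) by (simpl; lra).
  pose proof (ex_CRS 7 chiS (dirichlet' (- (1))) _ balanced_chiS
    (fun re n => fdiffn_dirichlet' re 7 (- (1)) n H6) (ex_series_pow_const _)) as H.
  assert (E : forall f g : nat -> R, (forall n, f n = g n) -> is_lim_seq (fdiffn 7 f) 0 -> is_lim_seq (fdiffn 7 g) 0).
  { intros f g E; apply is_lim_seq_ext; intros n; apply fdiffn_ext, E. }
  apply Cpart_inj; intros re.
  apply is_RS_unique with 7%nat chiS (fun n => Cpart re (dirichlet' (- (1)) n)); [apply H|].
  apply is_RS_ext with (fun n => (if re then - (1) else 0) * mlnm n + 0 * mlnm n).
  { intros n; rewrite dirichlet'_m1; destruct re; simpl; ring. }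
  replace (Cpart re (RtoC (- RS_mlnm)%R)) with ((if re then - (1) else 0) * RS_mlnm + 0 * RS_mlnm)
    by (destruct re; simpl; ring).
  assert (M : is_RS 7 chiS mlnm RS_mlnm).
  { apply is_RS_change_order with 3%nat; [apply balanced_chiS| | |apply is_RS_mlnm].
    - apply is_lim_seq_dominated_inv_sq with 1, fdiffn_mlnm_abs.
    - apply E with (fun n => - (Cpart true (dirichlet' (- (1)) n)) + 0 * 0).
      { intros n; rewrite dirichlet'_m1; simpl; ring. }
      apply is_lim_seq_ext with (fun n => (- (1)) * fdiffn 7 (fun n => Cpart true (dirichlet' (- (1)) n)) n
        + 0 * fdiffn 7 (fun n => Cpart true (dirichlet' (- (1)) n)) n).
      { intros n; rewrite <- fdiffn_lin; apply fdiffn_ext; intros m; ring. }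
      apply is_lim_seq_ext with (fun n => (- (1)) * fdiffn 7 (fun n => Cpart true (dirichlet' (- (1)) n)) n);
        [intros; ring|].
      replace (Finite 0) with (Rbar_mult (- (1)) 0) by (simpl; f_equal; ring).
      apply is_lim_seq_scal_l, is_lim_seq_dominated_inv_sq with (pow_const (- (1)) 7).
      intros n; apply fdiffn_dirichlet', H6. }
  exact (is_RS_lin 7 chiS mlnm mlnm _ _ _ _ M M).
Qed.

(** After three rounds the remaining series is at least [- 1/9] times the second difference of
    [m ln m] at its start. Solving back through the boundary terms gives
    [RS_mlnm <= ln 3 - 2 ln 2]. *)
Lemma RS_mlnm_neg : RS_mlnm < 0.
Proof.
  pose proof is_RS_mlnm as H; cbn [is_RS] in H.
  set (h1 := antidiff_shift chiS) in *; set (h2 := antidiff_shift h1) in *; set (h3 := antidiff_shift h2) in *.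
  assert (A0 : mlnm 0 = 0) by (unfold mlnm; simpl; rewrite ln_1; ring).
  assert (A1 : mlnm 1 = 2 * ln 2) by (unfold mlnm; simpl; reflexivity).
  assert (A2 : mlnm 2 = 3 * ln 3).
  { unfold mlnm; simpl; replace (1 + 1 + 1) with 3 by ring; reflexivity. }
  assert (V : antidiff h1 0 = - 1 / 3 /\ antidiff h2 0 = - 2 / 9 /\ h3 0%nat = 1 / 9
     /\ h3 1%nat = 1 / 9 /\ h3 2%nat = - 2 / 9 /\ h3 3%nat = 1 / 9 /\ h3 4%nat = 1 / 9 /\ h3 5%nat = - 2 / 9).
  { unfold h3, h2, h1, antidiff_shift, antidiff, mean6, chiS, chi32; simpl; repeat split; field. }
  destruct V as [V1 [V2 V3]].
  assert (B3 : forall n, h3 n <= 1 / 9).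
  { intros n; induction n as [n IH] using lt_wf_ind.
    destruct (le_lt_dec 6 n) as [D|D].
    - replace n with ((n - 6) + 6)%nat by lia.
      rewrite (proj1 (balanced_antidiff_shift _ (balanced_antidiff_shift _
        (balanced_antidiff_shift _ balanced_chiS)))); apply IH; lia.
    - do 6 (destruct n as [|n]; [lra|]); lia. }
  set (D3 := fdiffn 3 mlnm) in *.
  change (fdiff (fdiff (fdiff mlnm))) with D3 in H.
  set (l := - antidiff h2 0 * _ - _) in H.
  (* [h3 <= 1/9] and [D3 <= 0], and the sum of [D3] telescopes. *)
  assert (Hl : is_lim_seq (psum (fun n => h3 n * D3 n)) l) by (apply is_series_psum, H).
  assert (T : forall n, psum D3 n = fdiffn 2 mlnm n - fdiffn 2 mlnm 0).
  { induction n as [|n IH]; [simpl; ring|].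
    rewrite psum_S, IH; unfold D3; rewrite (fdiffn_S 2 mlnm n); ring. }
  assert (P : forall n, 1 / 9 * psum D3 n <= psum (fun n => h3 n * D3 n) n).
  { induction n as [|n IH]; [simpl; lra|]; rewrite !psum_S.
    pose proof (B3 n); pose proof (fdiffn_mlnm n) as Q; fold D3 in Q; nra. }
  assert (Q : forall n, 0 <= fdiffn 2 mlnm n).
  { intros n.
    rewrite (fdiffn_ext 2 _ (fun i => yln 0 (1 + 1 * INR i)))
      by (intros i; unfold mlnm; rewrite INR_S_affine; reflexivity).
    pose proof (pos_INR n).
    replace 0 with (0 * 1 ^ 2) by ring.
    eapply Rle_trans; [|apply (fdiffn_derivative 2 yln 0 (/ 1) 1 1 n)]; [lra|lra| |].
    - intros k y Hk Hy; apply is_derive_yln; [lia|lra].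
    - intros y Hy; change (yln 2 y) with (/ y); split; [apply Rlt_le, Rinv_0_lt_compat; lra|].
      apply Rinv_le_contravar; lra. }
  assert (LB : - (1 / 9) * fdiffn 2 mlnm 0 <= l).
  { assert (X : Rbar_le (- (1 / 9) * fdiffn 2 mlnm 0) l).
    { apply (is_lim_seq_le (fun _ => - (1 / 9) * fdiffn 2 mlnm 0) (psum (fun n => h3 n * D3 n))).
      - intros n; specialize (P n); rewrite T in P; specialize (Q n); nra.
      - apply is_lim_seq_const.
      - exact Hl. }
    exact X. }
  assert (LN : 3 * ln 3 < 6 * ln 2).
  { assert (X : ln 3 < ln (2 ^ 2)) by (apply ln_increasing; lra).
    rewrite ln_pow in X by lra; simpl INR in X; lra. }
  revert LB; unfold l; simpl fdiffn; unfold fdiff; rewrite V1, V2, A0, A1, A2.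
  intros; lra.
Qed.

(** * The quantum variable on a vertical line *)

Lemma psum_add a n k : psum a (n + k) = psum a n + psum (fun i => a (n + i)%nat) k.
Proof.
  induction k as [|k IH]; [rewrite Nat.add_0_r; simpl; ring|].
  rewrite Nat.add_succ_r, !psum_S, IH; ring.
Qed.

Lemma psum_plus a b n : psum (fun i => a i + b i) n = psum a n + psum b n.
Proof. induction n as [|n IH]; [simpl; ring|]; rewrite !psum_S, IH; ring. Qed.

Lemma psum_zero n : psum (fun _ => 0) n = 0.
Proof. induction n as [|n IH]; [reflexivity|]; rewrite psum_S, IH; ring. Qed.

Lemma psum_blocks a N J :
  psum a (N * J) = psum (fun rho => psum (fun j => a (N * j + rho)%nat) J) N.
Proof.
  induction J as [|J IH]; [rewrite Nat.mul_0_r; symmetry; apply psum_zero|].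
  rewrite Nat.mul_succ_r, psum_add, IH, <- psum_plus.
  apply psum_ext; intros i _; reflexivity.
Qed.

Lemma class_dominated (a : nat -> R) c N rho : (1 <= N)%nat ->
  (forall n, Rabs (a n) <= c * / INR (S n) ^ 2) ->
  forall j, Rabs (a (N * j + rho)%nat) <= c * / INR (S j) ^ 2.
Proof.
  intros HN H j.
  assert (P : 0 < INR (S j)) by apply lt_0_INR, Nat.lt_0_succ.
  assert (C0 : 0 <= c).
  { specialize (H 0%nat); pose proof (Rabs_pos (a 0%nat)); simpl in H.
    rewrite !Rmult_1_r, Rinv_1 in H; lra. }
  eapply Rle_trans; [apply H|]; apply Rmult_le_compat_l; [exact C0|].
  apply Rinv_le_contravar; [apply pow_lt, P|].
  apply pow_incr; split; [lra|]; apply le_INR; nia.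
Qed.

(** Partial sums of length [N J] regroup exactly by class, and both sides are limits along this
    subsequence. *)
Lemma Series_classes (a : nat -> R) c N : (1 <= N)%nat ->
  (forall n, Rabs (a n) <= c * / INR (S n) ^ 2) ->
  Series a = psum (fun rho => Series (fun j => a (N * j + rho)%nat)) N.
Proof.
  intros HN H.
  assert (E : forall b : nat -> R, (forall n, Rabs (b n) <= c * / INR (S n) ^ 2) -> is_lim_seq (psum b) (Series b)).
  { intros b Hb; apply is_series_psum, Series_correct.
    apply ex_series_dominated with (1 := Hb), ex_series_pow_const. }
  assert (L1 : is_lim_seq (fun J => psum a (N * J)) (Series a)).
  { apply is_lim_seq_subseq with (u := psum a) (phi := fun J => (N * J)%nat); [|apply E, H].
    apply eventually_subseq; intros n; lia. }
  assert (L2 : is_lim_seq (fun J => psum a (N * J))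
     (psum (fun rho => Series (fun j => a (N * j + rho)%nat)) N)).
  { apply is_lim_seq_ext with (fun J => psum (fun rho => psum (fun j => a (N * j + rho)%nat) J) N).
    { intros J; symmetry; apply psum_blocks. }
    apply (filterlim_psum eventually (fun J rho => psum (fun j => a (N * j + rho)%nat) J)
      (fun rho => Series (fun j => a (N * j + rho)%nat))).
    intros rho; apply (E (fun j => a (N * j + rho)%nat)), class_dominated; assumption. }
  apply is_lim_seq_unique in L1; apply is_lim_seq_unique in L2.
  rewrite L1 in L2; injection L2; auto.
Qed.

(** Coefficients of [E6] as a single Lambert series. *)
Definition beta (n : nat) : R := (if Nat.even n then -1 else 1) * chi32 n.

Lemma chi32_bound n : Rabs (chi32 n) <= 1.
Proof.
  unfold chi32; apply Rabs_le; destruct (n mod 3)%nat as [|[|[|k]]]; lra.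
Qed.

Lemma beta_bound n : Rabs (beta n) <= 1.
Proof.
  unfold beta; rewrite Rabs_mult; pose proof (chi32_bound n).
  replace (Rabs (if Nat.even n then -1 else 1)) with 1; [lra|].
  destruct (Nat.even n); [rewrite <- Rabs_R1, <- Rabs_Ropp; f_equal; ring|symmetry; apply Rabs_R1].
Qed.

Lemma chi32_double n : chi32 (2 * n) = - chi32 n.
Proof.
  unfold chi32; replace ((2 * n) mod 3)%nat with ((2 * (n mod 3)) mod 3)%nat
    by apply Nat.Div0.mul_mod_idemp_r.
  pose proof (Nat.mod_upper_bound n 3 ltac:(lia)).
  destruct (n mod 3)%nat as [|[|[|k]]]; simpl; try lra; lia.
Qed.

(** The factor [x^(-4)] makes this bound fit for convergence and derivation at [x > 0], but not for
    the limit at [0]. *)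
Lemma lambert_bound x m c : 0 < x -> (1 <= m)%nat -> Rabs c <= 1 ->
  forall v, Rabs v <= geomW (INR m * x) ->
  Rabs (c * INR m ^ 2 * v) <= 274 / x ^ 4 * / INR m ^ 2.
Proof.
  intros Hx Hm Hc v Hv.
  assert (P : 1 <= INR m) by (apply (le_INR 1), Hm).
  pose proof (geomW_pow4 (INR m * x) ltac:(nra)) as G.
  pose proof (geomW_pos (INR m * x) ltac:(nra)) as GP.
  rewrite !Rabs_mult, (Rabs_pos_eq (INR m ^ 2)) by nra.
  apply Rle_trans with (1 * INR m ^ 2 * geomW (INR m * x)).
  { apply Rmult_le_compat; auto using Rabs_pos.
    - apply Rmult_le_pos; [apply Rabs_pos|nra].
    - apply Rmult_le_compat_r; [nra|exact Hc]. }
  assert (0 < x ^ 4) by (apply pow_lt, Hx).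
  assert (0 < INR m ^ 2) by (apply pow_lt; lra).
  apply Rmult_le_reg_r with (x ^ 4 * INR m ^ 2); [apply Rmult_lt_0_compat; assumption|].
  replace (274 / x ^ 4 * / INR m ^ 2 * (x ^ 4 * INR m ^ 2)) with 274 by (field; lra).
  replace (_ * _) with ((INR m * x) ^ 4 * geomW (INR m * x)) by ring; exact G.
Qed.

Lemma lambert_bound1 x m c : 0 < x -> (1 <= m)%nat -> Rabs c <= 1 ->
  forall v, Rabs v <= geomW (INR m * x) ->
  Rabs (c * INR m * v) <= 274 / x ^ 4 * / INR m ^ 2.
Proof.
  intros Hx Hm Hc v Hv; eapply Rle_trans; [|apply (lambert_bound x m c Hx Hm Hc v Hv)].
  rewrite !Rabs_mult.
  assert (P : 1 <= INR m) by (apply (le_INR 1), Hm).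
  rewrite !(Rabs_pos_eq (INR m)), (Rabs_pos_eq (INR m ^ 2)) by nra.
  apply Rmult_le_compat_r; [apply Rabs_pos|].
  apply Rmult_le_compat_l; [apply Rabs_pos|nra].
Qed.

Definition lam_term (re : bool) (th x : R) (m : nat) : R :=
  beta m * INR m ^ 2 * geom re (INR m * th) (INR m * x).
Definition log_term (re : bool) (th x : R) (m : nat) : R :=
  beta m * INR m * log1m re (INR m * th) (INR m * x).

(** With [q = e^(i th - x)], these are the parts of [1 - E6] and of the logarithm of the product of
    [(1 - q^m)^(m beta(m))], the principal branch being taken in each factor. *)
Definition Lam (re : bool) (th x : R) : R := Series (fun n => lam_term re th x (S n)).
Definition LogProd (re : bool) (th x : R) : R := Series (fun n => log_term re th x (S n)).

Lemma lam_term_bound re th x n : 0 < x ->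
  Rabs (lam_term re th x (S n)) <= 274 / x ^ 4 * / INR (S n) ^ 2.
Proof.
  intros Hx; apply lambert_bound; [exact Hx|lia|apply beta_bound|].
  apply geom_abs, Rmult_lt_0_compat; [apply lt_0_INR, Nat.lt_0_succ|exact Hx].
Qed.

Lemma log_term_bound re th x n : 0 < x ->
  Rabs (log_term re th x (S n)) <= 274 / x ^ 4 * / INR (S n) ^ 2.
Proof.
  intros Hx; apply lambert_bound1; [exact Hx|lia|apply beta_bound|].
  apply log1m_abs, Rmult_lt_0_compat; [apply lt_0_INR, Nat.lt_0_succ|exact Hx].
Qed.

(** For [n = 2 m] one has [8 m^2 = 2 n^2] and [chi(m) = - chi(n)], so the second series adds
    [- 2 chi(n) n^2] at even [n] and reverses the sign there. *)
Lemma E6_lambert re th x : 0 < x ->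
  Series (fun n => chi32 (S n) * INR (S n) ^ 2 * geom re (INR (S n) * th) (INR (S n) * x))
  + 8 * Series (fun n => chi32 (S n) * INR (S n) ^ 2
                 * geom re (INR (2 * S n) * th) (INR (2 * S n) * x))
  = Lam re th x.
Proof.
  intros Hx.
  set (a := fun n => chi32 (S n) * INR (S n) ^ 2 * geom re (INR (S n) * th) (INR (S n) * x)).
  set (e := fun n => (if Nat.even (S n) then -2 else 0) * a n).
  assert (Ba : forall n, Rabs (a n) <= 274 / x ^ 4 * / INR (S n) ^ 2).
  { intros n; apply lambert_bound; [exact Hx|lia|apply chi32_bound|].
    apply geom_abs, Rmult_lt_0_compat; [apply lt_0_INR, Nat.lt_0_succ|exact Hx]. }
  assert (Be : forall n, Rabs (e n) <= 2 * (274 / x ^ 4) * / INR (S n) ^ 2).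
  { intros n; unfold e; rewrite Rabs_mult, Rmult_assoc; specialize (Ba n).
    apply Rmult_le_compat; auto using Rabs_pos.
    destruct (Nat.even (S n)); [apply Rabs_le; lra|rewrite Rabs_R0; lra]. }
  unfold Lam; rewrite (Series_ext (fun n => lam_term re th x (S n)) (fun n => a n + e n)).
  2: { intros n; unfold e, a, lam_term, beta; destruct (Nat.even (S n)); ring. }
  rewrite (Series_plus a e (ex_series_dominated _ _ Ba (ex_series_pow_const _))
    (ex_series_dominated _ _ Be (ex_series_pow_const _))).
  f_equal; rewrite (Series_classes e _ 2 ltac:(lia) Be); cbn [psum].
  (* Index [n] stands for [m = n + 1]: the even indices carry the odd [m], where [e] vanishes. *)
  rewrite (Series_ext (fun j => e (2 * j + 0)%nat) (fun j => 0 * a j)).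
  2: { intros j; unfold e; replace (S (2 * j + 0)) with (S (2 * j)) by lia.
       rewrite Nat.even_succ, Nat.odd_mul; simpl; ring. }
  rewrite Series_scal_l, <- Series_scal_l.
  rewrite Rmult_0_l, !Rplus_0_l; apply Series_ext; intros j.
  unfold e, a; replace (S (2 * j + 1)) with (2 * S j)%nat by lia.
  rewrite Nat.even_mul, chi32_double; cbn [Nat.even orb].
  rewrite !mult_INR; simpl (INR 2); ring.
Qed.

(** Termwise derivation: the difference quotients are dominated by [M] and
    converge termwise. *)
Lemma is_derive_Series (a a' : nat -> R -> R) (M : nat -> R) x d :
  0 < d ->
  (forall n y, Rabs (y - x) < d -> is_derive (a n) y (a' n y) /\ Rabs (a' n y) <= M n) ->
  (forall y, Rabs (y - x) < d -> ex_series (fun n => a n y)) ->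
  ex_series M ->
  is_derive (fun y => Series (fun n => a n y)) x (Series (fun n => a' n x)).
Proof.
  intros Hd HA HE HM.
  apply is_derive_Reals.
  assert (D0 : Rabs (x - x) < d) by (rewrite Rminus_diag, Rabs_R0; exact Hd).
  assert (Q : forall n h, h <> 0 -> Rabs h < d -> Rabs ((a n (x + h) - a n x) / h) <= M n).
  { intros n h Hn Hh.
    pose proof (bounded_variation (a n) (a' n) (M n) x (x + h)) as B.
    replace (x + h - x) with h in B by ring.
    unfold Rdiv; rewrite Rabs_mult, Rabs_inv.
    assert (0 < Rabs h) by (apply Rabs_pos_lt, Hn).
    apply Rmult_le_reg_r with (Rabs h); [assumption|].
    rewrite Rmult_assoc, Rinv_l, Rmult_1_r by lra.
    apply B; intros t Ht; apply HA; lra. }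
  assert (H : filterlim (fun h => Series (fun n => (a n (x + h) - a n x) / h))
    (locally' 0) (locally (Series (fun n => a' n x)))).
  { apply (filterlim_Series_dominated (locally' 0) _ (fun n => a' n x) M).
    - exists (mkposreal d Hd); intros h Hh Hn n.
      unfold ball in Hh; simpl in Hh; unfold AbsRing_ball, abs, minus, plus, opp in Hh; simpl in Hh.
      rewrite Ropp_0, Rplus_0_r in Hh.
      apply Q; assumption.
    - intros n; apply (HA n x D0).
    - exact HM.
    - intros n; apply filterlim_R_spec; [typeclasses eauto|]; intros eps He.
      destruct (HA n x D0) as [Hn _]; apply is_derive_Reals in Hn.
      destruct (Hn eps He) as [dl Hdl]; exists dl; intros h Hh Hn0; apply Hdl; [exact Hn0|].
      unfold ball in Hh; simpl in Hh; unfold AbsRing_ball, abs, minus, plus, opp in Hh; simpl in Hh.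
      rewrite Ropp_0, Rplus_0_r in Hh; exact Hh. }
  intros eps He.
  destruct (proj1 (filterlim_R_spec _ _ _) H eps He) as [dl Hdl].
  assert (Dm : 0 < Rmin d dl) by (apply Rmin_pos; [exact Hd|apply cond_pos]).
  exists (mkposreal _ Dm); intros h Hn Hh; simpl in Hh.
  assert (Hh1 : Rabs h < d) by (eapply Rlt_le_trans; [exact Hh|apply Rmin_l]).
  assert (Hh2 : Rabs h < dl) by (eapply Rlt_le_trans; [exact Hh|apply Rmin_r]).
  replace ((_ - _) / h) with (Series (fun n => (a n (x + h) - a n x) / h)).
  - apply Hdl; [|exact Hn].
    unfold ball; simpl; unfold AbsRing_ball, abs, minus, plus, opp; simpl.
    rewrite Ropp_0, Rplus_0_r; exact Hh2.
  - rewrite <- Series_minus.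
    + unfold Rdiv; rewrite Series_scal_r; reflexivity.
    + apply HE; replace (x + h - x) with h by ring; exact Hh1.
    + apply HE, D0.
Qed.

Lemma is_derive_LogProd re th x : 0 < x -> is_derive (LogProd re th) x (Lam re th x).
Proof.
  intros Hx.
  (* Within distance [x / 2] of [x] the variable stays above [x / 2], which makes the majorant
     uniform. *)
  apply (is_derive_Series (fun n y => log_term re th y (S n)) (fun n y => lam_term re th y (S n))
    (fun n => 274 / (x / 2) ^ 4 * / INR (S n) ^ 2) x (x / 2)); [lra| | |apply ex_series_pow_const].
  - intros n y Hy; apply Rabs_def2 in Hy.
    assert (P : 0 < INR (S n)) by apply lt_0_INR, Nat.lt_0_succ.
    split.
    + unfold log_term, lam_term.
      generalize (beta (S n)); revert P; generalize (INR (S n)); intros m P b.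
      replace (b * m ^ 2 * geom re (m * th) (m * y)) with
        (b * m * (m * geom re (m * th) (m * y))) by ring.
      apply (is_derive_scal (fun y => log1m re (m * th) (m * y))).
      apply (is_derive_comp (log1m re (m * th)) (fun y => m * y)).
      * apply is_derive_log1m, Rmult_lt_0_compat; lra.
      * auto_derive; [trivial|ring].
    + eapply Rle_trans; [apply lam_term_bound; lra|].
      apply Rmult_le_compat_r; [apply Rlt_le, Rinv_0_lt_compat, pow_lt, P|].
      apply Rmult_le_compat_l; [lra|].
      apply Rinv_le_contravar; [apply pow_lt; lra|apply pow_incr; lra].
  - intros y Hy; apply Rabs_def2 in Hy.
    apply ex_series_dominated with (fun n => 274 / y ^ 4 * / INR (S n) ^ 2).
    + intros n; apply log_term_bound; lra.
    + apply ex_series_pow_const.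
Qed.

Lemma Cexp_pow z n : (Cexp z ^ n)%C = Cexp (INR n * z).
Proof.
  induction n as [|n IH].
  - simpl; rewrite Cmult_0_l, Cexp_0; reflexivity.
  - rewrite S_INR, RtoC_plus, Cmult_plus_distr_r, Cexp_plus, <- IH, Cmult_1_l; simpl; ring.
Qed.

Lemma nome_vertical r t : nome (r, t) = Cexp ((- (2 * PI * t))%R, (2 * PI * r)%R).
Proof. unfold nome; f_equal; apply C_eq; simpl; ring. Qed.

Lemma Cexp_geom th y : 0 < y ->
  (Cexp ((- y)%R, th) / (1 - Cexp ((- y)%R, th)))%C = (geom true th y, geom false th y).
Proof.
  intros H; destruct (log1m_denominators th y H) as [D1 [D2 D3]].
  pose proof (cos_sin_sq th) as CS.
  assert (DD : 0 < 1 - 2 * exp (- y) * cos th + exp (- y) ^ 2) by nra.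
  assert (N : (1 - Cexp ((- y)%R, th))%C <> 0).
  { intros E; apply (f_equal Re) in E; simpl in E; lra. }
  set (z := Cexp ((- y)%R, th)) in *.
  set (g := (geom true th y, geom false th y) : C).
  assert (E : z = (g * (1 - z))%C).
  { apply C_eq; unfold g, z, geom, Cexp; simpl; field_simplify_eq; try lra;
      replace (sin th ^ 2) with (1 - cos th ^ 2) by (rewrite <- CS; ring); ring. }
  rewrite E at 1; unfold Cdiv; rewrite <- Cmult_assoc, Cinv_r, Cmult_1_r by exact N.
  reflexivity.
Qed.

Lemma E6_vertical r t : 0 < t ->
  E6 (r, t) = (1 - Lam true (2 * PI * r) (2 * PI * t), - Lam false (2 * PI * r) (2 * PI * t)).
Proof.
  intros Ht; pose proof PI_RGT_0 as HP.
  set (x := 2 * PI * t); set (th := 2 * PI * r).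
  assert (Hx : 0 < x) by (unfold x; nra).
  assert (Q : forall m, (1 <= m)%nat -> (nome (r, t) ^ m / (1 - nome (r, t) ^ m))%C =
    (geom true (INR m * th) (INR m * x), geom false (INR m * th) (INR m * x))).
  { intros m Hm; rewrite nome_vertical, Cexp_pow.
    replace (INR m * ((- (2 * PI * t))%R, (2 * PI * r)%R))%C with (((- (INR m * x))%R, (INR m * th)%R) : C)
      by (apply C_eq; simpl; unfold x, th; ring).
    apply Cexp_geom; pose proof (le_INR 1 m Hm) as I; simpl in I; nra. }
  rewrite <- !E6_lambert by exact Hx.
  assert (R1 : forall (p : nat -> nat), (forall n, (1 <= p (S n))%nat) ->
    CSeries (fun n => (chi32 (S n) * INR (S n) ^ 2 *
      (nome (r, t) ^ p (S n) / (1 - nome (r, t) ^ p (S n))))%C) =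
    (Series (fun n => chi32 (S n) * INR (S n) ^ 2
       * geom true (INR (p (S n)) * th) (INR (p (S n)) * x)),
     Series (fun n => chi32 (S n) * INR (S n) ^ 2
       * geom false (INR (p (S n)) * th) (INR (p (S n)) * x)))).
  { intros p Hp; unfold CSeries; f_equal; apply Series_ext; intros n;
      rewrite Q by apply Hp; rewrite <- RtoC_pow, <- RtoC_mult;
      generalize (chi32 (S n) * INR (S n) ^ 2); intros c; simpl; ring. }
  unfold E6; cbv zeta.
  rewrite (R1 (fun m => m)), (R1 (fun m => (2 * m)%nat)) by (intros; lia).
  apply C_eq; simpl; ring.
Qed.

Lemma Cder_vertical (f : C -> C) r t l : is_derive f (r, t) l ->
  Cder (fun t => f (r, t)) t (Ci * l)%C.
Proof.
  intros [_ H]; specialize (H (r, t) (fun P HP => HP)).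
  assert (K : forall eps : posreal, locally t (fun s =>
    Cmod (f (r, s) - f (r, t) - (s - t)%R * (Ci * l))%C <= eps * Rabs (s - t))).
  { intros eps; destruct (H eps) as [d Hd]; exists d; intros s Hs.
    assert (E : ((r, s) - (r, t) : C)%C = ((s - t)%R * Ci)%C) by (apply C_eq; simpl; ring).
    assert (B : Cmod ((r, s) - (r, t) : C)%C = Rabs (s - t)).
    { rewrite E, Cmod_mult, Cmod_R, Cmod_Ci; ring. }
    specialize (Hd (r, s)).
    assert (Hb : ball (M := AbsRing_NormedModule C_AbsRing) (r, t) d (r, s)).
    { change (Cmod ((r, s) - (r, t) : C)%C < d); rewrite B; exact Hs. }
    specialize (Hd Hb).
    change (Cmod (f (r, s) - f (r, t) - ((r, s) - (r, t)) * l)%C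
      <= eps * Cmod ((r, s) - (r, t) : C)%C) in Hd.
    rewrite B, E, <- Cmult_assoc in Hd; exact Hd. }
  split; (split; [apply is_linear_scal_l|]); intros x Hx;
    apply (is_filter_lim_locally_unique (V := AbsRing_NormedModule R_AbsRing)) in Hx; subst x;
    intros eps; generalize (K eps); apply filter_imp; intros s Hs.
  - eapply Rle_trans; [|exact Hs].
    eapply Rle_trans; [|apply re_le_Cmod]; right.
    change (Rabs (Re (f (r, s)) - Re (f (r, t)) - (s - t) * Re (Ci * l)%C) =
      Rabs (Re (f (r, s) - f (r, t) - (s - t)%R * (Ci * l))%C)).
    f_equal; simpl; unfold Re, Im; ring.
  - eapply Rle_trans; [|exact Hs].
    eapply Rle_trans; [|apply im_le_Cmod]; right.
    change (Rabs (Im (f (r, s)) - Im (f (r, t)) - (s - t) * Im (Ci * l)%C) =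
      Rabs (Im (f (r, s) - f (r, t) - (s - t)%R * (Ci * l))%C)).
    f_equal; simpl; unfold Re, Im; ring.
Qed.

Definition CLogProd (r t : R) : C :=
  (LogProd true (2 * PI * r) (2 * PI * t), LogProd false (2 * PI * r) (2 * PI * t)).

Lemma Cder_CLogProd r t : 0 < t ->
  Cder (CLogProd r) t ((2 * PI)%R * (1 - E6 (r, t)))%C.
Proof.
  intros Ht; pose proof PI_RGT_0 as HP; rewrite E6_vertical by exact Ht.
  assert (D : forall re, is_derive (fun t => LogProd re (2 * PI * r) (2 * PI * t)) t
    (2 * PI * Lam re (2 * PI * r) (2 * PI * t))).
  { intros re; apply (is_derive_comp (LogProd re (2 * PI * r)) (fun t => 2 * PI * t)).
    - apply is_derive_LogProd; nra.
    - auto_derive; [trivial|ring]. }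
  split.
  - replace (Re _) with (2 * PI * Lam true (2 * PI * r) (2 * PI * t)) by (simpl; ring); apply (D true).
  - replace (Im _) with (2 * PI * Lam false (2 * PI * r) (2 * PI * t)) by (simpl; ring); apply (D false).
Qed.

(** The product tends to [1] at the cusp at infinity. The decay is in fact exponential, but [1 / x]
    suffices to identify a constant. *)
Lemma LogProd_large re th x : 1 <= x ->
  Rabs (LogProd re th x) <= 274 * Series (fun n => / INR (S n) ^ 2) / x.
Proof.
  intros Hx; set (S2 := Series _).
  assert (0 <= S2).
  { unfold S2; rewrite <- (Rmult_0_l (Series (fun n => / INR (S n) ^ 2))), <- Series_scal_l.
    apply Series_le; [|apply ex_series_inv_sq]; intros n.
    assert (0 < / INR (S n) ^ 2) by (apply Rinv_0_lt_compat, pow_lt, lt_0_INR, Nat.lt_0_succ); lra. }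
  apply Rle_trans with (274 / x ^ 4 * S2).
  - unfold S2; rewrite <- Series_scal_l; apply Series_abs_le; [|apply ex_series_pow_const].
    intros n; apply log_term_bound; lra.
  - replace (274 * S2 / x) with (274 * / x * S2) by (field; lra).
    apply Rmult_le_compat_r; [assumption|]; apply Rmult_le_compat_l; [lra|].
    apply Rinv_le_contravar; [lra|]; rewrite <- (pow_1 x) at 1; apply Rle_pow; [lra|lia].
Qed.

Lemma eq_0_of_inv_bound (v B t0 : R) : (forall t, t0 < t -> 1 <= t -> Rabs v <= B / t) -> v = 0.
Proof.
  intros H; destruct (Req_dec v 0) as [E|E]; [exact E|exfalso].
  apply Rabs_pos_lt in E.
  set (t := Rmax (Rmax (t0 + 1) 1) ((Rabs B + 1) / Rabs v)).
  assert (T1 : t0 + 1 <= t) by (eapply Rle_trans; [apply Rmax_l|apply Rmax_l]).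
  assert (T2 : 1 <= t) by (eapply Rle_trans; [apply Rmax_r|apply Rmax_l]).
  assert (T3 : (Rabs B + 1) / Rabs v <= t) by apply Rmax_r.
  specialize (H t ltac:(lra) T2).
  apply (Rmult_le_compat_r t) in H; [|lra].
  replace (B / t * t) with B in H by (field; lra).
  apply (Rmult_le_compat_r (Rabs v)) in T3; [|lra].
  replace ((Rabs B + 1) / Rabs v * Rabs v) with (Rabs B + 1) in T3 by (field; lra).
  pose proof (Rle_abs B); nra.
Qed.

Lemma Cder_opp f x l : Cder f x l -> Cder (fun t => - f t)%C x (- l)%C.
Proof.
  intros [F1 F2]; split.
  - exact (is_derive_opp (V := R_NormedModule) (fun t => Re (f t)) x (Re l) F1).
  - exact (is_derive_opp (V := R_NormedModule) (fun t => Im (f t)) x (Im l) F2).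
Qed.

Lemma Cder_zero_const (f : R -> C) a b : 0 < a -> 0 < b ->
  (forall t, 0 < t -> Cder f t 0) -> f a = f b.
Proof.
  intros Ha Hb H.
  assert (X : forall a b, 0 < a -> a < b -> f a = f b).
  { intros u v Hu Huv; apply C_eq.
    - apply (eq_is_derive (V := R_NormedModule) (fun t => Re (f t))); [|exact Huv].
      intros t Ht; apply (H t); lra.
    - apply (eq_is_derive (V := R_NormedModule) (fun t => Im (f t))); [|exact Huv].
      intros t Ht; apply (H t); lra. }
  destruct (Rtotal_order a b) as [L|[E|L]]; [apply X; assumption|rewrite E; reflexivity|].
  symmetry; apply X; assumption.
Qed.

(** Along the line [d log Ql / dt = - 2 pi E6], while the exponent in [Z] has derivative
    [2 pi - 2 pi (1 - E6)]. So [Z] is constant, and the leading term of [Ql] at infinity determines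
    it. *)
Lemma quantum_variable_vertical (Ql : C -> C) r :
  (forall tau : C, 0 < Im tau -> is_derive Ql tau (2 * PI * Ci * E6 tau * Ql tau)%C) ->
  (exists M K : R, 0 < M /\ forall tau : C, M < Im tau ->
     Cmod (nome tau + Ql tau) <= K * Cmod (Ql tau) ^ 2) ->
  forall t, 0 < t -> Ql (r, t) = (- nome (r, t) * Cexp (CLogProd r t))%C.
Proof.
  intros HD [M [K [HM HK]]]; pose proof PI_RGT_0 as HP.
  set (Z := fun t : R => (Ql (r, t) * Cexp ((2 * PI * t)%R + - CLogProd r t))%C).
  assert (HZ : forall t, 0 < t -> Cder Z t 0).
  { intros s Hs; eapply Cder_eq.
    - apply (Cder_mult (fun t => Ql (r, t)) (fun t : R => Cexp ((2 * PI * t)%R + - CLogProd r t))).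
      + apply Cder_vertical, HD, Hs.
      + apply (Cder_exp (fun t : R => ((2 * PI * t)%R + - CLogProd r t)%C)).
        apply (Cder_plus (fun t : R => RtoC (2 * PI * t)) (fun t => - CLogProd r t)%C).
        * apply (Cder_RtoC (fun t => 2 * PI * t) s (2 * PI)); auto_derive; [trivial|ring].
        * apply Cder_opp, Cder_CLogProd, Hs.
    - cbv beta.
      assert (I2 : (Ci * Ci)%C = (- (1))%C) by (apply C_eq; simpl; ring).
      generalize (Cexp ((2 * PI * s)%R + - CLogProd r s)) (Ql (r, s)) (E6 (r, s)); intros c q e.
      rewrite RtoC_mult.
      replace (Ci * (2 * PI * Ci * e * q) * c)%C with ((Ci * Ci) * (2 * PI * e * q) * c)%C by ring.
      rewrite I2; ring. }
  set (c0 := Z 1).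
  assert (HQ : forall t, 0 < t -> Ql (r, t) = (c0 * (Cexp (- (2 * PI * t)%R) * Cexp (CLogProd r t)))%C).
  { intros t Ht; unfold c0; rewrite (Cder_zero_const Z 1 t) by (lra || assumption).
    unfold Z; rewrite <- !Cmult_assoc, <- !Cexp_plus.
    replace (_ + (- (2 * PI * t)%R + CLogProd r t))%C with (RtoC 0) by ring.
    rewrite Cexp_0; ring. }
  set (e := Cexp (0, (2 * PI * r)%R)).
  assert (HN : forall t, nome (r, t) = (Cexp (- (2 * PI * t)%R) * e)%C).
  { intros t; rewrite nome_vertical; unfold e; rewrite <- Cexp_plus; f_equal.
    apply C_eq; simpl; ring. }
  set (B := 274 * Series (fun n => / INR (S n) ^ 2)).
  (* Dividing the leading-term estimate by [|q| = e^(-x)] leaves an error that decays with [t],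
     whereas [e + c0] does not depend on [t]. *)
  assert (E0 : Cmod (e + c0)%C = 0).
  { apply (eq_0_of_inv_bound _
      (Rabs K * Cmod c0 ^ 2 * exp (4 * Rabs B) + Cmod c0 * (4 * Rabs B * exp (2 * Rabs B))) M).
    intros t Ht1 Ht2; rewrite (Rabs_pos_eq (Cmod _)) by apply Cmod_ge_0.
    set (x := 2 * PI * t); set (w := CLogProd r t).
    assert (Hx : t <= x) by (unfold x; pose proof PI2_1; nra).
    pose proof (Rle_abs B) as AB; pose proof (Rabs_pos B) as AB0.
    assert (IX : / x <= / t) by (apply Rinv_le_contravar; lra).
    assert (IX0 : 0 < / x) by (apply Rinv_0_lt_compat; lra).
    assert (W : Cmod w <= 2 * (Rabs B * / x)).
    { apply Cmod_parts_le; intros re.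
      assert (X : Rabs (LogProd re (2 * PI * r) x) <= B / x) by (apply LogProd_large; lra).
      replace (Cpart re w) with (LogProd re (2 * PI * r) x) by (destruct re; reflexivity).
      eapply Rle_trans; [exact X|]; apply Rmult_le_compat_r; lra. }
    assert (IT1 : / t <= 1) by (rewrite <- Rinv_1; apply Rinv_le_contravar; lra).
    assert (W2 : Cmod w <= 2 * Rabs B) by nra.
    pose proof (HK (r, t) Ht1) as Hk.
    rewrite HN, HQ in Hk by lra; fold x w in Hk.
    replace (Cexp (- x) * e + c0 * (Cexp (- x) * Cexp w))%C
      with (Cexp (- x) * (e + c0 * Cexp w))%C in Hk by ring.
    rewrite !Cmod_mult, !Cexp_mod in Hk.
    change (Re (- x)%C) with (- x) in Hk.
    pose proof (exp_pos (- x)) as EX.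
    assert (H1 : Cmod (e + c0 * Cexp w)%C <= Rabs K * Cmod c0 ^ 2 * exp (4 * Rabs B) * exp (- x)).
    { apply Rmult_le_reg_l with (exp (- x)); [exact EX|].
      eapply Rle_trans; [exact Hk|].
      replace (K * (Cmod c0 * (exp (- x) * exp (Re w))) ^ 2) with
        (exp (- x) * (K * (Cmod c0 ^ 2 * (exp (Re w) * exp (Re w)) * exp (- x)))) by ring.
      apply Rmult_le_compat_l; [lra|].
      rewrite <- exp_plus.
      assert (R2 : exp (Re w + Re w) <= exp (4 * Rabs B)).
      { apply exp_le; pose proof (re_le_Cmod w) as Q; apply Rabs_le_between in Q; lra. }
      pose proof (exp_pos (Re w + Re w)).
      pose proof (Rle_abs K); pose proof (Rabs_pos K); pose proof (Cmod_ge_0 c0).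
      apply Rle_trans with (Rabs K * (Cmod c0 ^ 2 * exp (Re w + Re w) * exp (- x))).
      - apply Rmult_le_compat_r; [|assumption].
        repeat apply Rmult_le_pos; try apply pow2_ge_0; lra.
      - rewrite !Rmult_assoc; repeat (apply Rmult_le_compat_l; [try apply pow2_ge_0; lra|]).
        apply Rmult_le_compat_r; lra. }
    assert (EXx : exp (- x) <= / x).
    { pose proof (exp_neg_mul x ltac:(lra)).
      apply Rmult_le_reg_l with x; [lra|]; rewrite Rinv_r by lra; exact H. }
    assert (H2 : Cmod (Cexp w - 1)%C <= 2 * (2 * (Rabs B * / x) * exp (2 * Rabs B))).
    { eapply Rle_trans; [apply Cexp_minus_1_bound|]; apply Rmult_le_compat_l; [lra|].
      apply Rmult_le_compat; [apply Cmod_ge_0|apply Rlt_le, exp_pos|exact W|apply exp_le, W2]. }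
    replace (e + c0)%C with ((e + c0 * Cexp w) + - (c0 * (Cexp w - 1)))%C by ring.
    eapply Rle_trans; [apply Cmod_triangle|]; rewrite Cmod_opp, Cmod_mult.
    pose proof (Cmod_ge_0 c0).
    apply Rle_trans with (Rabs K * Cmod c0 ^ 2 * exp (4 * Rabs B) * / t
       + Cmod c0 * (4 * Rabs B * exp (2 * Rabs B)) * / t); [|right; unfold Rdiv; ring].
    apply Rplus_le_compat.
    - eapply Rle_trans; [exact H1|]; apply Rmult_le_compat_l; [|lra].
      repeat apply Rmult_le_pos; try apply Rabs_pos; try lra; apply Rlt_le, exp_pos.
    - rewrite Rmult_assoc; apply Rmult_le_compat_l; [assumption|].
      eapply Rle_trans; [exact H2|].
      replace (2 * (2 * (Rabs B * / x) * exp (2 * Rabs B))) with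
        (4 * Rabs B * exp (2 * Rabs B) * / x) by ring.
      apply Rmult_le_compat_l; [|exact IX].
      repeat apply Rmult_le_pos; try lra; apply Rlt_le, exp_pos. }
  intros t Ht; rewrite HQ, HN by exact Ht.
  apply Cmod_eq_0 in E0.
  replace c0 with (- e + (e + c0))%C by ring; rewrite E0; ring.
Qed.

(** * Limits of the class sums *)

Lemma is_RS_ext_weight K h k f l : (forall n, h n = k n) -> is_RS K h f l -> is_RS K k f l.
Proof.
  revert h k f l; induction K as [|K IH]; intros h k f l E; simpl.
  - apply is_series_ext; intros n; rewrite E; reflexivity.
  - assert (P : forall n, psum h n = psum k n) by (intros n; apply psum_ext; auto).
    assert (A : forall n, antidiff h n = antidiff k n).
    { intros n; unfold antidiff, mean6; rewrite !P; reflexivity. }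
    rewrite A; apply IH; intros n; apply A.
Qed.

Lemma psum_scal c h n : psum (fun i => c * h i) n = c * psum h n.
Proof. induction n as [|n IH]; [simpl; ring|]; rewrite !psum_S, IH; ring. Qed.

Lemma is_RS_scal_weight K c h f l : is_RS K h f l -> is_RS K (fun n => c * h n) f (c * l).
Proof.
  revert h f l; induction K as [|K IH]; intros h f l H; simpl in *.
  - apply is_series_ext with (fun n => scal c (h n * f n)).
    { intros n; unfold scal; simpl; unfold mult; simpl; ring. }
    apply (is_series_scal (V := R_NormedModule)), H.
  - assert (A : forall n, antidiff (fun n => c * h n) n = c * antidiff h n).
    { intros n; unfold antidiff, mean6; rewrite !psum_scal; field. }
    rewrite A; apply IH in H.
    match type of H with is_RS _ _ _ ?x => replace (_ - c * l) with x by ring end.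
    eapply is_RS_ext_weight; [|exact H]; intros n; symmetry; apply A.
Qed.

Definition affine (r N : R) (j : nat) : R := r + N * INR j.

(** The second differences of an affine sequence vanish, so its regularised sum reduces to the first
    two boundary terms. *)
Definition RS_affine (h : nat -> R) (r N : R) : R :=
  - antidiff h 0 * r + antidiff (antidiff_shift h) 0 * N.

Lemma is_RS_affine h r N : is_RS 3 h (affine r N) (RS_affine h r N).
Proof.
  assert (D1 : forall n, fdiff (affine r N) n = N).
  { intros n; unfold fdiff, affine; rewrite S_INR; ring. }
  cbn [is_RS].
  assert (D2 : forall n, fdiff (fdiff (affine r N)) n = 0).
  { intros n; unfold fdiff at 1; rewrite !D1; ring. }
  rewrite D2, D1; unfold RS_affine.
  match goal with |- is_series _ ?x => assert (E : @eq R x 0) by (unfold affine; simpl; ring); rewrite E end.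
  apply is_series_psum, is_lim_seq_ext with (fun _ => 0); [|apply is_lim_seq_const].
  intros n; rewrite (psum_ext _ (fun _ => 0)), psum_zero; [reflexivity|].
  intros i _; unfold fdiff at 1; rewrite !D2; ring.
Qed.

Lemma fdiffn_affine r N n : fdiffn 3 (affine r N) n = 0.
Proof. unfold fdiffn, fdiff, affine; rewrite !S_INR; ring. Qed.

Lemma filterlim_fdiffn {T} (F : (T -> Prop) -> Prop) {FF : Filter F} K (f : T -> nat -> R) g n :
  (forall n, filterlim (fun x => f x n) F (locally (g n))) ->
  filterlim (fun x => fdiffn K (f x) n) F (locally (fdiffn K g n)).
Proof.
  revert f g n; induction K as [|K IH]; intros f g n H; simpl; [apply H|].
  apply (IH (fun x => fdiff (f x))); intros m; unfold fdiff, Rminus.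
  eapply filterlim_comp_2; [apply H| |apply (filterlim_plus (V := R_NormedModule))].
  eapply filterlim_comp; [apply H|apply (filterlim_opp (V := R_NormedModule))].
Qed.

Lemma filterlim_Rabs_le {T} (F : (T -> Prop) -> Prop) {FF : ProperFilter F} (f : T -> R) l M :
  filterlim f F (locally l) -> F (fun x => Rabs (f x) <= M) -> Rabs l <= M.
Proof.
  intros Hf HM; apply Rnot_lt_le; intros H.
  pose proof (proj1 (filterlim_R_spec F f l) Hf (Rabs l - M) ltac:(lra)) as X.
  destruct (filter_ex _ (filter_and _ _ X HM)) as [x [X1 X2]].
  rewrite Rabs_minus_sym in X1; pose proof (Rabs_triang_inv l (f x)); lra.
Qed.

Lemma at_right_pos : at_right 0 (fun x => 0 < x).
Proof. exists (mkposreal 1 Rlt_0_1); intros y _ Hy; exact Hy. Qed.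

Definition class_fun (re : bool) (th r N x : R) (j : nat) : R :=
  affine r N j * log1m re th (affine r N j * x).

(** The source of uniformity: the sequence is [ylog / x] on a grid of step [N x] with nodes above
    [x (n + 1)], and in [(1 / x) (N x)^3 / (x (n + 1))^2] all powers of [x] cancel. *)
Lemma fdiffn_class_fun re th r N x n : (1 <= r)%nat -> (1 <= N)%nat -> 0 < x ->
  Rabs (fdiffn 3 (class_fun re th (INR r) (INR N) x) n) <= 486 * INR N ^ 3 * / INR (S n) ^ 2.
Proof.
  intros Hr HN Hx.
  apply (le_INR 1) in Hr; apply (le_INR 1) in HN; simpl in Hr, HN.
  pose proof (pos_INR n) as Hn.
  set (y0 := INR r * x + INR N * x * INR n).
  assert (Y0 : x * INR (S n) <= y0) by (unfold y0; rewrite S_INR; assert (0 <= x * INR n) by nra; nra).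
  assert (Pn : 0 < INR (S n)) by apply lt_0_INR, Nat.lt_0_succ.
  assert (Y1 : 0 < y0) by (eapply Rlt_le_trans; [|exact Y0]; apply Rmult_lt_0_compat; assumption).
  rewrite (fdiffn_ext 3 _ (fun j => / x * ylog re th 0 (INR r * x + INR N * x * INR j)
      + 0 * ylog re th 0 (INR r * x + INR N * x * INR j))).
  2: { intros j; unfold class_fun, affine; simpl ylog.
       replace ((INR r + INR N * INR j) * x) with (INR r * x + INR N * x * INR j) by ring.
       field; lra. }
  rewrite fdiffn_lin, Rmult_0_l, Rplus_0_r, Rabs_mult, Rabs_inv, (Rabs_pos_eq x) by lra.
  assert (B : Rabs (fdiffn 3 (fun j => ylog re th 0 (INR r * x + INR N * x * INR j)) n)
     <= 486 / y0 ^ 2 * (INR N * x) ^ 3).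
  { apply (fdiffn_derivative_abs 3 (ylog re th)); [nra| |].
    - intros k y Hk Hy; apply is_derive_ylog; [exact Hk|fold y0 in Hy; lra].
    - intros y Hy; fold y0 in Hy; eapply Rle_trans; [apply ylog_third_bound; lra|].
      apply Rmult_le_compat_l; [lra|]; apply Rinv_le_contravar;
        [apply pow_lt, Y1|apply pow_incr; lra]. }
  apply Rle_trans with (/ x * (486 / (x * INR (S n)) ^ 2 * (INR N * x) ^ 3)).
  - apply Rmult_le_compat_l; [apply Rlt_le, Rinv_0_lt_compat, Hx|].
    eapply Rle_trans; [exact B|]; apply Rmult_le_compat_r; [apply pow_le; nra|].
    apply Rmult_le_compat_l; [lra|]; apply Rinv_le_contravar.
    + apply pow_lt, Rmult_lt_0_compat; assumption.
    + apply pow_incr; split; [apply Rlt_le, Rmult_lt_0_compat; assumption|exact Y0].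
  - right; field; lra.
Qed.

Lemma affine_INR r N j : affine (INR r) (INR N) j = INR (r + N * j).
Proof. unfold affine; rewrite plus_INR, mult_INR; reflexivity. Qed.

Lemma class_fun_bound re th r N x j : (1 <= r)%nat -> (1 <= N)%nat -> 0 < x ->
  Rabs (class_fun re th (INR r) (INR N) x j) <= 274 / x ^ 4 * / INR (S j) ^ 2.
Proof.
  intros Hr HN Hx; unfold class_fun; rewrite affine_INR.
  assert (Hm : (S j <= r + N * j)%nat) by nia.
  rewrite <- (Rmult_1_l (INR (r + N * j))) at 1.
  eapply Rle_trans; [apply lambert_bound1 with (x := x); [exact Hx|lia|rewrite Rabs_R1; lra|]|].
  - apply log1m_abs, Rmult_lt_0_compat; [apply lt_0_INR; lia|exact Hx].
  - assert (0 < x ^ 4) by (apply pow_lt, Hx).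
    assert (P : 0 < INR (S j)) by apply lt_0_INR, Nat.lt_0_succ.
    apply Rmult_le_compat_l; [apply Rlt_le, Rdiv_lt_0_compat; lra|].
    apply Rinv_le_contravar; [apply pow_lt, P|]; apply pow_incr; split; [lra|apply le_INR, Hm].
Qed.

(** [c] absorbs a possible logarithmic divergence. *)
Lemma class_limit re th r N h (c : R -> R) g l0 :
  (1 <= r)%nat -> (1 <= N)%nat -> balanced h ->
  (forall j, filterlim (fun x => class_fun re th (INR r) (INR N) x j - c x * affine (INR r) (INR N) j)
     (at_right 0) (locally (g j))) ->
  is_RS 3 h g l0 ->
  filterlim (fun x => Series (fun j => h j * class_fun re th (INR r) (INR N) x j)
     - c x * RS_affine h (INR r) (INR N)) (at_right 0) (locally l0).
Proof.
  intros Hr HN Bh Hg Hl0.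
  set (f := fun x j => class_fun re th (INR r) (INR N) x j - c x * affine (INR r) (INR N) j).
  (* The subtracted multiple of an affine sequence has no third difference, so the uniform bound is
     unchanged. *)
  assert (Hf : at_right 0 (fun x => forall n, Rabs (fdiffn 3 (f x) n) <= 486 * INR N ^ 3 * / INR (S n) ^ 2)).
  { generalize at_right_pos; apply filter_imp; intros x Hx n; unfold f.
    rewrite (fdiffn_ext 3 _ (fun j => 1 * class_fun re th (INR r) (INR N) x j
      + - c x * affine (INR r) (INR N) j)) by (intros; ring).
    rewrite fdiffn_lin, fdiffn_affine, Rmult_1_l, Rmult_0_r, Rplus_0_r.
    apply fdiffn_class_fun; assumption. }
  apply (filterlim_RS_dominated (at_right 0) 3 h f g (fun n => 486 * INR N ^ 3 * / INR (S n) ^ 2)).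
  - exact Bh.
  - exact Hf.
  - intros n; apply (filterlim_Rabs_le (at_right 0) (fun x => fdiffn 3 (f x) n)).
    + apply (filterlim_fdiffn (at_right 0) 3 f g n Hg).
    + revert Hf; apply filter_imp; intros x Hx; apply Hx.
  - apply ex_series_pow_const.
  - exact Hg.
  - generalize at_right_pos; apply filter_imp; intros x Hx.
    assert (E : ex_series (fun j => h j * class_fun re th (INR r) (INR N) x j)).
    { apply ex_series_mul_bounded with (2 := fun j => class_fun_bound re th r N x j Hr HN Hx);
        [exact Bh|apply ex_series_pow_const]. }
    (* At fixed [x > 0] the series converges absolutely, so its sum is also its regularised value of
       order 3. *)
    assert (R0 : is_RS 0 h (class_fun re th (INR r) (INR N) x)
       (Series (fun j => h j * class_fun re th (INR r) (INR N) x j))) by apply Series_correct, E.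
    apply (is_RS_add 0 3 h) in R0; [|exact Bh|].
    2: { apply is_lim_seq_dominated_inv_sq with (274 / x ^ 4); intros j; apply class_fun_bound; assumption. }
    pose proof (is_RS_lin 3 h _ _ _ _ 1 (- c x) R0 (is_RS_affine h (INR r) (INR N))) as X.
    eapply is_RS_ext in X.
    + match type of X with is_RS _ _ _ ?y => replace (_ - _) with y by ring end; exact X.
    + intros j; unfold f; ring.
  - exact Hl0.
Qed.

Lemma cos_sin_period_Z th k :
  cos (th + 2 * IZR k * PI) = cos th /\ sin (th + 2 * IZR k * PI) = sin th.
Proof.
  destruct (Z_le_gt_dec 0 k) as [H|H].
  - rewrite <- (Z2Nat.id k H), <- INR_IZR_INZ; split; [apply cos_period|apply sin_period].
  - set (n := Z.to_nat (- k)).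
    assert (E : IZR k = - INR n) by (unfold n; rewrite INR_IZR_INZ, Z2Nat.id, opp_IZR by lia; ring).
    rewrite E; rewrite <- (cos_period _ n), <- (sin_period _ n).
    replace (th + 2 * - INR n * PI + 2 * INR n * PI) with th by ring; split; reflexivity.
Qed.

Lemma log1m_period re th k y : log1m re (th + 2 * IZR k * PI) y = log1m re th y.
Proof. unfold log1m; destruct (cos_sin_period_Z th k) as [-> ->]; reflexivity. Qed.

Lemma log1m_true_opp th y : log1m true (- th) y = log1m true th y.
Proof. unfold log1m; rewrite cos_neg; reflexivity. Qed.

Lemma log1m_continuous re th : cos th <> 1 -> continuous (log1m re th) 0.
Proof.
  intros H; pose proof (COS_bound th).
  apply (ex_derive_continuous (V := R_NormedModule)).
  destruct re; unfold log1m; auto_derive; rewrite Ropp_0, exp_0; [nra|lra].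
Qed.

Lemma filterlim_scaled_at_right (m : R) (f : R -> R) : 0 < m -> continuous f 0 ->
  filterlim (fun x => f (m * x)) (at_right 0) (locally (f 0)).
Proof.
  intros Hm Hf.
  assert (C : continuous (fun x => f (m * x)) 0).
  { apply (continuous_comp (fun x => m * x) f).
    - apply (ex_derive_continuous (V := R_NormedModule)); auto_derive; trivial.
    - rewrite Rmult_0_r; exact Hf. }
  unfold continuous in C; rewrite Rmult_0_r in C.
  eapply filterlim_filter_le_1; [|exact C]; apply filter_le_within.
Qed.

(** Here [1 - e^(i th)] is not zero, so [log (1 - z)] is continuous up to the circle and all terms
    of the class share the same logarithm in the limit. *)
Lemma regular_class_limit re th r N h :
  (1 <= r)%nat -> (1 <= N)%nat -> balanced h -> cos th <> 1 ->
  filterlim (fun x => Series (fun j => h j * class_fun re th (INR r) (INR N) x j))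
    (at_right 0) (locally (log1m re th 0 * RS_affine h (INR r) (INR N))).
Proof.
  intros Hr HN Bh Hth.
  apply filterlim_ext with (fun x => Series (fun j => h j * class_fun re th (INR r) (INR N) x j)
     - 0 * RS_affine h (INR r) (INR N)); [intros x; ring|].
  apply (class_limit re th r N h (fun _ => 0) (fun j => log1m re th 0 * affine (INR r) (INR N) j));
    try assumption.
  - intros j; rewrite affine_INR.
    assert (P : 0 < INR (r + N * j)) by (apply lt_0_INR; lia).
    apply filterlim_ext with (fun x => INR (r + N * j) * log1m re th (INR (r + N * j) * x)).
    { intros x; unfold class_fun; rewrite affine_INR; ring. }
    rewrite (Rmult_comm (log1m re th 0)).
    eapply filterlim_comp; [apply (filterlim_scaled_at_right _ _ P (log1m_continuous re th Hth))|].
    apply (filterlim_scal_r (K := R_AbsRing) (V := R_NormedModule) (INR (r + N * j)) (log1m re th 0)).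
  - pose proof (is_RS_affine h (INR r) (INR N)) as A.
    pose proof (is_RS_lin 3 h _ _ _ _ (log1m re th 0) 0 A A) as X.
    eapply is_RS_ext in X.
    + match type of X with is_RS _ _ _ ?y => replace (_ * RS_affine _ _ _) with y by ring end; exact X.
    + intros j; cbv beta; ring.
Qed.

Lemma log1m_true_0 y : 0 < y -> log1m true 0 y = ln (1 - exp (- y)).
Proof.
  intros H; pose proof (exp_neg_bounds y H); unfold log1m; rewrite cos_0.
  replace (1 - 2 * exp (- y) * 1 + exp (- y) ^ 2) with ((1 - exp (- y)) ^ 2) by ring.
  rewrite ln_pow by lra; simpl INR; field.
Qed.

Lemma log1m_false_0 y : log1m false 0 y = 0.
Proof. unfold log1m; rewrite sin_0, Rmult_0_r; unfold Rdiv; rewrite Rmult_0_l, atan_0; ring. Qed.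

Lemma filterlim_one_minus_exp m : 0 < m ->
  filterlim (fun x => (1 - exp (- (m * x))) / x) (at_right 0) (locally m).
Proof.
  intros Hm; apply filterlim_R_spec; [typeclasses eauto|]; intros eps He.
  assert (D : derivable_pt_lim (fun x => 1 - exp (- (m * x))) 0 m).
  { apply is_derive_Reals; auto_derive; [trivial|]; rewrite Rmult_0_r, Ropp_0, exp_0; ring. }
  destruct (D eps He) as [d Hd]; exists d; intros y Hy Hpos.
  assert (Hy' : Rabs y < d).
  { unfold ball in Hy; simpl in Hy; unfold AbsRing_ball, abs, minus, plus, opp in Hy; simpl in Hy.
    rewrite Ropp_0, Rplus_0_r in Hy; exact Hy. }
  specialize (Hd y ltac:(lra) Hy').
  rewrite Rplus_0_l, Rmult_0_r, Ropp_0, exp_0 in Hd.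
  replace (1 - exp (- (m * y)) - (1 - 1)) with (1 - exp (- (m * y))) in Hd by ring; exact Hd.
Qed.

(** Here [ln (1 - e^(-m x)) - ln x] tends to [ln m], and the divergent [ln x] multiplies the
    regularised sum of [h m], which is zero. With [m = N (j + 1)] the same vanishing removes the
    contribution of [ln N]. *)
Lemma singular_class_limit N h kap :
  (1 <= N)%nat -> balanced h -> (forall j, h j = kap * chiS j) ->
  RS_affine h (INR N) (INR N) = 0 ->
  filterlim (fun x => Series (fun j => h j * class_fun true 0 (INR N) (INR N) x j))
    (at_right 0) (locally (kap * INR N * RS_mlnm)).
Proof.
  intros HN Bh Hh H0.
  apply filterlim_ext with (fun x => Series (fun j => h j * class_fun true 0 (INR N) (INR N) x j)
     - ln x * RS_affine h (INR N) (INR N)); [intros x; rewrite H0; ring|].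
  assert (PN : 0 < INR N) by (apply lt_0_INR; lia).
  apply (class_limit true 0 N N h ln (fun j => INR N * mlnm j + ln (INR N) * affine (INR N) (INR N) j));
    try assumption.
  - intros j.
    set (m := affine (INR N) (INR N) j).
    assert (Em : m = INR N * INR (S j)) by (unfold m, affine; rewrite S_INR; ring).
    assert (Pj : 0 < INR (S j)) by apply lt_0_INR, Nat.lt_0_succ.
    assert (Pm : 0 < m) by (rewrite Em; apply Rmult_lt_0_compat; assumption).
    replace (INR N * mlnm j + ln (INR N) * m) with (m * ln m).
    2: { rewrite Em, ln_mult by assumption; unfold mlnm; ring. }
    apply filterlim_ext_loc with (fun x => m * ln ((1 - exp (- (m * x))) / x)).
    { generalize at_right_pos; apply filter_imp; intros x Hx.
      unfold class_fun; fold m.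
      assert (0 < m * x) by (apply Rmult_lt_0_compat; assumption).
      rewrite log1m_true_0 by assumption.
      pose proof (exp_neg_bounds (m * x) H).
      unfold Rdiv; rewrite ln_mult, ln_Rinv by (try apply Rinv_0_lt_compat; lra); ring. }
    eapply filterlim_comp; [|apply (filterlim_scal_r (K := R_AbsRing) (V := R_NormedModule) m (ln m))].
    eapply filterlim_comp; [apply filterlim_one_minus_exp, Pm|].
    apply (ex_derive_continuous (V := R_NormedModule) ln m); eexists; apply is_derive_ln, Pm.
  - pose proof (is_RS_scal_weight 3 kap chiS mlnm _ is_RS_mlnm) as M.
    eapply is_RS_ext_weight in M; [|intros n; symmetry; apply Hh].
    pose proof (is_RS_lin 3 h _ _ _ _ (INR N) (ln (INR N)) M (is_RS_affine h (INR N) (INR N))) as X.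
    rewrite H0 in X.
    match type of X with is_RS _ _ _ ?y => replace (kap * INR N * RS_mlnm) with y by ring end.
    exact X.
Qed.

(** * Arithmetic of the weights modulo 6 *)

Definition beta6 (n : nat) : R :=
  match n with 1%nat | 2%nat => 1 | 4%nat | 5%nat => -1 | _ => 0 end.

Lemma beta_mod n : beta n = beta6 (n mod 6).
Proof.
  pose proof (Nat.div_mod_eq n 6) as E.
  pose proof (Nat.mod_upper_bound n 6 ltac:(lia)) as B.
  set (q := (n / 6)%nat) in *; set (s := (n mod 6)%nat) in *.
  rewrite E; unfold beta.
  replace (Nat.even (6 * q + s)) with (Nat.even s)
    by (rewrite Nat.even_add, Nat.even_mul; simpl; destruct (Nat.even s); reflexivity).
  replace (chi32 (6 * q + s)) with (chi32 s).
  2: { unfold chi32; replace (6 * q + s)%nat with (s + (2 * q) * 3)%nat by lia.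
       rewrite Nat.Div0.mod_add; reflexivity. }
  do 6 (destruct s as [|s]; [unfold chi32; simpl; ring|]); lia.
Qed.

Definition class_weight (r N j : nat) : R := beta (r + N * j).

Lemma class_weight_mod r N j :
  class_weight r N j = beta6 ((r mod 6 + N mod 6 * j) mod 6).
Proof.
  unfold class_weight; rewrite beta_mod; f_equal.
  rewrite Nat.Div0.add_mod_idemp_l, <- (Nat.Div0.add_mod_idemp_r _ (N mod 6 * j)).
  rewrite Nat.Div0.mul_mod_idemp_l, Nat.Div0.add_mod_idemp_r; reflexivity.
Qed.

(** The residues of [|c|] at the two cusps: 3 in case 6I, and 2 or 4 in case 6II according to the
    sign of [c]. *)
Definition good_level (N : nat) : Prop :=
  (N mod 6 = 2 \/ N mod 6 = 3 \/ N mod 6 = 4)%nat.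

Lemma mod6_cases (n : nat) : (n mod 6 = 0 \/ n mod 6 = 1 \/ n mod 6 = 2 \/ n mod 6 = 3
  \/ n mod 6 = 4 \/ n mod 6 = 5)%nat.
Proof. pose proof (Nat.mod_upper_bound n 6 ltac:(lia)); lia. Qed.

Lemma balanced_class_weight r N : good_level N -> balanced (class_weight r N).
Proof.
  intros G; split.
  - intros n; unfold class_weight; rewrite !beta_mod; f_equal.
    replace (r + N * (n + 6))%nat with (r + N * n + N * 6)%nat by lia.
    apply Nat.Div0.mod_add.
  - simpl; rewrite !class_weight_mod.
    destruct G as [->|[->| ->]]; destruct (mod6_cases r) as [->|[->|[->|[->|[->| ->]]]]]; simpl; lra.
Qed.

Lemma RS_affine_values h r N : RS_affine h r N =
  (5 * h 0%nat + 4 * h 1%nat + 3 * h 2%nat + 2 * h 3%nat + h 4%nat) / 6 * r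
  - (15 * h 0%nat - 9 * h 2%nat - 12 * h 3%nat - 9 * h 4%nat) / 36 * N.
Proof. unfold RS_affine, antidiff_shift, antidiff, mean6; simpl; field. Qed.

Definition class_sum (r N : nat) : R := RS_affine (class_weight r N) (INR r) (INR N).

(** The regularised sum of [m beta(m)] over a class combines values of the Bernoulli polynomial
    [B_2], symmetric under [x -> 1 - x], with the odd weights [beta]. The proof checks the residues
    modulo 6 directly. *)
Lemma class_sum_antisym r r' : good_level (r + r') ->
  class_sum r (r + r') = - class_sum r' (r + r').
Proof.
  unfold good_level; intros G; unfold class_sum.
  rewrite !RS_affine_values, !class_weight_mod, plus_INR.
  rewrite (Nat.Div0.add_mod r r' 6) in G |- *.
  destruct (mod6_cases r) as [E|[E|[E|[E|[E|E]]]]];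
  destruct (mod6_cases r') as [E'|[E'|[E'|[E'|[E'|E']]]]];
  rewrite E, E' in *; simpl in G; try (exfalso; lia); simpl; lra.
Qed.

Lemma class_sum_diag N : good_level N -> class_sum N N = 0.
Proof.
  intros G; unfold class_sum; rewrite !RS_affine_values, !class_weight_mod.
  destruct G as [->|[->| ->]]; simpl; lra.
Qed.

(** The factor in [beta(N m) = level_sign N * chi(m)]: the parity of [N] contributes [-1] for even
    [N], and [chi(N)] is [-1], [1] or [0]. *)
Definition level_sign (N : nat) : R :=
  match (N mod 6)%nat with 2%nat => 1 | 4%nat => -1 | _ => 0 end.

Lemma class_weight_diag N j : good_level N -> class_weight N N j = level_sign N * chiS j.
Proof.
  intros G; induction j as [j IH] using lt_wf_ind.
  destruct (le_lt_dec 6 j) as [D|D].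
  - replace j with ((j - 6) + 6)%nat by lia.
    rewrite (proj1 (balanced_class_weight N N G)), (proj1 balanced_chiS); apply IH; lia.
  - rewrite class_weight_mod; unfold level_sign.
    destruct G as [->|[->| ->]]; do 6 (destruct j as [|j];
      [unfold chiS, chi32; simpl; ring|]); lia.
Qed.

(** * Rationality of the limiting arguments *)

Definition is_rational (x : R) : Prop :=
  exists p q : Z, (0 < q)%Z /\ x = IZR p / IZR q.

Lemma is_rational_IZR p : is_rational (IZR p).
Proof. exists p, 1%Z; split; [lia|]; field. Qed.

Lemma is_rational_INR n : is_rational (INR n).
Proof. rewrite INR_IZR_INZ; apply is_rational_IZR. Qed.

Lemma is_rational_plus x y : is_rational x -> is_rational y -> is_rational (x + y).
Proof.
  intros [p [q [Hq ->]]] [p' [q' [Hq' ->]]].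
  exists (p * q' + p' * q)%Z, (q * q')%Z; split; [nia|].
  rewrite plus_IZR, !mult_IZR; field; split; apply not_0_IZR; lia.
Qed.

Lemma is_rational_mult x y : is_rational x -> is_rational y -> is_rational (x * y).
Proof.
  intros [p [q [Hq ->]]] [p' [q' [Hq' ->]]].
  exists (p * p')%Z, (q * q')%Z; split; [nia|].
  rewrite !mult_IZR; field; split; apply not_0_IZR; lia.
Qed.

Lemma is_rational_opp x : is_rational x -> is_rational (- x).
Proof.
  intros H; replace (- x) with (IZR (-1) * x) by ring.
  apply is_rational_mult; [apply is_rational_IZR|exact H].
Qed.

Lemma is_rational_minus x y : is_rational x -> is_rational y -> is_rational (x - y).
Proof. intros; apply is_rational_plus; [|apply is_rational_opp]; assumption. Qed.

Lemma is_rational_div x p : is_rational x -> (0 < p)%Z -> is_rational (x / IZR p).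
Proof.
  intros H Hp; apply is_rational_mult; [exact H|].
  exists 1%Z, p; split; [exact Hp|]; field; apply not_0_IZR; lia.
Qed.

Lemma class_sum_rational r N : is_rational (class_sum r N).
Proof.
  unfold class_sum; rewrite RS_affine_values, !class_weight_mod.
  assert (B : forall n, is_rational (beta6 n)).
  { intros n; do 6 (destruct n as [|n]; [apply is_rational_IZR|]); apply is_rational_IZR. }
  repeat first [apply is_rational_IZR | apply is_rational_INR | apply B |
    apply is_rational_minus | apply is_rational_plus |
    apply is_rational_div; [|lia] | apply is_rational_mult].
Qed.

Lemma psum_antisym f n : (forall i, (i < n)%nat -> f (n - 1 - i)%nat = - f i) -> psum f n = 0.
Proof.
  intros H.
  assert (R : forall g m, psum (fun i => g (m - 1 - i)%nat) m = psum g m).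
  { intros g; induction m as [|m IH]; [reflexivity|].
    pose proof (psum_add (fun i => g (S m - 1 - i)%nat) 1 m) as A.
    change (1 + m)%nat with (S m) in A; rewrite A.
    rewrite (psum_ext (fun i => g (S m - 1 - (1 + i))%nat) (fun i => g (m - 1 - i)%nat))
      by (intros; f_equal; lia).
    rewrite IH, !psum_S; replace (S m - 1 - 0)%nat with m by lia; simpl; ring. }
  pose proof (R f n) as E.
  rewrite (psum_ext _ (fun i => -1 * f i)), psum_scal in E by (intros i Hi; rewrite H by exact Hi; ring).
  lra.
Qed.

Lemma cos_lt_1 phi : 0 < phi < 2 * PI -> cos phi < 1.
Proof.
  intros H; replace phi with (2 * (phi / 2)) by field.
  rewrite cos_2a_sin; pose proof (sin_gt_0 (phi / 2) ltac:(lra) ltac:(lra)); nra.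
Qed.

(** This is the argument in [1 - e^(i phi) = 2 sin (phi/2) e^(i (phi - pi) / 2)]; it makes the
    arguments at rational angles rational multiples of [pi]. *)
Lemma log1m_false_boundary phi : 0 < phi < 2 * PI ->
  log1m false phi 0 = - (PI / 2 - phi / 2).
Proof.
  intros H; unfold log1m; rewrite Ropp_0, exp_0, !Rmult_1_l; f_equal.
  rewrite <- (atan_tan (PI / 2 - phi / 2)) by lra; f_equal.
  pose proof (sin_gt_0 (phi / 2) ltac:(lra) ltac:(lra)) as S.
  unfold tan; rewrite sin_shift, cos_shift.
  replace phi with (2 * (phi / 2)) at 1 2 by field.
  rewrite cos_2a_sin, sin_2a; field; repeat split; intros Z; nra.
Qed.

Lemma filterlim_psum_shift_last {T} (F : (T -> Prop) -> Prop) {FF : Filter F} (a : T -> nat -> R) b n :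
  (forall k, (k < n)%nat -> filterlim (fun x => a x k) F (locally (b k))) ->
  filterlim (fun x => psum (a x) n) F (locally (psum b n)).
Proof.
  induction n as [|n IH]; intros H; simpl; [apply filterlim_const|].
  eapply filterlim_comp_2; [apply IH; auto|apply H; lia|apply (filterlim_plus (V := R_NormedModule))].
Qed.

(** [a] is invertible modulo [N], so [r a] is not divisible by [N] when [0 < r < N]; the angle stays
    off the multiples of [2 pi]. *)
Lemma reduced_angle (N r : nat) (a : Z) : (1 <= r < N)%nat ->
  (exists u v, a * u + Z.of_nat N * v = 1)%Z ->
  exists k j : Z, (0 < j < Z.of_nat N)%Z /\
    INR r * (2 * PI * (IZR a / INR N)) = 2 * PI * (IZR j / INR N) + 2 * IZR k * PI.
Proof.
  intros Hr [u [v Huv]].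
  set (n := Z.of_nat N); set (m := (Z.of_nat r * a)%Z).
  exists (m / n)%Z, (m mod n)%Z.
  pose proof (Z.mod_pos_bound m n ltac:(lia)) as B.
  pose proof (Z.div_mod m n ltac:(lia)) as E.
  split.
  - assert (m mod n <> 0)%Z; [|lia]; intros Z0.
    assert (D : (n | Z.of_nat r)%Z).
    { exists (m / n * u + Z.of_nat r * v)%Z; fold n in Huv.
      transitivity (Z.of_nat r * (a * u + n * v))%Z; [rewrite Huv; ring|].
      transitivity (m * u + Z.of_nat r * v * n)%Z; [unfold m; ring|].
      rewrite E at 1; rewrite Z0; ring. }
    apply Z.divide_pos_le in D; lia.
  - assert (P : INR N <> 0) by (apply not_0_INR; lia).
    replace (2 * PI * (IZR (m mod n) / INR N) + 2 * IZR (m / n) * PI) with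
      (2 * PI * ((INR N * IZR (m / n) + IZR (m mod n)) / INR N)) by (field; exact P).
    rewrite (INR_IZR_INZ N); fold n; rewrite <- mult_IZR, <- plus_IZR, <- E.
    unfold m; rewrite mult_IZR, <- INR_IZR_INZ; unfold Rdiv; ring.
Qed.

Lemma LogProd_classes re (a : Z) (N : nat) x : (1 <= N)%nat -> 0 < x ->
  LogProd re (2 * PI * (IZR a / INR N)) x =
  psum (fun rho => Series (fun j => class_weight (S rho) N j *
     class_fun re (INR (S rho) * (2 * PI * (IZR a / INR N))) (INR (S rho)) (INR N) x j)) N.
Proof.
  intros HN Hx; unfold LogProd.
  rewrite (Series_classes _ _ N HN (fun n => log_term_bound re _ x n Hx)).
  apply psum_ext; intros rho _; apply Series_ext; intros j.
  unfold log_term, class_fun, class_weight; rewrite affine_INR.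
  replace (S (N * j + rho)) with (S rho + N * j)%nat by lia.
  set (m := (S rho + N * j)%nat).
  replace (INR m * (2 * PI * (IZR a / INR N))) with
    (INR (S rho) * (2 * PI * (IZR a / INR N)) + 2 * IZR (a * Z.of_nat j) * PI).
  - rewrite log1m_period; ring.
  - unfold m; rewrite plus_INR, (mult_INR N j), mult_IZR, <- INR_IZR_INZ.
    field; apply not_0_INR; lia.
Qed.

Lemma LogProd_limit (a : Z) (N : nat) :
  (1 <= N)%nat -> good_level N -> (exists u v, a * u + Z.of_nat N * v = 1)%Z ->
  filterlim (LogProd true (2 * PI * (IZR a / INR N))) (at_right 0)
    (locally (level_sign N * INR N * RS_mlnm)) /\
  exists q, is_rational q /\
    filterlim (LogProd false (2 * PI * (IZR a / INR N))) (at_right 0) (locally (PI * q)).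
Proof.
  intros HN G HB; pose proof PI_RGT_0 as HP.
  set (th := 2 * PI * (IZR a / INR N)).
  assert (PN : 0 < INR N) by (apply lt_0_INR; lia).
  assert (Eth : INR N * th = 0 + 2 * IZR a * PI) by (unfold th; field; lra).
  assert (Reg : forall r, (1 <= r < N)%nat -> cos (INR r * th) <> 1).
  { intros r Hr; destruct (reduced_angle N r a Hr HB) as [k [j [Hj E]]].
    unfold th; rewrite E, (proj1 (cos_sin_period_Z _ k)).
    apply Rlt_not_eq, cos_lt_1.
    assert (0 < IZR j < INR N) by (rewrite INR_IZR_INZ; split; apply IZR_lt; lia).
    assert (0 < IZR j / INR N < 1).
    { split; [apply Rdiv_lt_0_compat; lra|]. apply Rmult_lt_reg_r with (INR N); [exact PN|].
      unfold Rdiv; rewrite Rmult_assoc, Rinv_l by lra; lra. }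
    nra. }
  set (F := fun re x rho => Series (fun j => class_weight (S rho) N j *
     class_fun re (INR (S rho) * th) (INR (S rho)) (INR N) x j)).
  set (v := fun re rho => log1m re (INR (S rho) * th) 0 * class_sum (S rho) N).
  assert (HF : forall re l, filterlim (fun x => F re x (N - 1)%nat) (at_right 0) (locally l) ->
    filterlim (LogProd re th) (at_right 0) (locally (psum (v re) (N - 1) + l))).
  { intros re l Hl.
    apply filterlim_ext_loc with (fun x => psum (F re x) (N - 1) + F re x (N - 1)%nat).
    { generalize at_right_pos; apply filter_imp; intros x Hx.
      etransitivity; [|symmetry; apply LogProd_classes; assumption].
      change (psum (F re x) (N - 1) + F re x (N - 1)%nat = psum (F re x) N).
      rewrite <- psum_S; f_equal; lia. }
    eapply filterlim_comp_2; [|exact Hl|apply (filterlim_plus (V := R_NormedModule))].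
    apply filterlim_psum_shift_last; [typeclasses eauto|]; intros k Hk.
    apply regular_class_limit; [lia|exact HN|apply balanced_class_weight, G|apply Reg; lia]. }
  (* The classes are numbered from [1] to [N], so index [N - 1] is the class of [0], whose angle is
     a multiple of [2 pi]. *)
  assert (Last : forall re x, F re x (N - 1)%nat =
    Series (fun j => class_weight N N j * class_fun re 0 (INR N) (INR N) x j)).
  { intros re x; unfold F; replace (S (N - 1)) with N by lia.
    apply Series_ext; intros j; unfold class_fun; rewrite Eth, log1m_period; reflexivity. }
  split.
  - replace (level_sign N * INR N * RS_mlnm) with
      (psum (v true) (N - 1) + level_sign N * INR N * RS_mlnm).
    + apply HF; apply filterlim_ext with (2 := singular_class_limit N (class_weight N N)
        (level_sign N) HN (balanced_class_weight N N G) (fun j => class_weight_diag N j G)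
        (class_sum_diag N G)).
      intros x; symmetry; apply Last.
    (* Classes [i + 1] and [N - (i + 1)] have opposite angles, where the real logarithm is even, and
       opposite regularised sums. *)
    + rewrite psum_antisym; [ring|]; intros i Hi; unfold v.
      replace (class_sum (S (N - 1 - 1 - i)) N) with (- class_sum (S i) N).
      2: { pose proof (class_sum_antisym (S i) (S (N - 1 - 1 - i))) as A.
           replace (S i + S (N - 1 - 1 - i))%nat with N in A by lia.
           rewrite A by exact G; ring. }
      replace (INR (S (N - 1 - 1 - i)) * th) with (- (INR (S i) * th) + 2 * IZR a * PI).
      2: { replace (INR (S (N - 1 - 1 - i))) with (INR N - INR (S i))
             by (rewrite <- minus_INR by lia; f_equal; lia).
           replace (_ + 2 * IZR a * PI) with (INR N * th - INR (S i) * th) by (rewrite Eth; ring); ring. }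
      rewrite log1m_period, log1m_true_opp; ring.
  - assert (V : forall rho, (rho < N - 1)%nat -> exists q, is_rational q /\ v false rho = PI * q).
    { intros rho Hr; unfold v, th.
      destruct (reduced_angle N (S rho) a ltac:(lia) HB) as [k [j [Hj E]]].
      assert (0 < IZR j < INR N) by (rewrite INR_IZR_INZ; split; apply IZR_lt; lia).
      assert (0 < IZR j / INR N < 1).
      { split; [apply Rdiv_lt_0_compat; lra|]. apply Rmult_lt_reg_r with (INR N); [exact PN|].
        unfold Rdiv; rewrite Rmult_assoc, Rinv_l by lra; lra. }
      rewrite E, log1m_period, log1m_false_boundary by nra.
      exists ((IZR j / INR N - 1 / IZR 2) * class_sum (S rho) N); split; [|field; lra].
      apply is_rational_mult; [|apply class_sum_rational].
      apply is_rational_minus; [|apply is_rational_div; [apply is_rational_IZR|lia]].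
      rewrite INR_IZR_INZ; apply is_rational_div; [apply is_rational_IZR|lia]. }
    assert (W : forall n, (n <= N - 1)%nat -> exists q, is_rational q /\ psum (v false) n = PI * q).
    { induction n as [|n IH]; intros Hn.
      - exists 0; split; [apply is_rational_IZR|simpl; ring].
      - destruct (IH ltac:(lia)) as [q [Hq E]]; destruct (V n ltac:(lia)) as [q' [Hq' E']].
        exists (q + q'); split; [apply is_rational_plus; assumption|].
        rewrite psum_S, E, E'; ring. }
    destruct (W (N - 1)%nat (le_n _)) as [q [Hq E]]; exists q; split; [exact Hq|].
    replace (PI * q) with (psum (v false) (N - 1) + 0) by (rewrite E; ring).
    (* In the class of [0] each factor [1 - e^(-m x)] is a positive real and has argument zero. *)
    apply HF; apply filterlim_ext with (fun _ => 0); [|apply filterlim_const].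
    intros x; rewrite Last, (Series_ext _ (fun _ => 0 * 0)).
    + rewrite Series_scal_l; ring.
    + intros j; unfold class_fun; rewrite log1m_false_0; ring.
Qed.

(** * The transition limit *)

Lemma filterlim_C_parts {T} (F : (T -> Prop) -> Prop) {FF : Filter F} (f : T -> C) (l : C) :
  filterlim (fun x => Re (f x)) F (locally (Re l)) ->
  filterlim (fun x => Im (f x)) F (locally (Im l)) -> filterlim f F (locally l).
Proof.
  intros H1 H2 P [eps HP].
  assert (B1 := H1 _ (locally_ball (Re l) eps)).
  assert (B2 := H2 _ (locally_ball (Im l) eps)).
  unfold filtermap in *; generalize (filter_and _ _ B1 B2); apply filter_imp.
  intros x [X Y]; apply HP; split; assumption.
Qed.

Lemma filterlim_Cexp {T} (F : (T -> Prop) -> Prop) {FF : Filter F} (a b : T -> R) (l m : R) :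
  filterlim a F (locally l) -> filterlim b F (locally m) ->
  filterlim (fun x => Cexp (a x, b x)) F (locally (Cexp (l, m))).
Proof.
  intros Ha Hb.
  assert (M : forall u v : R -> R, continuous u l -> continuous v m ->
    filterlim (fun x => u (a x) * v (b x)) F (locally (u l * v m))).
  { intros u v Hu Hv; eapply filterlim_comp_2; [| |apply (filterlim_mult (K := R_AbsRing))].
    - eapply filterlim_comp; [exact Ha|exact Hu].
    - eapply filterlim_comp; [exact Hb|exact Hv]. }
  apply filterlim_C_parts; [exact FF| |]; simpl; apply M;
    apply (ex_derive_continuous (V := R_NormedModule)); auto_derive; trivial.
Qed.

Lemma root_of_unity_rational q : is_rational q -> root_of_unity (Cexp (0, (PI * q)%R)).
Proof.
  intros [a [b [Hb ->]]]; exists (Z.to_nat (2 * b)); split; [lia|].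
  rewrite Cexp_pow, INR_IZR_INZ, Z2Nat.id by lia.
  replace (_ * _)%C with ((0, (2 * IZR a * PI)%R) : C).
  2: { assert (IZR b <> 0) by (apply not_0_IZR; lia).
       rewrite mult_IZR; apply C_eq; simpl; field; assumption. }
  unfold Cexp; simpl Re; simpl Im.
  replace (2 * IZR a * PI) with (0 + 2 * IZR a * PI) by ring.
  destruct (cos_sin_period_Z 0 a) as [-> ->]; rewrite exp_0, cos_0, sin_0.
  apply C_eq; simpl; ring.
Qed.

Lemma transition_limit_level (Ql : C -> C) (a : Z) (N : nat) :
  (forall tau : C, 0 < Im tau -> is_derive Ql tau (2 * PI * Ci * E6 tau * Ql tau)%C) ->
  (exists M K : R, 0 < M /\ forall tau : C, M < Im tau ->
     Cmod (nome tau + Ql tau) <= K * Cmod (Ql tau) ^ 2) ->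
  (1 <= N)%nat -> good_level N -> (exists u v, a * u + Z.of_nat N * v = 1)%Z ->
  exists q, is_rational q /\
    is_transition_limit Ql (IZR a / INR N) (Cexp ((level_sign N * INR N * RS_mlnm)%R, (PI * q)%R)).
Proof.
  intros HD HL HN G HB; pose proof PI_RGT_0 as HP.
  destruct (LogProd_limit a N HN G HB) as [L1 [q [Hq L2]]].
  set (r := IZR a / INR N) in *.
  (* In units of [pi], the sign in [- q] contributes [1], the factor [e^(2 pi i r)] contributes
     [2 r], and the product contributes [q]. *)
  exists (1 + 2 * r + q); split.
  { apply is_rational_plus; [apply is_rational_plus; [apply is_rational_IZR|]|exact Hq].
    apply is_rational_mult; [apply is_rational_IZR|]; unfold r; rewrite INR_IZR_INZ.
    apply is_rational_div; [apply is_rational_IZR|lia]. }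
  assert (Sc : forall (f : R -> R) (l : R), filterlim f (at_right 0) (locally l) ->
    filterlim (fun t => f (2 * PI * t)) (at_right 0) (locally l)).
  { intros f l Hf; eapply filterlim_comp; [|exact Hf].
    intros P [d Hd].
    assert (D : 0 < d / (2 * PI)) by (apply Rdiv_lt_0_compat; [apply cond_pos|lra]).
    exists (mkposreal _ D); intros y Hy Hpos; apply Hd; [|nra].
    unfold ball in *; simpl in *; unfold AbsRing_ball, abs, minus, plus, opp in *; simpl in *.
    rewrite Ropp_0, Rplus_0_r in *.
    rewrite Rabs_mult, (Rabs_pos_eq (2 * PI)) by lra.
    apply (Rmult_lt_compat_l (2 * PI)) in Hy; [|lra].
    replace (2 * PI * (d / (2 * PI))) with (pos d) in Hy by (field; lra); exact Hy. }
  unfold is_transition_limit.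
  apply filterlim_ext_loc with (fun t => Cexp
    ((- (2 * PI * t) + LogProd true (2 * PI * r) (2 * PI * t))%R,
     (PI + 2 * PI * r + LogProd false (2 * PI * r) (2 * PI * t))%R)).
  { generalize at_right_pos; apply filter_imp; intros t Ht.
    rewrite (quantum_variable_vertical Ql r HD HL t Ht), nome_vertical.
    assert (EPI : Cexp (0, PI) = (- (1))%C).
    { unfold Cexp; simpl; rewrite exp_0, cos_PI, sin_PI; apply C_eq; simpl; ring. }
    replace (- _ * _)%C with (Cexp (0, PI) * (Cexp ((- (2 * PI * t))%R, (2 * PI * r)%R) * Cexp (CLogProd r t)))%C
      by (rewrite EPI; ring).
    rewrite <- !Cexp_plus; f_equal; apply C_eq; simpl; ring. }
  apply (filterlim_Cexp (at_right 0)).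
  - replace (level_sign N * INR N * RS_mlnm) with (0 + level_sign N * INR N * RS_mlnm) by ring.
    eapply filterlim_comp_2; [|apply Sc, L1|apply (filterlim_plus (V := R_NormedModule))].
    assert (Cn : continuous (fun t => - (2 * PI * t)) 0).
    { apply (ex_derive_continuous (V := R_NormedModule)); auto_derive; trivial. }
    unfold continuous in Cn; rewrite Rmult_0_r, Ropp_0 in Cn.
    eapply filterlim_filter_le_1; [|exact Cn]; apply filter_le_within.
  - replace (PI * (1 + 2 * r + q)) with ((PI + 2 * PI * r) + PI * q) by ring.
    eapply filterlim_comp_2; [apply filterlim_const|apply Sc, L2|apply (filterlim_plus (V := R_NormedModule))].
Qed.

(** A negative [c] is moved to the numerator. If [c] is 2 modulo 6, then [|c|] is 4 with level sign
    [-1], so that the exponent is [c] for either sign. *)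
Lemma transition_limit_cusp (Ql : C -> C) (a c : Z) :
  (forall tau : C, 0 < Im tau -> is_derive Ql tau (2 * PI * Ci * E6 tau * Ql tau)%C) ->
  (exists M K : R, 0 < M /\ forall tau : C, M < Im tau ->
     Cmod (nome tau + Ql tau) <= K * Cmod (Ql tau) ^ 2) ->
  (exists u v, a * u + c * v = 1)%Z -> (c mod 6 = 2 \/ c mod 6 = 3)%Z ->
  exists q, is_rational q /\
    is_transition_limit Ql (IZR a / IZR c)
      (Cexp ((if Z.eqb (c mod 6) 2 then IZR c * RS_mlnm else 0)%R, (PI * q)%R)).
Proof.
  intros HD HL [u [v HB]] Hc.
  set (N := Z.abs_nat c).
  assert (Ec : c <> 0%Z) by (intros ->; destruct Hc; discriminate).
  assert (EN : Z.of_nat N = Z.abs c) by apply Zabs2Nat.id_abs.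
  assert (Sg : (Z.sgn c = 1 \/ Z.sgn c = -1)%Z) by lia.
  assert (EM : Z.of_nat (N mod 6) = (Z.abs c mod 6)%Z) by (rewrite Nat2Z.inj_mod, EN; reflexivity).
  assert (Mod : ((Z.sgn c = 1 /\ Z.abs c mod 6 = c mod 6) \/
                (Z.sgn c = -1 /\ Z.abs c mod 6 = 6 - c mod 6))%Z).
  { destruct Sg as [S|S]; [left|right]; split; try assumption.
    - f_equal; lia.
    - replace (Z.abs c) with (- c)%Z by lia; rewrite Z.mod_opp_l_nz; lia. }
  destruct (transition_limit_level Ql (Z.sgn c * a) N HD HL) as [q [Hq H]].
  - lia.
  - unfold good_level; lia.
  - exists (Z.sgn c * u)%Z, (Z.sgn c * v)%Z; rewrite EN, <- HB.
    destruct Sg as [S|S]; rewrite S; [replace (Z.abs c) with c by lia|replace (Z.abs c) with (- c)%Z by lia]; ring.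
  - exists q; split; [exact Hq|].
    assert (EI : INR N = IZR (Z.sgn c) * IZR c).
    { rewrite INR_IZR_INZ, EN, <- mult_IZR; f_equal; lia. }
    replace (IZR a / IZR c) with (IZR (Z.sgn c * a) / INR N).
    2: { rewrite EI, mult_IZR; apply not_0_IZR in Ec; field; split; [exact Ec|].
         apply not_0_IZR; lia. }
    replace (if (c mod 6 =? 2)%Z then IZR c * RS_mlnm else 0)
      with (level_sign N * INR N * RS_mlnm); [exact H|].
    unfold level_sign; rewrite EI.
    destruct Mod as [[S M]|[S M]]; destruct Hc as [E|E]; rewrite E, S in *;
      [replace (N mod 6)%nat with 2%nat by lia|replace (N mod 6)%nat with 3%nat by lia
      |replace (N mod 6)%nat with 4%nat by lia|replace (N mod 6)%nat with 3%nat by lia];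
      simpl; ring.
Qed.

Theorem theorem0p4 :
  (forall (f g : nat -> C) (P Ql : C -> C),
     is_quantum_variable case6I f g P Ql ->
     forall r : Q, same_cusp (transition_cusp case6I) (Q2R r) ->
     exists Qr : C, is_transition_limit Ql (Q2R r) Qr /\ root_of_unity Qr)
  /\
  (exists L : C -> C, is_entire_Dirichlet_L chi32 L /\
     forall (f g : nat -> C) (P Ql : C -> C),
     is_quantum_variable case6II f g P Ql ->
     forall a c : Z, Z.gcd a c = 1%Z -> (c mod 6 = 2)%Z ->
     same_cusp (transition_cusp case6II) (IZR a / IZR c) ->
     exists Qr : C, is_transition_limit Ql (IZR a / IZR c) Qr /\
       (exists omega : C, root_of_unity omega /\
          Qr = (omega * Cexp (- IZR c * C_derive L (- (1)))) %C) /\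
       ~ root_of_unity Qr).
Proof.
  split.
  - intros f g P Ql HQ r [a [b [c [d [[Hdet [Ha [Hd Hc]]] [Hnz Hr]]]]]].
    (* The image of [1/3] is [(a + 3b) / (c + 3d)]. Its denominator is 3 modulo 6, and
       [a d - b c = 1] is itself a Bezout relation for it. *)
    destruct (transition_limit_cusp Ql (a + 3 * b) (c + 3 * d)) as [q [Hq H]].
    + apply (qv_derive _ _ _ _ _ HQ).
    + apply (qv_leading _ _ _ _ _ HQ).
    + exists d, (- b)%Z; rewrite <- Hdet; ring.
    + right; pose proof (Z.div_mod c 6); pose proof (Z.div_mod d 6).
      replace (c + 3 * d)%Z with (3 + (c / 6 + 3 * (d / 6)) * 6)%Z by lia.
      rewrite Z.mod_add by lia; reflexivity.
    + exists (Cexp (0, (PI * q)%R)); split; [|apply root_of_unity_rational, Hq].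
      replace (Q2R r) with (IZR (a + 3 * b) / IZR (c + 3 * d)).
      * replace (Z.eqb ((c + 3 * d) mod 6) 2) with false in H; [exact H|].
        pose proof (Z.div_mod c 6); pose proof (Z.div_mod d 6).
        replace (c + 3 * d)%Z with (3 + (c / 6 + 3 * (d / 6)) * 6)%Z by lia.
        rewrite Z.mod_add by lia; reflexivity.
      * rewrite Hr; simpl transition_cusp in *.
        rewrite !plus_IZR, !mult_IZR; field; repeat split; intros Z0; apply Hnz; lra.
  - exists L3; split; [exact L3_entire_Dirichlet|].
    intros f g P Ql HQ a c Hgcd Hc _.
    destruct (transition_limit_cusp Ql a c) as [q [Hq H]].
    + apply (qv_derive _ _ _ _ _ HQ).
    + apply (qv_leading _ _ _ _ _ HQ).
    + destruct (Z.gcd_bezout _ _ _ Hgcd) as [u [v E]]; exists u, v; rewrite <- E; ring.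
    + left; exact Hc.
    + rewrite Hc, Z.eqb_refl in H.
      eexists; split; [exact H|split].
      * exists (Cexp (0, (PI * q)%R)); split; [apply root_of_unity_rational, Hq|].
        rewrite C_derive_L3_m1, <- Cexp_plus; f_equal; apply C_eq; simpl; ring.
      (* The [n]-th power has modulus [exp (n c RS_mlnm)], and none of the three factors is zero. *)
      * intros [n [Hn E]].
        apply (f_equal Cmod) in E; rewrite Cexp_pow, Cexp_mod, Cmod_1, <- exp_0 in E.
        apply exp_inv in E; simpl in E.
        pose proof RS_mlnm_neg; apply lt_0_INR in Hn.
        assert (IZR c <> 0) by (apply not_0_IZR; intros ->; discriminate).
        assert (Z0 : INR n * (IZR c * RS_mlnm) = 0) by lra.
        apply Rmult_integral in Z0; destruct Z0 as [Z0|Z0]; [lra|].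
        apply Rmult_integral in Z0; lra.
Qed.
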